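(* Let $C$ be the class of all functional modules $(\mathcal{E},\Theta_A(\mathcal{E}))$, with both $\mathcal{E}$ and $\Theta_A(\mathcal{E})$ cofull, over discrete algebras $(A,\alpha)$ having approximate units, such that $\mathcal{K}_A(\mathcal{E})$ also has an approximate unit and there is a functional extension from $\mathcal{E}$ into some $A^n=(A\otimes\mathbb{C}^n,\alpha\otimes\mu)$ ($n$ any cardinality). Then: (a) $C$ contains all plain modules $A^n=(A\otimes\mathbb{C}^n,\alpha\otimes\mu)$ with $A$ having an approximate unit; and if $G$ is a finite group, $C$ contains even all plain modules $(A^n,\gamma)$ with arbitrary $G$-action $\gamma$, with $A$ having an approximate unit. (b) $C$ is closed under: (1) direct sums $\bigoplus_{i\in I}\mathcal{E}_i$ ($I$ any set) of $A$-modules $\mathcal{E}_i$ in $C$; (2) internal tensor products $\mathcal{E}\otimes_\pi B$ (change of coefficient algebra), for any $A$-module $\mathcal{E}$ in $C$ and any algebra homomorphism $\pi:A\to B$ with $B$ having an approximate unit; (3) external tensor products $\mathcal{E}\otimes\mathcal{G}$ of an $A$-module $\mathcal{E}$ in $C$ and a $B$-module $\mathcal{G}$ in $C$; (4) corner modules $\mathcal{F}\cdot M_A$, for any $A$-module $\mathcal{E}$ in $C$ and any $\mathcal{K}_A(\mathcal{E}\oplus A)$-module $\mathcal{F}$ in $C$.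
   Context: Fix a discrete group $G$. All algebras are (not necessarily unital, discrete) associative algebras over $\mathbb{C}$ which are quadratik, i.e. every element is a finite sum of products $ab$ of elements of the algebra. Every algebra $A$ carries a $G$-action $\alpha:G\to\mathrm{Aut}(A)$ (a group homomorphism), written $(A,\alpha)$; algebra homomorphisms are $G$-equivariant. An approximate unit of $A$ is a net $(x_i)_{i\in I}$ in $A$ such that for each $a\in A$ there is $j$ with $x_ia=ax_i=a$ for all $i\ge j$. Right $A$-modules are also $\mathbb{C}$-vector spaces. A $G$-action on a right $A$-module $M$ is a group homomorphism $S$ from $G$ to the invertible additive maps on $M$ with $S_g(\xi a)=S_g(\xi)\alpha_g(a)$. $\mathrm{Hom}_A(M,N)$ is the abelian group of all (not necessarily equivariant) right $A$-module homomorphisms $(M,S)\to(N,T)$, with $G$-action $g(\phi)=T_g\circ\phi\circ S_{g^{-1}}$; write $\mathrm{ad}(S)$ for this action when $(M,S)=(N,T)$. $\mathrm{Hom}_A(M,A)$ is a left $A$-module via $(a\phi)(\xi)=a\,\phi(\xi)$. A functional $A$-module is a right $A$-module $M$ with $G$-action together with a distinguished $G$-invariant left $A$-submodule $\Theta_A(M)\subseteq\mathrm{Hom}_A(M,A)$ (its functional space). $\mathcal{E}$ is cofull if every element of $\mathcal{E}$ is a finite sum $\sum_i\xi_i\phi_i(\eta_i)$ with $\xi_i,\eta_i\in\mathcal{E}$, $\phi_i\in\Theta_A(\mathcal{E})$; $\Theta_A(\mathcal{E})$ is cofull if every element of it is a finite sum $\sum_i\phi_i(\xi_i)\tau_i$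 with $\phi_i,\tau_i\in\Theta_A(\mathcal{E})$, $\xi_i\in\mathcal{E}$. The algebra $A$ is a functional module over itself with action $\alpha$ and $\Theta_A(A)=A$ acting by left multiplication. Direct sums $\bigoplus_i\mathcal{E}_i$ (finitely supported) have functional space $\bigoplus_i\Theta_A(\mathcal{E}_i)$ with $(\bigoplus\phi_i)(\bigoplus\xi_i)=\sum_i\phi_i(\xi_i)$ and the direct sum action. For any cardinality $n$, $\mathbb{C}^n$ and $A^n\cong A\otimes\mathbb{C}^n$ denote finitely supported families, with functional space $A^n$ (acting by $x\cdot a=\sum_ix_ia_i$); in $(A\otimes\mathbb{C}^n,\alpha\otimes\mu)$, $\mu$ is a $G$-action on $\mathbb{C}^n$; any $G$-action considered on $A^n$ is such that $A^n$ with functional space $A^n$ is a functional module. Compact operators: $\mathcal{K}_A(M,N)\subseteq\mathrm{Hom}_A(M,N)$ is the set of finite sums of the operators $\theta_{\eta,\phi}(\xi)=\eta\,\phi(\xi)$, $\eta\in N$, $\phi\in\Theta_A(M)$; $\mathcal{K}_A(M)=\mathcal{K}_A(M,M)$ is an algebra under composition, with action $\mathrm{ad}(S)$ for $M=(M,S)$. A homomorphism of functional $A$-modules $\mathcal{E}\to\mathcal{F}$ is a pair $(U,U^* )$ with $U:\mathcal{E}\to\mathcal{F}$ a $G$-equivariant right $A$-module homomorphism and $U^*:\Theta_A(\mathcal{E})\to\Theta_A(\mathcal{F})$ a $G$-equivariant left $A$-module homomorphism such that $U^*(\phi)(U(\xi))=\phi(\xi)$ for all $\phi,\xi$. It is a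 functional extension if $U$ is injective and for all $\phi_1,\dots,\phi_k\in\Theta_A(\mathcal{E})$ and all $\eta\in\mathcal{F}$ there is $\xi\in\mathcal{E}$ with $U^*(\phi_i)(\eta)=\phi_i(\xi)$ for all $1\le i\le k$. Internal tensor product: for a functional $(A,\alpha)$-module $(\mathcal{E},S)$ and an algebra homomorphism $\pi:(A,\alpha)\to(B,\beta)$, $\mathcal{E}\otimes_\pi B:=\mathcal{E}\otimes B/\mathrm{span}\{\xi a\otimes b-\xi\otimes\pi(a)b\}$, a right $B$-module with action $S\otimes\beta$ and functional space the linear span of the functionals $(\phi\otimes c)(\xi\otimes b)=c\,\pi(\phi(\xi))\,b$, $\phi\in\Theta_A(\mathcal{E})$, $c\in B$. External tensor product: for a functional $A$-module $(\mathcal{E},S)$ and a functional $B$-module $(\mathcal{G},T)$, the canonical functional $A\otimes B$-module $\mathcal{E}\otimes\mathcal{G}$ (tensor products over $\mathbb{C}$) with action $S\otimes T$ and functional space spanned by the functionals $(\phi\otimes\psi)(\xi\otimes\eta)=\phi(\xi)\otimes\psi(\eta)$. Corner modules: let $\mathcal{E}=(\mathcal{E},S)$ be a functional $(A,\alpha)$-module, $K=(\mathcal{K}_A(\mathcal{E}\oplus A),\mathrm{ad}(S\oplus\alpha))$ and $m_b\in K$, $m_b(\xi\oplus c)=0\oplus bc$ for $b\in A$. Let $M_A=\{m_b:b\in A\}\subseteq K$, identified with $A$. For a functional $K$-module $(\mathcal{F},T)$, $\mathcal{F}\cdot M_A:=\{\xi m_b:\xi\in\mathcal{F},b\in A\}$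 is the functional $A$-module with the restricted action of $T$, module multiplication $(\xi m_b)\cdot c=\xi m_{bc}$, and functional space $\{m_b\cdot\phi|_{\mathcal{F}\cdot M_A}:\phi\in\Theta_K(\mathcal{F}),b\in A\}$, where $(m_b\cdot\phi)(\xi m_c)=m_b\,\phi(\xi)\,m_c\in M_A\cong A$. *)

(* Defs.v *)
From HB Require Import structures.
From mathcomp Require Import all_boot all_order all_algebra complex.
From mathcomp Require Import finmap boolp classical_sets functions cardinality.
From mathcomp Require Import fsbigop reals.

Set Implicit Arguments.
Unset Strict Implicit.
Unset Printing Implicit Defensive.

Import GRing.Theory.
Local Open Scope classical_set_scope.
Local Open Scope ring_scope.
Local Open Scope quotient_scope.
Local Open Scope complex_scope.

Section LinearMaps.
Variables (K : fieldType) (V W : lmodType K).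
Implicit Type f : V -> W.

Lemma linD f : linear f -> forall x y, f (x + y) = f x + f y.
Proof. by move=> h x y; rewrite -[x]scale1r h !scale1r. Qed.

Lemma lin0 f : linear f -> f 0 = 0.
Proof. by move=> h; apply: (addrI (f 0)); rewrite -linD // !addr0. Qed.

Lemma linZ f : linear f -> forall c x, f (c *: x) = c *: f x.
Proof. by move=> h c x; rewrite -[c *: x]addr0 h lin0 // addr0. Qed.

Lemma linN f : linear f -> forall x, f (- x) = - f x.
Proof. by move=> h x; rewrite -!scaleN1r linZ. Qed.

Lemma linB f : linear f -> forall x y, f (x - y) = f x - f y.
Proof. by move=> h x y; rewrite linD // linN. Qed.

Lemma lin_sum f (I : Type) (r : seq I) (P : pred I) (F : I -> V) :
  linear f -> f (\sum_(i <- r | P i) F i) = \sum_(i <- r | P i) f (F i).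
Proof. by move=> h; apply: big_morph; [exact: linD | exact: lin0]. Qed.

End LinearMaps.

Section Sums.
Variables (K : fieldType) (V : lmodType K).

Definition fin_sums (S : set V) : set V := [set v |
  exists n (x : 'I_n -> V), (forall i, S (x i)) /\ v = \sum_(i < n) x i].

Definition lspan (S : set V) : set V := [set v |
  exists n (c : 'I_n -> K) (x : 'I_n -> V),
    (forall i, S (x i)) /\ v = \sum_(i < n) c i *: x i].

Lemma fin_sums0 S : fin_sums S 0.
Proof. by exists 0%N, (fun=> 0); split=> [[]//|]; rewrite big_ord0. Qed.

Lemma fin_sumsD S x y : fin_sums S x -> fin_sums S y -> fin_sums S (x + y).
Proof.
move=> [n [u [Su ->]]] [m [v [Sv ->]]].
exists (n + m)%N, (fun i => match fintype.split i with inl j => u j | inr j => v j end).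
split; first by move=> i; case: (fintype.split i).
rewrite big_split_ord /=; congr (_ + _); apply: eq_bigr => i _.
  by rewrite (unsplitK (inl i)).
by rewrite (unsplitK (inr i)).
Qed.

Lemma fin_sums1 (S : set V) x : S x -> fin_sums S x.
Proof. by move=> Sx; exists 1%N, (fun=> x); rewrite big_ord1. Qed.

Lemma fin_sums_ind (S : set V) (Q : V -> Prop) :
  Q 0 -> (forall x y, S x -> Q y -> Q (x + y)) -> forall v, fin_sums S v -> Q v.
Proof.
move=> Q0 QD v [n [x [Sx ->]]].
elim: n x Sx => [|n IH] x Sx; first by rewrite big_ord0.
by rewrite big_ord_recl; apply: QD => //; apply: IH => i; apply: Sx.
Qed.

Lemma lspanE S : lspan S = fin_sums [set y | exists c x, S x /\ y = c *: x].
Proof.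
apply/seteqP; split=> v.
  by move=> [n [c [x [Sx ->]]]]; exists n, (fun i => c i *: x i); split=> // i;
     exists (c i), (x i).
move=> [n [x [Sx ->]]].
have /choice [c hc] : forall i, exists cx : K * V, S cx.2 /\ x i = cx.1 *: cx.2.
  by move=> i; have [c [y [Sy e]]] := Sx i; exists (c, y).
exists n, (fun i => (c i).1), (fun i => (c i).2); split=> [i|].
  by case: (hc i).
by apply: eq_bigr => i _; case: (hc i).
Qed.

Lemma lspan_ind (S : set V) (Q : V -> Prop) :
  Q 0 -> (forall c x y, S x -> Q y -> Q (c *: x + y)) ->
  forall v, lspan S v -> Q v.
Proof.
move=> Q0 QD v; rewrite lspanE; apply: fin_sums_ind => // x y [c [z [Sz ->]]].
exact: QD.
Qed.

Lemma lspan0 S : lspan S 0. Proof. by rewrite lspanE; exact: fin_sums0. Qed.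

Lemma lspanD S x y : lspan S x -> lspan S y -> lspan S (x + y).
Proof. by rewrite !lspanE; exact: fin_sumsD. Qed.

Lemma lspan_incl (S : set V) x : S x -> lspan S x.
Proof. by move=> Sx; exists 1%N, (fun=> 1), (fun=> x); rewrite big_ord1 scale1r. Qed.

Lemma lspanZ S c x : lspan S x -> lspan S (c *: x).
Proof.
move=> [n [d [y [Sy ->]]]]; exists n, (fun i => c * d i), y; split=> //.
by rewrite scaler_sumr; apply: eq_bigr => i _; rewrite scalerA.
Qed.

Lemma lspanL S c x y : lspan S x -> lspan S y -> lspan S (c *: x + y).
Proof. by move=> hx hy; apply: lspanD => //; apply: lspanZ. Qed.

End Sums.

Record subspace (K : fieldType) (V : lmodType K) := Subspace {
  sp_set :> set V;
  sp_zero : sp_set 0;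
  sp_lin : forall c x y, sp_set x -> sp_set y -> sp_set (c *: x + y) }.

Section Subspace.
Variables (K : fieldType) (V : lmodType K) (W : subspace V).

Definition sp_pred : {pred V} := [pred x | `[< sp_set W x >]].

Lemma sp_predP x : reflect (sp_set W x) (x \in sp_pred).
Proof. by rewrite inE; exact: asboolP. Qed.

Fact sp_pred_closed : submod_closed sp_pred.
Proof.
split; first exact/sp_predP/sp_zero.
by move=> c x y /sp_predP hx /sp_predP hy; apply/sp_predP/sp_lin.
Qed.

HB.instance Definition _ := GRing.isSubmodClosed.Build K V sp_pred sp_pred_closed.

Record sub_of := SubOf { sub_val : V; sub_valP : sub_val \in sp_pred }.
HB.instance Definition _ := [isSub for sub_val].
HB.instance Definition _ := [Choice of sub_of by <:].
HB.instance Definition _ := [SubChoice_isSubZmodule of sub_of by <:].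
HB.instance Definition _ := [SubZmodule_isSubLmodule of sub_of by <:].
End Subspace.

Definition span_subspace (K : fieldType) (V : lmodType K) (S : set V) :
  subspace V := Subspace (lspan0 S) (@lspanL K V S).

Section Quotient.
Variables (K : fieldType) (V : lmodType K) (W : subspace V).
Implicit Types x y : V.

Definition quot_rel x y : bool := x - y \in sp_pred W.

Fact quot_rel_refl : reflexive quot_rel.
Proof. by move=> x; rewrite /quot_rel subrr rpred0. Qed.

Fact quot_rel_sym : symmetric quot_rel.
Proof. by move=> x y; rewrite /quot_rel -opprB rpredN. Qed.

Fact quot_rel_trans : transitive quot_rel.
Proof.
move=> y x z; rewrite /quot_rel => hxy hyz.
by rewrite -(subrK y x) -addrA rpredD.
Qed.

Definition quot_equiv :=
  EquivRel quot_rel quot_rel_refl quot_rel_sym quot_rel_trans.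
Definition quot : Type := {eq_quot quot_equiv}.
HB.instance Definition _ := Choice.on quot.
HB.instance Definition _ := Quotient.on quot.

Definition qpi x : quot := \pi_quot x.

Lemma qpiP x y : qpi x = qpi y <-> sp_set W (x - y).
Proof.
split=> [/eqmodP /sp_predP //|h]; apply/eqmodP; exact/sp_predP.
Qed.

Lemma qpi_repr (q : quot) : qpi (repr q) = q.
Proof. exact: reprK. Qed.

Lemma repr_qpi x : sp_set W (repr (qpi x) - x).
Proof. by apply/qpiP; rewrite qpi_repr. Qed.

Definition qadd (p q : quot) : quot := qpi (repr p + repr q).
Definition qopp (p : quot) : quot := qpi (- repr p).
Definition qscale (c : K) (p : quot) : quot := qpi (c *: repr p).

Let spD x y : sp_set W x -> sp_set W y -> sp_set W (x + y).
Proof. by move=> hx hy; rewrite -[x]scale1r; apply: sp_lin. Qed.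

Let spZ c x : sp_set W x -> sp_set W (c *: x).
Proof. by move=> hx; rewrite -[_ *: x]addr0; apply: sp_lin => //; apply: sp_zero. Qed.

Lemma qaddE x y : qadd (qpi x) (qpi y) = qpi (x + y).
Proof.
apply/qpiP; rewrite opprD addrACA; apply: spD; exact: repr_qpi.
Qed.

Lemma qoppE x : qopp (qpi x) = qpi (- x).
Proof.
apply/qpiP; rewrite -opprD.
by have := spZ (-1) (repr_qpi x); rewrite scaleN1r.
Qed.

Lemma qscaleE c x : qscale c (qpi x) = qpi (c *: x).
Proof. by apply/qpiP; rewrite -scalerBr; apply: spZ; exact: repr_qpi. Qed.

Fact qaddA : associative qadd.
Proof.
by move=> p q r; rewrite -[p]qpi_repr -[q]qpi_repr -[r]qpi_repr !qaddE addrA.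
Qed.
Fact qaddC : commutative qadd.
Proof. by move=> p q; rewrite -[p]qpi_repr -[q]qpi_repr !qaddE addrC. Qed.
Fact qadd0 : left_id (qpi 0) qadd.
Proof. by move=> p; rewrite -[p]qpi_repr qaddE add0r. Qed.
Fact qaddN : left_inverse (qpi 0) qopp qadd.
Proof. by move=> p; rewrite -[p]qpi_repr qoppE qaddE addNr. Qed.
HB.instance Definition _ := GRing.isZmodule.Build quot qaddA qaddC qadd0 qaddN.

Let qDE x y : qpi x + qpi y = qpi (x + y). Proof. exact: qaddE. Qed.

Fact qscaleA a b p : qscale a (qscale b p) = qscale (a * b) p.
Proof. by rewrite -[p]qpi_repr !qscaleE scalerA. Qed.
Fact qscale1 : left_id 1 qscale.
Proof. by move=> p; rewrite -[p]qpi_repr qscaleE scale1r. Qed.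
Fact qscaleDr : right_distributive qscale +%R.
Proof.
move=> c p q; rewrite -[p]qpi_repr -[q]qpi_repr.
by rewrite qDE !qscaleE qDE scalerDr.
Qed.
Fact qscaleDl p : {morph qscale^~ p : a b / a + b}.
Proof.
move=> a b; by rewrite -[p]qpi_repr /= !qscaleE qDE scalerDl.
Qed.
HB.instance Definition _ :=
  GRing.Zmodule_isLmodule.Build K quot qscaleA qscale1 qscaleDr qscaleDl.

Lemma qpi_linear : linear qpi.
Proof. by move=> c x y; rewrite -qDE -qscaleE. Qed.

(* Linear whenever f is linear and vanishes on W. *)
Definition qlift (U : lmodType K) (f : V -> U) (q : quot) : U := f (repr q).

Section Lift.
Variables (U : lmodType K) (f : V -> U).
Hypotheses (f_lin : linear f) (f_W : forall x, sp_set W x -> f x = 0).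

Lemma qliftE x : qlift f (qpi x) = f x.
Proof. by apply/eqP; rewrite -subr_eq0 /qlift -linB //; apply/eqP/f_W/repr_qpi. Qed.

Lemma qlift_linear : linear (qlift f).
Proof.
move=> c p q; rewrite -[p]qpi_repr -[q]qpi_repr -qpi_linear !qliftE.
exact: f_lin.
Qed.
End Lift.

Lemma quot_ext (U : lmodType K) (f g : quot -> U) :
  (forall x, f (qpi x) = g (qpi x)) -> f =1 g.
Proof. by move=> h q; rewrite -[q]qpi_repr. Qed.

End Quotient.

Section FinSupp.
Variables (K : fieldType) (I : choiceType) (V : I -> lmodType K).

Record fsfam := FsFam {
  fs_val :> forall i, V i;
  fs_fin : finite_set [set i | fs_val i != 0] }.

HB.instance Definition _ := gen_eqMixin fsfam.
HB.instance Definition _ := gen_choiceMixin fsfam.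

Lemma fs_ext (x y : fsfam) : (forall i, x i = y i) -> x = y.
Proof.
case: x y => [x hx] [y hy] /= h.
have e : x = y by apply: functional_extensionality_dep.
by rewrite e in hx *; congr FsFam; exact: Prop_irrelevance.
Qed.

Fact fs0_fin : finite_set [set i | (0 : V i) != 0].
Proof. by apply: (sub_finite_set _ (finite_set0 _)) => i /=; rewrite eqxx. Qed.
Definition fs0 := FsFam fs0_fin.

Fact fsL_fin (c : K) (x y : fsfam) :
  finite_set [set i | c *: x i + y i != 0].
Proof.
have h : finite_set ([set i | x i != 0] `|` [set i | y i != 0]).
  by rewrite finite_setU; split; apply: fs_fin.
apply: sub_finite_set h => i /=.
have [->|xi] := eqVneq (x i) 0; last by left.
by rewrite scaler0 add0r; right.
Qed.
Definition fsL c x y := FsFam (fsL_fin c x y).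

Let fsadd x y := fsL 1 x y.
Let fsopp x := fsL (-1) x fs0.
Let fsscale c x := fsL c x fs0.

Fact fsaddA : associative fsadd.
Proof. by move=> x y z; apply: fs_ext => i /=; rewrite !scale1r addrA. Qed.
Fact fsaddC : commutative fsadd.
Proof. by move=> x y; apply: fs_ext => i /=; rewrite !scale1r addrC. Qed.
Fact fsadd0 : left_id fs0 fsadd.
Proof. by move=> x; apply: fs_ext => i /=; rewrite scale1r add0r. Qed.
Fact fsaddN : left_inverse fs0 fsopp fsadd.
Proof.
by move=> x; apply: fs_ext => i /=; rewrite scale1r addr0 scaleN1r addNr.
Qed.
HB.instance Definition _ := GRing.isZmodule.Build fsfam fsaddA fsaddC fsadd0 fsaddN.

Fact fsscaleA a b p : fsscale a (fsscale b p) = fsscale (a * b) p.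
Proof. by apply: fs_ext => i /=; rewrite !addr0 scalerA. Qed.
Fact fsscale1 : left_id 1 fsscale.
Proof. by move=> p; apply: fs_ext => i /=; rewrite addr0 scale1r. Qed.
Fact fsscaleDr : right_distributive fsscale +%R.
Proof. by move=> c p q; apply: fs_ext => i /=; rewrite !addr0 !scale1r scalerDr. Qed.
Fact fsscaleDl p : {morph fsscale^~ p : a b / a + b}.
Proof. by move=> a b; apply: fs_ext => i /=; rewrite !addr0 scale1r scalerDl. Qed.
HB.instance Definition _ :=
  GRing.Zmodule_isLmodule.Build K fsfam fsscaleA fsscale1 fsscaleDr fsscaleDl.

Lemma fsDE (x y : fsfam) i : (x + y) i = x i + y i.
Proof. by rewrite /= scale1r. Qed.
Lemma fs0E i : (0 : fsfam) i = 0. Proof. by []. Qed.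
Lemma fsZE c (x : fsfam) i : (c *: x) i = c *: x i.
Proof. by rewrite /= addr0. Qed.
Lemma fsNE (x : fsfam) i : (- x) i = - x i.
Proof. by rewrite /= addr0 scaleN1r. Qed.
Lemma fsLE c (x y : fsfam) i : (c *: x + y) i = c *: x i + y i.
Proof. by rewrite fsDE fsZE. Qed.

Definition fs_total (U : lmodType K) (f : forall i, V i -> U) (x : fsfam) : U :=
  \sum_(i \in [set: I]) f i (x i).

Lemma fs_totalL (U : lmodType K) (f : forall i, V i -> U) :
  (forall i, linear (f i)) -> linear (fs_total f).
Proof.
move=> hf c x y; rewrite /fs_total.
have fin0 (z : fsfam) : finite_set [set i | f i (z i) != 0].
  apply: sub_finite_set (fs_fin z) => i /=.
  by apply: contraNN => /eqP ->; rewrite lin0.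
pose D := [set i | f i (x i) != 0] `|` [set i | f i (y i) != 0].
have finD : finite_set D by rewrite finite_setU; split; apply: fin0.
have restr (F : I -> U) : (forall i, ~ D i -> F i = 0) ->
    \sum_(i \in [set: I]) F i = \sum_(i <- fset_set D) F i.
  move=> hF; rewrite (fsbigTE (fset_set D)) // => i.
  by rewrite in_fset_set // notin_setE; exact: hF.
have hD i : ~ D i -> f i (x i) = 0 /\ f i (y i) = 0.
  by move=> Di; split; apply: contrapT => /eqP h; apply: Di; [left|right].
have Hx := restr (fun i => f i (x i)) (fun i Di => proj1 (hD i Di)).
have Hy := restr (fun i => f i (y i)) (fun i Di => proj2 (hD i Di)).
rewrite Hx Hy (restr (fun i => f i ((c *: x + y) i))) => [|i /hD[h1 h2]]; last first.
  by rewrite fsLE hf h1 h2 scaler0 addr0.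
by rewrite scaler_sumr -big_split; apply: eq_bigr => i _; rewrite fsLE hf.
Qed.

End FinSupp.

Section Free.
Variables (K : fieldType) (X : choiceType).

Definition free : lmodType K := fsfam (fun _ : X => K^o : lmodType K).

Fact delta_fin (x : X) :
  finite_set [set i | (if i == x then 1 else 0 : K^o) != 0].
Proof.
apply: (sub_finite_set _ (finite_set1 x)) => i /= h; apply: contrapT.
by move=> /eqP/negbTE ix; move: h; rewrite ix eqxx.
Qed.
Definition delta (x : X) : free := @FsFam K X (fun=> K^o) _ (delta_fin x).

Lemma deltaE x i : delta x i = (i == x)%:R :> K.
Proof. by rewrite /=; case: eqP. Qed.

Definition free_ext (U : lmodType K) (h : X -> U) : free -> U :=
  fs_total (fun x (c : K^o) => c *: h x).

Lemma free_ext_linear (U : lmodType K) (h : X -> U) : linear (free_ext h).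
Proof.
apply: fs_totalL => x c a b; rewrite scalerDl; congr (_ + _).
by rewrite [RHS]scalerA.
Qed.

Lemma free_extE (U : lmodType K) (h : X -> U) x : free_ext h (delta x) = h x.
Proof.
rewrite /free_ext /fs_total (fsbigTE [fset x]%fset) => [|i].
  by rewrite big_seq_fset1 deltaE eqxx scale1r.
by rewrite inE => /negbTE ix; rewrite deltaE ix scale0r.
Qed.

Lemma free_span (x : free) : lspan (range delta) x.
Proof.
pose D := fset_set [set i | x i != 0].
have -> : x = \sum_(i <- D) x i *: delta i.
  apply: fs_ext => j.
  have e (r : seq X) (F : X -> free) :
      (\sum_(i <- r) F i) j = \sum_(i <- r) F i j.
    by elim: r => [|i r IH]; rewrite ?big_nil // !big_cons fsDE IH.
  rewrite e; have [jD|jD] := boolP (j \in D).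
    rewrite (bigD1_seq j) ?fset_uniq // fsZE deltaE eqxx.
    rewrite big1; first by rewrite [RHS]addr0 [RHS]mulr1.
    by move=> i ij; rewrite fsZE deltaE eq_sym (negbTE ij) scaler0.
  rewrite big1_seq => [|i /andP[_ iD]].
    by move: jD; rewrite in_fset_set ?notin_setE; [move=> /negP; rewrite negbK => /eqP|exact: fs_fin].
  rewrite fsZE deltaE; case: eqVneq => [ij|_]; last by rewrite scaler0.
  by rewrite ij iD in jD.
elim: (enum_fset D) => [|i r IH]; first by rewrite big_nil; exact: lspan0.
by rewrite big_cons; apply: lspanL => //; apply: lspan_incl; exists i.
Qed.

End Free.

Section FinSuppMaps.
Variables (K : fieldType) (I : choiceType) (V W : I -> lmodType K).

Fact fs_map_fin (f : forall i, V i -> W i) (f0 : forall i, f i 0 = 0)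
  (x : fsfam V) : finite_set [set i | f i (x i) != 0].
Proof.
apply: sub_finite_set (fs_fin x) => i /=.
by apply: contraNN => /eqP ->; rewrite f0.
Qed.

Definition fs_map (f : forall i, V i -> W i) (f0 : forall i, f i 0 = 0)
  (x : fsfam V) : fsfam W := FsFam (fs_map_fin f0 x).

Lemma fs_mapE f (f0 : forall i, f i 0 = 0) x i : fs_map f0 x i = f i (x i).
Proof. by []. Qed.

Lemma fs_map_linear f (f0 : forall i, f i 0 = 0) :
  (forall i, linear (f i)) -> linear (fs_map f0).
Proof.
by move=> lf c x y; apply: fs_ext => i; rewrite fsLE !fs_mapE fsLE lf.
Qed.

Lemma fs_totalE (U : lmodType K) (f : forall i, V i -> U) (x : fsfam V) :
  (forall i, f i 0 = 0) ->
  fs_total f x = \sum_(i <- fset_set [set i | x i != 0]) f i (x i).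
Proof.
move=> f0; rewrite /fs_total.
rewrite (fsbigTE (fset_set [set i | x i != 0])) // => i.
rewrite in_fset_set ?notin_setE; last exact: fs_fin.
by move=> /negP; rewrite negbK => /eqP ->.
Qed.

Lemma fs_total_comp (U U' : lmodType K) (f : forall i, V i -> U) (h : U -> U')
    (x : fsfam V) : linear h -> (forall i, f i 0 = 0) ->
  h (fs_total f x) = fs_total (fun i y => h (f i y)) x.
Proof.
move=> lh f0; rewrite !fs_totalE //; last by move=> i; rewrite f0 lin0.
by rewrite lin_sum.
Qed.

Lemma fs_total_ext (U : lmodType K) (f g : forall i, V i -> U) (x y : fsfam V) :
  (forall i, f i (x i) = g i (y i)) -> fs_total f x = fs_total g y.
Proof. by move=> h; apply: eq_fsbigr => i _. Qed.

Lemma fs_totalB (U : lmodType K) (f g : forall i, V i -> U) (x : fsfam V) :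
  (forall i, f i 0 = 0) -> (forall i, g i 0 = 0) ->
  fs_total (fun i y => f i y - g i y) x = fs_total f x - fs_total g x.
Proof.
move=> f0 g0; rewrite !fs_totalE //; last by move=> i; rewrite f0 g0 subrr.
by rewrite sumrB.
Qed.

End FinSuppMaps.

Arguments fs_map {K I V W} f f0 x.

Definition bilin (K : fieldType) (V W U : lmodType K) (h : V -> W -> U) :=
  (forall w, linear (h^~ w)) /\ (forall v, linear (h v)).

Section Tensor.
Variables (K : fieldType) (V W : lmodType K).

Definition tens_rel : set (free K (V * W)%type) :=
  [set z | exists c v v' w,
     z = delta K (c *: v + v', w) - (c *: delta K (v, w) + delta K (v', w))] `|`
  [set z | exists c v w w',
     z = delta K (v, c *: w + w') - (c *: delta K (v, w) + delta K (v, w'))].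

Definition tensor : lmodType K := quot (span_subspace tens_rel).

Definition tens (v : V) (w : W) : tensor := qpi _ (delta K (v, w)).

Lemma tens_bilin : bilin tens.
Proof.
split=> [w c v v'|v c w w']; rewrite /tens -qpi_linear; apply/qpiP.
  by apply: lspan_incl; left; exists c, v, v', w.
by apply: lspan_incl; right; exists c, v, w, w'.
Qed.

(* The linear map v (x) w |-> h v w; meaningful when h is bilinear (tliftE). *)
Definition tlift (U : lmodType K) (h : V -> W -> U) : tensor -> U :=
  qlift (free_ext (fun p : V * W => h p.1 p.2)).

Section Lift.
Variables (U : lmodType K) (h : V -> W -> U).
Hypothesis h_bilin : bilin h.

Let h_rel z : sp_set (span_subspace tens_rel) z ->
  free_ext (fun p : V * W => h p.1 p.2) z = 0.
Proof.
have L := free_ext_linear (fun p : V * W => h p.1 p.2).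
move: z; apply: (lspan_ind (S := tens_rel)) => [|c x y Sx IH]; first exact: lin0.
rewrite L IH addr0; case: Sx => -[d [v [v' [w ->]]]];
  by rewrite linB // L !free_extE /= (h_bilin.1, h_bilin.2) subrr scaler0.
Qed.

Lemma tliftE v w : tlift h (tens v w) = h v w.
Proof. by rewrite /tlift /tens qliftE ?free_extE //; exact: free_ext_linear. Qed.

Lemma tlift_linear : linear (tlift h).
Proof. by apply: qlift_linear => //; exact: free_ext_linear. Qed.

End Lift.

Lemma tens_ind (P : tensor -> Prop) : P 0 ->
  (forall c v w t, P t -> P (c *: tens v w + t)) -> forall t, P t.
Proof.
move=> P0 PL t; rewrite -(qpi_repr t).
elim/lspan_ind: (free_span (repr t)) => [|c x y [[v w] _ <-] Py].
  by rewrite (lin0 (@qpi_linear _ _ _)).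
by rewrite qpi_linear; apply: PL.
Qed.

Lemma tens_ext (U : lmodType K) (f g : tensor -> U) : linear f -> linear g ->
  (forall v w, f (tens v w) = g (tens v w)) -> f =1 g.
Proof.
move=> lf lg h; apply: tens_ind => [|c v w t IH]; first by rewrite !lin0.
by rewrite lf lg h IH.
Qed.

End Tensor.

Notation "v *t w" := (tens v w) (at level 40, left associativity).

Section TensorMap.
Variables (K : fieldType) (V W V' W' : lmodType K).

Definition tmap (f : V -> V') (g : W -> W') : tensor V W -> tensor V' W' :=
  tlift (fun v w => f v *t g w).

Variables (f : V -> V') (g : W -> W').
Hypotheses (lf : linear f) (lg : linear g).

Let bil : bilin (fun v w => f v *t g w).
Proof.
by split=> [w c v v'|v c w w'] /=;
   rewrite (lf, lg) ((tens_bilin _ _).1, (tens_bilin _ _).2).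
Qed.

Lemma tmapE v w : tmap f g (v *t w) = f v *t g w.
Proof. exact: tliftE. Qed.

Lemma tmap_linear : linear (tmap f g).
Proof. exact: tlift_linear. Qed.
End TensorMap.

Section TensorPair.
Variables (K : fieldType) (V W V' W' V'' W'' : lmodType K).

Definition tpair (f : V -> V' -> V'') (g : W -> W' -> W'')
    (s : tensor V W) (t : tensor V' W') : tensor V'' W'' :=
  tlift (fun v w => tmap (f v) (g w) t) s.

Variables (f : V -> V' -> V'') (g : W -> W' -> W'').
Hypotheses (bf : bilin f) (bg : bilin g).

Let bil t : bilin (fun v w => tmap (f v) (g w) t).
Proof.
have [[f1 f2] [g1 g2]] := (bf, bg).
have [t1 t2] := @tens_bilin K V'' W''.
have lm v w : linear (tmap (f v) (g w)) by exact: tmap_linear.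
split=> [w c v v'|v c w w'] /=; elim/tens_ind: t => [|d x y t IH].
- by rewrite !(lin0 (lm _ _)) scaler0 addr0.
- by rewrite !lm !tmapE // f1 t1 IH; rewrite !scalerDr !scalerA mulrC !addrA;
     congr (_ + _); rewrite -!addrA; congr (_ + _); rewrite addrC.
- by rewrite !(lin0 (lm _ _)) scaler0 addr0.
- by rewrite !lm !tmapE // g1 t2 IH; rewrite !scalerDr !scalerA mulrC !addrA;
     congr (_ + _); rewrite -!addrA; congr (_ + _); rewrite addrC.
Qed.

Lemma tpairE v w v' w' : tpair f g (v *t w) (v' *t w') = f v v' *t g w w'.
Proof. by rewrite /tpair tliftE // tmapE //; [apply: bf.2|apply: bg.2]. Qed.

Lemma tpair_linl t : linear (fun s => tpair f g s t).
Proof. exact: tlift_linear. Qed.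

Lemma tpair_linr s : linear (tpair f g s).
Proof.
elim/tens_ind: s => [|d v w s IH] c t t'.
  have e u : tpair f g 0 u = 0 by exact: (lin0 (tpair_linl u)).
  by rewrite !e scaler0 addr0.
have lm : linear (tmap (f v) (g w)) by apply: tmap_linear; [apply: bf.2|apply: bg.2].
have e u : tpair f g (d *: (v *t w) + s) u = d *: tmap (f v) (g w) u + tpair f g s u.
  by rewrite (tpair_linl u) {1}/tpair tliftE.
rewrite !e lm IH !scalerDr !scalerA mulrC !addrA; congr (_ + _).
by rewrite -!addrA; congr (_ + _); rewrite addrC.
Qed.

Lemma tpair_bilin : bilin (tpair f g).
Proof. by split; [exact: tpair_linl|exact: tpair_linr]. Qed.
End TensorPair.

Reserved Notation "a ** b" (at level 40, left associativity).
Reserved Notation "x |* a" (at level 40, left associativity).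

Section FunctionalModules.
Variables (R : realType) (G : groupType).
Local Notation C := (R[i]).

Record galg := GAlg {
  alg_car :> lmodType C;
  amul : alg_car -> alg_car -> alg_car;
  aact : G -> alg_car -> alg_car;
  amulA : forall a b c, amul a (amul b c) = amul (amul a b) c;
  amul_bilin : bilin amul;
  aact_lin : forall g, linear (aact g);
  aactM : forall g a b, aact g (amul a b) = amul (aact g a) (aact g b);
  aact1 : forall a, aact 1%g a = a;
  aact_mul : forall g h a, aact (g * h)%g a = aact g (aact h a) }.

Local Notation "a ** b" := (amul a b).

Definition quadratik (A : galg) : Prop :=
  forall a : A, fin_sums [set x | exists b c : A, x = b ** c] a.

Definition directed (I : Type) (le : I -> I -> Prop) : Prop :=
  [/\ inhabited I, forall i, le i i,
      forall i j k, le i j -> le j k -> le i k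
    & forall i j, exists k, le i k /\ le j k].

Definition approximate_unit (A : galg) (I : Type) (le : I -> I -> Prop)
    (x : I -> A) : Prop :=
  directed le /\
  forall a, exists j, forall i, le j i -> x i ** a = a /\ a ** x i = a.

Definition has_approximate_unit (A : galg) : Prop :=
  exists (I : Type) (le : I -> I -> Prop) (x : I -> A),
    approximate_unit le x.

(* The first conjunct is implied by the second: au_quadratik. *)
Definition discrete_alg_au (A : galg) : Prop :=
  quadratik A /\ has_approximate_unit A.

Lemma au2 (A : galg) : has_approximate_unit A -> forall a b : A, exists e : A,
  [/\ e ** a = a, a ** e = a, e ** b = b & b ** e = b].
Proof.
move=> [I [le [x [[_ _ _ dir] xP]]]] a b.
have [[j hj] [k hk]] := (xP a, xP b).
have [l [jl kl]] := dir j k.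
by exists (x l); have [-> ->] := hj l jl; have [-> ->] := hk l kl.
Qed.

Lemma au_quadratik (A : galg) : has_approximate_unit A -> quadratik A.
Proof.
move=> /au2 h a; have [e [ea _ _ _]] := h a a.
by apply: fin_sums1; exists e, a.
Qed.

Record algHom (A B : galg) := AlgHom {
  ah_fun :> A -> B;
  ah_lin : linear ah_fun;
  ah_mul : forall a b, ah_fun (a ** b) = ah_fun a ** ah_fun b;
  ah_act : forall g a, ah_fun (aact g a) = aact g (ah_fun a) }.

Record rmod (A : galg) := RMod {
  rm_car :> lmodType C;
  ract : rm_car -> A -> rm_car;
  ract_bilin : bilin ract;
  ractA : forall x a b, ract (ract x a) b = ract x (a ** b) }.

Local Notation "x |* a" := (ract x a).

Definition reg_rmod (A : galg) : rmod A :=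
  RMod (amul_bilin A) (fun x a b => esym (amulA x a b)).

(* On a module M = MA, additive maps that are equivariant for the module
   multiplications are automatically C-linear; hence on cofull modules nothing
   is lost by requiring G-actions and functionals to be C-linear in fmod. *)
Lemma additive_semilinear (A B : galg) (M : rmod A) (N : rmod B)
    (h : A -> B) (f : M -> N) :
  (forall x : M, fin_sums [set y | exists (z : M) a, y = z |* a] x) ->
  linear h -> {morph f : x y / x + y} ->
  (forall x a, f (x |* a) = f x |* h a) -> linear f.
Proof.
move=> MA lh fD fh c x y; rewrite fD; congr (_ + _).
have f0 : f 0 = 0 by apply: (addrI (f 0)); rewrite -fD !addr0.
elim/fin_sums_ind: (MA x) => [|u v [z [a ->]] IH]; first by rewrite scaler0 f0 scaler0.
rewrite scalerDr !fD IH scalerDr; congr (_ + _).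
have [b1 b2] := (ract_bilin M, ract_bilin N).
by rewrite -(linZ (b1.2 z)) !fh (linZ lh) (linZ (b2.2 _)).
Qed.

Record fmod (A : galg) := FMod {
  fm_mod :> rmod A;
  mact : G -> fm_mod -> fm_mod;
  mact_lin : forall g, linear (mact g);
  mact_ract : forall g x a, mact g (x |* a) = mact g x |* aact g a;
  mact1 : forall x, mact 1%g x = x;
  mact_mul : forall g h x, mact (g * h)%g x = mact g (mact h x);
  Theta : set (fm_mod -> A);
  Theta_lin : forall phi, Theta phi -> linear phi;
  Theta_ract : forall phi, Theta phi -> forall x a, phi (x |* a) = phi x ** a;
  Theta0 : Theta (fun=> 0);
  ThetaB : forall phi psi, Theta phi -> Theta psi ->
    Theta (fun x => phi x - psi x);
  Theta_mul : forall a phi, Theta phi -> Theta (fun x => a ** phi x);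
  Theta_act : forall g phi, Theta phi ->
    Theta (fun x => aact g (phi (mact g^-1%g x))) }.

Definition cofull (A : galg) (E : fmod A) : Prop := forall x : E,
  fin_sums [set y : E | exists (xi eta : E) phi,
    Theta phi /\ y = xi |* phi eta] x.

Definition cofull_Theta (A : galg) (E : fmod A) : Prop :=
  forall phi : E -> A, Theta phi ->
  fin_sums [set psi : E -> A | exists phi' tau (xi : E),
    [/\ Theta phi', Theta tau & psi = (fun x => phi' xi ** tau x)]] phi.

Lemma ThetaD (A : galg) (E : fmod A) (phi psi : E -> A) :
  Theta phi -> Theta psi -> Theta (fun x => phi x + psi x).
Proof.
move=> hp hq.
have -> : (fun x => phi x + psi x) = (fun x => phi x - (0 - psi x)).
  by apply/funext => x; rewrite sub0r opprK.
by apply: ThetaB => //; apply: ThetaB => //; exact: Theta0.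
Qed.

Lemma aactVK (A : galg) g (a : A) : aact g (aact g^-1%g a) = a.
Proof. by rewrite -aact_mul mulgV aact1. Qed.

Lemma mactVK (A : galg) (E : fmod A) g (x : E) : mact g (mact g^-1%g x) = x.
Proof. by rewrite -mact_mul mulgV mact1. Qed.

Lemma mactKV (A : galg) (E : fmod A) g (x : E) : mact g^-1%g (mact g x) = x.
Proof. by rewrite -mact_mul mulVg mact1. Qed.

Definition fmod_hom (A : galg) (E F : fmod A) (U : E -> F)
    (Us : (E -> A) -> (F -> A)) : Prop :=
  [/\ [/\ {morph U : x y / x + y},
          forall x a, U (x |* a) = U x |* a
        & forall g x, U (mact g x) = mact g (U x)],
      forall phi, Theta phi -> Theta (Us phi),
      [/\ forall phi psi, Theta phi -> Theta psi ->
            Us (fun x => phi x + psi x) = (fun y => Us phi y + Us psi y),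
          forall a phi, Theta phi ->
            Us (fun x => a ** phi x) = (fun y => a ** Us phi y)
        & forall g phi, Theta phi ->
            Us (fun x => aact g (phi (mact g^-1%g x))) =
            (fun y => aact g (Us phi (mact g^-1%g y)))]
    & forall phi, Theta phi -> forall xi, Us phi (U xi) = phi xi].

Definition functional_extension (A : galg) (E F : fmod A) (U : E -> F)
    (Us : (E -> A) -> (F -> A)) : Prop :=
  [/\ fmod_hom U Us, injective U
    & forall (k : nat) (phi : 'I_k -> (E -> A)), (forall i, Theta (phi i)) ->
      forall eta : F, exists xi : E, forall i, Us (phi i) eta = phi i xi].

Section Compact.
Variables (A : galg) (E : fmod A).

Definition rank_one (eta : E) (phi : E -> A) : E -> E := fun x => eta |* phi x.

Definition compact_ops : set (E -> E) :=
  fin_sums [set T | exists eta phi, Theta phi /\ T = rank_one eta phi].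

Let rank_one_lin eta phi : Theta phi -> linear (rank_one eta phi).
Proof.
by move=> h c x y; rewrite /rank_one (Theta_lin h) ((ract_bilin E).2 eta).
Qed.

Lemma compact_lin (T : E -> E) : compact_ops T -> linear T.
Proof.
move: T; apply: fin_sums_ind => [c x y|T T' [eta [phi [hphi ->]]] IH c x y].
  by rewrite /GRing.zero /= scaler0 addr0.
rewrite -![(_ + T') _]/(_ + _) rank_one_lin // IH scalerDr !addrA; congr (_ + _).
by rewrite -!addrA; congr (_ + _); rewrite addrC.
Qed.

Lemma compact_ract (T : E -> E) : compact_ops T ->
  forall x a, T (x |* a) = T x |* a.
Proof.
have [b1 _] := ract_bilin E.
move: T; apply: fin_sums_ind => [x a|T T' [eta [phi [hphi ->]]] IH x a].
  by rewrite /GRing.zero /= (lin0 (b1 a)).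
rewrite -![(_ + T') _]/(_ + _) IH (linD (b1 a)); congr (_ + _).
by rewrite /rank_one (Theta_ract hphi) ractA.
Qed.

Fact compact_opsL c T T' : compact_ops T -> compact_ops T' ->
  compact_ops (c *: T + T').
Proof.
move=> hT hT'; apply: fin_sumsD => //; move: T hT.
apply: fin_sums_ind => [|T T'' [eta [phi [hphi ->]]] IH].
  by rewrite scaler0; exact: fin_sums0.
rewrite scalerDr; apply: fin_sumsD => //; apply: fin_sums1.
exists (c *: eta), phi; split=> //; apply/funext => x.
by rewrite /rank_one (linZ ((ract_bilin E).1 _)).
Qed.

Definition compact_space : subspace (E -> E) :=
  Subspace (fin_sums0 _) compact_opsL.

Definition compact : lmodType C := sub_of compact_space.

Definition cop (T : compact) : E -> E := sub_val T.

Lemma copP (T : compact) : compact_ops (cop T).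
Proof. exact: (elimT (sp_predP compact_space _) (sub_valP T)). Qed.

Definition mk_compact (T : E -> E) (hT : compact_ops T) : compact :=
  SubOf (introT (sp_predP compact_space T) hT).

Lemma cop_inj : injective cop.
Proof. exact: val_inj. Qed.

Fact compact_comp (S T : compact) : compact_ops (cop S \o cop T).
Proof.
have lS := compact_lin (copP S).
have : compact_ops (cop T) by exact: copP.
move: (cop T); apply: fin_sums_ind => [|T1 T2 [eta [phi [hphi ->]]] IH].
  by rewrite (_ : _ \o _ = 0); [exact: fin_sums0|apply/funext => x /=; rewrite (lin0 lS)].
rewrite (_ : _ \o _ = (cop S \o rank_one eta phi) + (cop S \o T2)); last first.
  by apply/funext => x /=; rewrite [LHS](linD lS).
apply: fin_sumsD => //; apply: fin_sums1; exists (cop S eta), phi; split=> //.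
by apply/funext => x; rewrite /rank_one /= (compact_ract (copP S)).
Qed.

Fact compact_ad g (T : compact) :
  compact_ops (fun x => mact g (cop T (mact g^-1%g x))).
Proof.
have : compact_ops (cop T) by exact: copP.
move: (cop T); apply: fin_sums_ind => [|T1 T2 [eta [phi [hphi ->]]] IH].
  rewrite (_ : (fun=> _) = 0); first exact: fin_sums0.
  by apply/funext => x; rewrite [LHS](lin0 (@mact_lin A E g)).
rewrite (_ : (fun=> _) = rank_one (mact g eta)
    (fun x => aact g (phi (mact g^-1%g x))) +
    (fun x => mact g (T2 (mact g^-1%g x)))); last first.
  by apply/funext => x; rewrite [LHS](linD (@mact_lin A E g)) /rank_one mact_ract.
apply: fin_sumsD => //; apply: fin_sums1; do 2 eexists; split; last reflexivity.
exact: Theta_act.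
Qed.

Definition comp_mul S T : compact := mk_compact (compact_comp S T).
Definition comp_act g T : compact := mk_compact (compact_ad g T).

Fact comp_mulA S T U : comp_mul S (comp_mul T U) = comp_mul (comp_mul S T) U.
Proof. exact: cop_inj. Qed.
Fact comp_mul_bilin : bilin comp_mul.
Proof.
split=> [T c S S'|S c T T']; apply: cop_inj; apply/funext => x //=.
exact: (compact_lin (copP S)).
Qed.
Fact comp_act_lin g : linear (comp_act g).
Proof.
by move=> c S T; apply: cop_inj; apply/funext => x; exact: (@mact_lin A E g).
Qed.
Fact comp_actM g S T :
  comp_act g (comp_mul S T) = comp_mul (comp_act g S) (comp_act g T).
Proof. by apply: cop_inj; apply/funext => x; rewrite /cop /= mactKV. Qed.
Fact comp_act1 T : comp_act 1%g T = T.
Proof.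
by apply: cop_inj; apply/funext => x; rewrite [LHS]/= invg1 !mact1.
Qed.
Fact comp_act_mul g h T : comp_act (g * h)%g T = comp_act g (comp_act h T).
Proof.
by apply: cop_inj; apply/funext => x; rewrite [LHS]/= invgM !mact_mul.
Qed.

Definition Kalg : galg :=
  GAlg comp_mulA comp_mul_bilin comp_act_lin comp_actM comp_act1 comp_act_mul.

End Compact.

Section SelfModule.
Variable A : galg.

Definition self_Theta : set (A -> A) := [set phi | exists a, phi = amul a].

Fact self_Theta_lin phi : self_Theta phi -> linear phi.
Proof. by move=> [a ->]; exact: (amul_bilin A).2. Qed.
Fact self_Theta_ract phi : self_Theta phi -> forall x a, phi (x ** a) = phi x ** a.
Proof. by move=> [b ->] x a; rewrite amulA. Qed.
Fact self_Theta0 : self_Theta (fun=> 0).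
Proof. by exists 0; apply/funext => x; rewrite (lin0 ((amul_bilin A).1 x)). Qed.
Fact self_ThetaB phi psi : self_Theta phi -> self_Theta psi ->
  self_Theta (fun x => phi x - psi x).
Proof.
move=> [a ->] [b ->]; exists (a - b); apply/funext => x.
by rewrite (linB ((amul_bilin A).1 x)).
Qed.
Fact self_Theta_mul a phi : self_Theta phi -> self_Theta (fun x => a ** phi x).
Proof. by move=> [b ->]; exists (a ** b); apply/funext => x; rewrite amulA. Qed.
Fact self_Theta_act g phi : self_Theta phi ->
  self_Theta (fun x => aact g (phi (aact g^-1%g x))).
Proof.
by move=> [b ->]; exists (aact g b); apply/funext => x; rewrite aactM aactVK.
Qed.

Definition self_mod : fmod A :=
  @FMod A (reg_rmod A) (@aact A) (@aact_lin A) (@aactM A) (@aact1 A) (@aact_mul A)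
    self_Theta self_Theta_lin self_Theta_ract self_Theta0 self_ThetaB
    self_Theta_mul self_Theta_act.

End SelfModule.

Section BinarySum.
Variables (A : galg) (E F : fmod A).
Let M : lmodType C := (E * F)%type.

Definition sum2_ract (x : M) (a : A) : M := (x.1 |* a, x.2 |* a).
Fact sum2_ract_bilin : bilin sum2_ract.
Proof.
have [[e1 e2] [f1 f2]] := (ract_bilin E, ract_bilin F).
by split=> [a c x y|x c a b]; rewrite /sum2_ract /= ?(e1, e2) ?(f1, f2).
Qed.
Fact sum2_ractA x a b : sum2_ract (sum2_ract x a) b = sum2_ract x (a ** b).
Proof. by rewrite /sum2_ract /= !ractA. Qed.
Definition sum2_rmod : rmod A := RMod sum2_ract_bilin sum2_ractA.

Definition sum2_act g (x : M) : M := (mact g x.1, mact g x.2).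
Fact sum2_act_lin g : linear (sum2_act g).
Proof. by move=> c x y; rewrite /sum2_act /= !mact_lin. Qed.
Fact sum2_act_ract g x a :
  sum2_act g (sum2_ract x a) = sum2_ract (sum2_act g x) (aact g a).
Proof. by rewrite /sum2_act /sum2_ract /= !mact_ract. Qed.
Fact sum2_act1 x : sum2_act 1%g x = x.
Proof. by case: x => x y; rewrite /sum2_act /= !mact1. Qed.
Fact sum2_act_mul g h x : sum2_act (g * h)%g x = sum2_act g (sum2_act h x).
Proof. by rewrite /sum2_act /= !mact_mul. Qed.

Definition sum2_Theta : set (M -> A) := [set chi | exists phi psi,
  [/\ @Theta A E phi, @Theta A F psi & chi = (fun x => phi x.1 + psi x.2)]].

Fact sum2_Theta_lin phi : sum2_Theta phi -> linear phi.
Proof.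
move=> [p [q [hp hq ->]]] c x y; rewrite (Theta_lin hp) (Theta_lin hq) scalerDr.
by rewrite -!addrA; congr (_ + _); rewrite addrCA.
Qed.
Fact sum2_Theta_ract phi : sum2_Theta phi ->
  forall x a, phi (sum2_ract x a) = phi x ** a.
Proof.
move=> [p [q [hp hq ->]]] x a /=; rewrite (Theta_ract hp) (Theta_ract hq).
by rewrite (linD ((amul_bilin A).1 a)).
Qed.
Fact sum2_Theta0 : sum2_Theta (fun=> 0).
Proof.
exists (fun=> 0), (fun=> 0); split; [exact: Theta0|exact: Theta0|].
by apply/funext => x; rewrite addr0.
Qed.
Fact sum2_ThetaB phi psi : sum2_Theta phi -> sum2_Theta psi ->
  sum2_Theta (fun x => phi x - psi x).
Proof.
move=> [p [q [hp hq ->]]] [p' [q' [hp' hq' ->]]].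
exists (fun x => p x - p' x), (fun x => q x - q' x).
split; [exact: ThetaB|exact: ThetaB|].
by apply/funext => x; rewrite opprD addrACA.
Qed.
Fact sum2_Theta_mul a phi : sum2_Theta phi -> sum2_Theta (fun x => a ** phi x).
Proof.
move=> [p [q [hp hq ->]]].
exists (fun x => a ** p x), (fun x => a ** q x).
split; [exact: Theta_mul|exact: Theta_mul|].
by apply/funext => x; rewrite (linD ((amul_bilin A).2 a)).
Qed.
Fact sum2_Theta_act g phi : sum2_Theta phi ->
  sum2_Theta (fun x => aact g (phi (sum2_act g^-1%g x))).
Proof.
move=> [p [q [hp hq ->]]].
exists (fun x => aact g (p (mact g^-1%g x))), (fun x => aact g (q (mact g^-1%g x))).
split; [exact: Theta_act|exact: Theta_act|].
by apply/funext => x; rewrite (linD (@aact_lin A g)).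
Qed.

Definition sum2 : fmod A :=
  @FMod A sum2_rmod sum2_act sum2_act_lin sum2_act_ract sum2_act1 sum2_act_mul
    sum2_Theta sum2_Theta_lin sum2_Theta_ract sum2_Theta0 sum2_ThetaB
    sum2_Theta_mul sum2_Theta_act.

End BinarySum.

Section DirectSum.
Variables (A : galg) (I : choiceType) (E : I -> fmod A).

Let V (i : I) : lmodType C := E i.
Let D (i : I) : lmodType C := (E i -> A).
Definition dsum_car : lmodType C := fsfam V.

Fact ract_x0 a i : (0 : E i) |* a = 0.
Proof. exact: (lin0 ((ract_bilin (E i)).1 a)). Qed.
Definition dsum_ract (x : dsum_car) (a : A) : dsum_car :=
  fs_map (fun i (y : V i) => (y |* a) : V i) (ract_x0 a) x.
Fact dsum_ract_bilin : bilin dsum_ract.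
Proof.
split=> [a|x c a b]; first by apply: fs_map_linear => i; exact: (ract_bilin (E i)).1.
by apply: fs_ext => i; rewrite fsLE; exact: (ract_bilin (E i)).2.
Qed.
Fact dsum_ractA x a b : dsum_ract (dsum_ract x a) b = dsum_ract x (a ** b).
Proof. by apply: fs_ext => i; exact: ractA. Qed.
Definition dsum_rmod : rmod A := RMod dsum_ract_bilin dsum_ractA.

Fact mact_x0 g i : mact g (0 : E i) = 0.
Proof. exact: (lin0 (mact_lin g)). Qed.
Definition dsum_act g (x : dsum_car) : dsum_car := fs_map (fun i (y : V i) => mact g y : V i) (mact_x0 g) x.
Fact dsum_act_lin g : linear (dsum_act g).
Proof. by apply: fs_map_linear => i; exact: mact_lin. Qed.
Fact dsum_act_ract g x a :
  dsum_act g (dsum_ract x a) = dsum_ract (dsum_act g x) (aact g a).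
Proof. by apply: fs_ext => i; exact: mact_ract. Qed.
Fact dsum_act1 x : dsum_act 1%g x = x.
Proof. by apply: fs_ext => i; exact: mact1. Qed.
Fact dsum_act_mul g h x : dsum_act (g * h)%g x = dsum_act g (dsum_act h x).
Proof. by apply: fs_ext => i; exact: mact_mul. Qed.

Definition dsum_fun (phi : fsfam D) (x : dsum_car) : A :=
  fs_total (fun i => phi i : E i -> A) x.

Definition dsum_Theta : set (dsum_car -> A) := [set chi | exists phi : fsfam D,
  (forall i, Theta (phi i : E i -> A)) /\ chi = dsum_fun phi].

Fact dsum_Theta_lin phi : dsum_Theta phi -> linear phi.
Proof. by move=> [p [hp ->]]; apply: fs_totalL => i; exact: Theta_lin. Qed.

Let T0 (p : fsfam D) : (forall i, Theta (p i : E i -> A)) -> forall i, p i 0 = 0.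
Proof. by move=> hp i; exact: (lin0 (Theta_lin (hp i))). Qed.

Fact dsum_Theta_ract phi : dsum_Theta phi ->
  forall x a, phi (dsum_ract x a) = phi x ** a.
Proof.
move=> [p [hp ->]] x a; rewrite /dsum_fun.
rewrite (fs_total_comp x ((amul_bilin A).1 a) (T0 hp)).
by apply: fs_total_ext => i; exact: (Theta_ract (hp i)).
Qed.

Fact dsum_Theta0 : dsum_Theta (fun=> 0).
Proof.
exists 0; split=> [i|]; first exact: Theta0.
by apply/funext => x; rewrite /dsum_fun fs_totalE // big1.
Qed.

Fact dsum_ThetaB phi psi : dsum_Theta phi -> dsum_Theta psi ->
  dsum_Theta (fun x => phi x - psi x).
Proof.
move=> [p [hp ->]] [q [hq ->]]; exists (p - q).
have e i : (p - q) i = (fun x => p i x - q i x) by rewrite fsDE fsNE.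
split=> [i|]; first by rewrite e; exact: ThetaB.
apply/funext => x; rewrite /dsum_fun -fs_totalB; [|exact: T0|exact: T0].
by apply: fs_total_ext => i; rewrite e.
Qed.

Let mulf0 a i : (fun x => a ** (0 : D i) x) = 0 :> D i.
Proof. by apply/funext => x; exact: (lin0 ((amul_bilin A).2 a)). Qed.

Fact dsum_Theta_mul a phi : dsum_Theta phi -> dsum_Theta (fun x => a ** phi x).
Proof.
move=> [p [hp ->]].
exists (fs_map (fun i (q : D i) => (fun x => a ** q x) : D i) (mulf0 a) p).
split=> [i|]; first by rewrite fs_mapE; exact: Theta_mul.
apply/funext => x; rewrite /dsum_fun.
exact: (fs_total_comp x ((amul_bilin A).2 a) (T0 hp)).
Qed.

Let actf0 g i : (fun x => aact g ((0 : D i) (mact g^-1%g x))) = 0 :> D i.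
Proof. by apply/funext => x; exact: (lin0 (@aact_lin A g)). Qed.

Fact dsum_Theta_act g phi : dsum_Theta phi ->
  dsum_Theta (fun x => aact g (phi (dsum_act g^-1%g x))).
Proof.
move=> [p [hp ->]].
exists (fs_map (fun i (q : D i) =>
   (fun x => aact g (q (mact g^-1%g x))) : D i) (actf0 g) p).
split=> [i|]; first by rewrite fs_mapE; exact: Theta_act.
apply/funext => x; rewrite /dsum_fun.
exact: (fs_total_comp (dsum_act g^-1%g x) (@aact_lin A g) (T0 hp)).
Qed.

Definition dsum : fmod A :=
  @FMod A dsum_rmod dsum_act dsum_act_lin dsum_act_ract dsum_act1 dsum_act_mul
    dsum_Theta dsum_Theta_lin dsum_Theta_ract dsum_Theta0 dsum_ThetaB
    dsum_Theta_mul dsum_Theta_act.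

End DirectSum.

Section Plain.
Variables (A : galg) (n : choiceType).

Definition fspow (V : lmodType C) : lmodType C := fsfam (fun _ : n => V).

Fact amul_x0 (a : A) (i : n) : 0 ** a = 0.
Proof. exact: (lin0 ((amul_bilin A).1 a)). Qed.
Fact amul_0x (a : A) (i : n) : a ** 0 = 0.
Proof. exact: (lin0 ((amul_bilin A).2 a)). Qed.

Definition pow_ract (x : fspow A) (a : A) : fspow A := fs_map (fun (_ : n) (b : A) => b ** a) (amul_x0 a) x.
Definition pow_lact (a : A) (x : fspow A) : fspow A := fs_map (fun (_ : n) (b : A) => a ** b) (amul_0x a) x.

Fact pow_ract_bilin : bilin pow_ract.
Proof.
split=> [a|x c a b]; first by apply: fs_map_linear => i; exact: (amul_bilin A).1.
by apply: fs_ext => i; rewrite fsLE; exact: (amul_bilin A).2.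
Qed.
Fact pow_ractA x a b : pow_ract (pow_ract x a) b = pow_ract x (a ** b).
Proof. by apply: fs_ext => i; rewrite /= amulA. Qed.
Definition pow_rmod : rmod A := RMod pow_ract_bilin pow_ractA.

Definition pow_fun (x f : fspow A) : A := fs_total (fun i a => x i ** a) f.

Definition pow_Theta : set (fspow A -> A) := [set phi | exists x, phi = pow_fun x].

(* G-actions on A^n for which A^n, with functional space A^n, is a functional
   module. *)
Record plain_action := PlainAction {
  pa_act :> G -> fspow A -> fspow A;
  pa_lin : forall g, linear (pa_act g);
  pa_ract : forall g x a, pa_act g (pow_ract x a) = pow_ract (pa_act g x) (aact g a);
  pa_act1 : forall x, pa_act 1%g x = x;
  pa_act_mul : forall g h x, pa_act (g * h)%g x = pa_act g (pa_act h x);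
  pa_Theta : forall g phi, pow_Theta phi ->
    pow_Theta (fun x => aact g (phi (pa_act g^-1%g x))) }.

Fact pow_Theta_lin phi : pow_Theta phi -> linear phi.
Proof. by move=> [p ->]; apply: fs_totalL => i; exact: (amul_bilin A).2. Qed.
Fact pow_Theta_ract phi : pow_Theta phi ->
  forall x a, phi (pow_ract x a) = phi x ** a.
Proof.
move=> [p ->] x a; rewrite /pow_fun.
rewrite (fs_total_comp x ((amul_bilin A).1 a)) => [|i]; last exact: amul_0x.
by apply: fs_total_ext => i; exact: amulA.
Qed.
Fact pow_Theta0 : pow_Theta (fun=> 0).
Proof.
exists 0; apply/funext => x; rewrite /pow_fun fs_totalE => [|i]; last exact: amul_0x.
by rewrite big1 // => i _; exact: amul_x0.
Qed.
Fact pow_ThetaB phi psi : pow_Theta phi -> pow_Theta psi ->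
  pow_Theta (fun x => phi x - psi x).
Proof.
move=> [p ->] [q ->]; exists (p - q); apply/funext => x.
rewrite /pow_fun -fs_totalB => [|i|i]; try exact: amul_0x.
by apply: fs_total_ext => i; rewrite fsDE fsNE (linB ((amul_bilin A).1 _)).
Qed.
Fact pow_Theta_mul a phi : pow_Theta phi -> pow_Theta (fun x => a ** phi x).
Proof.
move=> [p ->]; exists (pow_lact a p); apply/funext => x; rewrite /pow_fun.
rewrite (fs_total_comp x ((amul_bilin A).2 a)) => [|i]; last exact: amul_0x.
by apply: fs_total_ext => i; exact: amulA.
Qed.

Definition plain_mod (gamma : plain_action) : fmod A :=
  @FMod A pow_rmod gamma (pa_lin gamma) (pa_ract gamma) (pa_act1 gamma)
    (pa_act_mul gamma) pow_Theta pow_Theta_lin pow_Theta_ract pow_Theta0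
    pow_ThetaB pow_Theta_mul (pa_Theta gamma).

(* The elementary tensor a (x) v of A (x) C^n = A^n. *)
Fact scale0_idx (a : A) (i : n) : (0 : C^o) *: a = 0.
Proof. exact: scale0r. Qed.
Definition pow_tens (a : A) (v : fspow C^o) : fspow A :=
  fs_map (fun (_ : n) (c : C^o) => (c : C) *: a) (scale0_idx a) v.

Definition linear_action (mu : G -> fspow C^o -> fspow C^o) : Prop :=
  [/\ forall g, linear (mu g), forall v, mu 1%g v = v
    & forall g h v, mu (g * h)%g v = mu g (mu h v)].

(* gamma = alpha (x) mu: the elementary tensors span A^n, so the second
   conjunct determines gamma. *)
Definition is_tensor_action (gamma : plain_action)
    (mu : G -> fspow C^o -> fspow C^o) : Prop :=
  linear_action mu /\
  forall g a v, gamma g (pow_tens a v) = pow_tens (aact g a) (mu g v).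

End Plain.

Definition in_C (A : galg) (E : fmod A) : Prop :=
  [/\ discrete_alg_au A, cofull E, cofull_Theta E, discrete_alg_au (Kalg E)
    & exists (n : choiceType) (gamma : plain_action A n)
        (mu : G -> fspow n C^o -> fspow n C^o), is_tensor_action gamma mu /\
      exists (U : E -> plain_mod gamma) Us, functional_extension U Us].

Section InternalTensor.
Variables (A B : galg) (pi : algHom A B) (E : fmod A).

Definition itens_rel : set (tensor E B) := [set z | exists (x : E) (a : A) (b : B),
  z = (x |* a) *t b - x *t (pi a ** b)].
Definition itens_car : lmodType C := quot (span_subspace itens_rel).

Definition itens (x : E) (b : B) : itens_car := qpi _ (x *t b).

Lemma itens_rel_lift (U : lmodType C) (f : tensor E B -> U) : linear f ->
  (forall x a b, f ((x |* a) *t b) = f (x *t (pi a ** b))) ->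
  forall z, sp_set (span_subspace itens_rel) z -> f z = 0.
Proof.
move=> lf h; apply: (lspan_ind (S := itens_rel)) => [|c z t [x [a [b ->]]] IH].
  exact: lin0.
by rewrite lf IH linB // h subrr scaler0 addr0.
Qed.

Lemma itens_bal x a b : itens (x |* a) b = itens x (pi a ** b).
Proof. by apply/qpiP; apply: lspan_incl; exists x, a, b. Qed.

Lemma itens_ext (U : lmodType C) (f g : itens_car -> U) : linear f -> linear g ->
  (forall x b, f (itens x b) = g (itens x b)) -> f =1 g.
Proof.
move=> lf lg h; apply: quot_ext => t; move: t.
apply: (@tens_ext _ _ _ _ (f \o qpi _) (g \o qpi _)).
- by move=> c s t /=; rewrite qpi_linear lf.
- by move=> c s t /=; rewrite qpi_linear lg.
- exact: h.
Qed.

Let idl : linear (@id E). Proof. by []. Qed.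
Let rl (c : B) : linear (fun b => b ** c). Proof. exact: (amul_bilin B).1. Qed.

Definition itens_ract (x : itens_car) (c : B) : itens_car :=
  qlift (fun t => qpi _ (tmap id (fun b => b ** c) t)) x.

Let ract_lin c :
  linear (fun t : tensor E B => qpi (span_subspace itens_rel)
            (tmap id (fun b => b ** c) t)).
Proof. by move=> d s t; rewrite tmap_linear // qpi_linear. Qed.

Let ract_rel c z : sp_set (span_subspace itens_rel) z ->
  qpi (span_subspace itens_rel) (tmap id (fun b => b ** c) z) = 0.
Proof.
move: z; apply: (itens_rel_lift (ract_lin c)) => x a b.
by rewrite !tmapE // -amulA; exact: itens_bal.
Qed.

Lemma itens_ract_linl c : linear (fun x => itens_ract x c).
Proof. exact: (qlift_linear (ract_lin c) (@ract_rel c)). Qed.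

Lemma itens_ractE x b c : itens_ract (itens x b) c = itens x (b ** c).
Proof. by rewrite /itens_ract (qliftE (ract_lin c) (@ract_rel c)) tmapE. Qed.

Fact itens_ract_bilin : bilin itens_ract.
Proof.
split=> [c|x c b b']; first exact: itens_ract_linl.
move: x; apply: itens_ext => [|d x y|x b0]; first exact: itens_ract_linl.
  rewrite !itens_ract_linl !scalerDr !scalerA [c * d]mulrC !addrA.
  by congr (_ + _); rewrite -!addrA; congr (_ + _); rewrite addrC.
rewrite !itens_ractE (amul_bilin B).2.
by rewrite /itens (tens_bilin _ _).2 qpi_linear.
Qed.

Fact itens_ractA x b c : itens_ract (itens_ract x b) c = itens_ract x (b ** c).
Proof.
move: x; apply: itens_ext => [d x y||x b0]; [|exact: itens_ract_linl|].
  by rewrite !itens_ract_linl.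
by rewrite !itens_ractE amulA.
Qed.

Definition itens_rmod : rmod B := RMod itens_ract_bilin itens_ractA.

Definition itens_act g (x : itens_car) : itens_car :=
  qlift (fun t => qpi _ (tmap (@mact _ E g) (@aact B g) t)) x.

Let ml g : linear (@mact A E g). Proof. exact: mact_lin. Qed.
Let al g : linear (@aact B g). Proof. exact: aact_lin. Qed.

Let act_lin g : linear (fun t : tensor E B =>
  qpi (span_subspace itens_rel) (tmap (@mact _ E g) (@aact B g) t)).
Proof. by move=> d s t; rewrite tmap_linear // qpi_linear. Qed.

Let act_rel g z : sp_set (span_subspace itens_rel) z ->
  qpi (span_subspace itens_rel) (tmap (@mact _ E g) (@aact B g) z) = 0.
Proof.
move: z; apply: (itens_rel_lift (@act_lin g)) => x a b.
by rewrite !tmapE // mact_ract aactM -ah_act; exact: itens_bal.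
Qed.

Fact itens_act_lin g : linear (itens_act g).
Proof. exact: (qlift_linear (@act_lin g) (@act_rel g)). Qed.

Lemma itens_actE g x b : itens_act g (itens x b) = itens (mact g x) (aact g b).
Proof. by rewrite /itens_act (qliftE (@act_lin g) (@act_rel g)) tmapE. Qed.

Fact itens_act_ract g x c :
  itens_act g (itens_ract x c) = itens_ract (itens_act g x) (aact g c).
Proof.
move: x; apply: itens_ext => [d x y|d x y|x b].
- by rewrite itens_ract_linl itens_act_lin.
- by rewrite itens_act_lin itens_ract_linl.
- by rewrite itens_actE !itens_ractE itens_actE aactM.
Qed.
Fact itens_act1 x : itens_act 1%g x = x.
Proof.
move: x; apply: itens_ext => [|//|x b]; first exact: itens_act_lin.
by rewrite itens_actE mact1 aact1.
Qed.
Fact itens_act_mul g h x : itens_act (g * h)%g x = itens_act g (itens_act h x).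
Proof.
move: x; apply: itens_ext => [|d x y|x b]; first exact: itens_act_lin.
  by rewrite !itens_act_lin.
by rewrite !itens_actE mact_mul aact_mul.
Qed.

(* (phi (x) c)(xi (x) b) = c pi(phi(xi)) b *)
Definition itens_fun (phi : E -> A) (c : B) : itens_car -> B :=
  qlift (tlift (fun x b => c ** pi (phi x) ** b)).

Section Fun.
Variables (phi : E -> A) (c : B).
Hypothesis hphi : Theta phi.

Let bil : bilin (fun (x : E) (b : B) => c ** pi (phi x) ** b).
Proof.
have [b1 b2] := amul_bilin B.
split=> [b d x y|x]; last exact: b2.
by rewrite (Theta_lin hphi) (ah_lin pi) (b2 c) (b1 b).
Qed.

Let rel z : sp_set (span_subspace itens_rel) z ->
  tlift (fun x b => c ** pi (phi x) ** b) z = 0.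
Proof.
move: z; apply: (itens_rel_lift (tlift_linear bil)) => x a b.
by rewrite !tliftE // (Theta_ract hphi) ah_mul !amulA.
Qed.

Lemma itens_funE x b : itens_fun phi c (itens x b) = c ** pi (phi x) ** b.
Proof. by rewrite /itens_fun (qliftE (tlift_linear bil) rel) tliftE. Qed.

Lemma itens_fun_linear : linear (itens_fun phi c).
Proof. exact: (qlift_linear (tlift_linear bil) rel). Qed.
End Fun.

Definition itens_gen : set (itens_car -> B) :=
  [set chi | exists (phi : E -> A) c, Theta phi /\ chi = itens_fun phi c].
Definition itens_Theta : set (itens_car -> B) := lspan itens_gen.

Fact itens_Theta_lin phi : itens_Theta phi -> linear phi.
Proof.
move: phi; apply: lspan_ind => [d x y|e phi psi [f [c [hf ->]]] IH d x y].
  by rewrite [LHS]/GRing.zero /= scaler0 addr0.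
rewrite -![(_ + psi) _]/(e *: _ + psi _) (itens_fun_linear _ hf) IH.
rewrite !scalerDr !scalerA [e * d]mulrC !addrA.
by congr (_ + _); rewrite -!addrA; congr (_ + _); rewrite addrC.
Qed.

Fact itens_Theta_ract phi : itens_Theta phi ->
  forall x a, phi (itens_ract x a) = phi x ** a.
Proof.
have b1 := (amul_bilin B).1.
move: phi; apply: lspan_ind => [x a|e phi psi [f [c [hf ->]]] IH x a].
  by rewrite (lin0 (b1 a)).
rewrite -![(_ + psi) _]/(e *: _ + psi _) IH (b1 a); congr (e *: _ + _).
move: x; apply: itens_ext => [d x y|d x y|x b].
- by rewrite itens_ract_linl itens_fun_linear.
- by rewrite itens_fun_linear // (b1 a).
- by rewrite itens_ractE !itens_funE // amulA.
Qed.

Fact itens_Theta0 : itens_Theta (fun=> 0).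
Proof. exact: lspan0. Qed.

Fact itens_ThetaB phi psi : itens_Theta phi -> itens_Theta psi ->
  itens_Theta (fun x => phi x - psi x).
Proof.
move=> hp hq; rewrite (_ : (fun=> _) = (-1) *: psi + phi); first exact: lspanL.
by apply/funext => x; rewrite addrC -scaleN1r.
Qed.

Fact itens_Theta_mul a phi : itens_Theta phi -> itens_Theta (fun x => a ** phi x).
Proof.
have b2 := (amul_bilin B).2 a.
move: phi; apply: lspan_ind => [|e phi psi [f [c [hf ->]]] IH].
  rewrite (_ : (fun=> _) = 0); first exact: lspan0.
  by apply/funext => x; exact: (lin0 b2).
rewrite (_ : (fun=> _) = e *: itens_fun f (a ** c) + (fun x => a ** psi x)).
  by apply: lspanL => //; apply: lspan_incl; exists f, (a ** c).
apply/funext => x; rewrite [LHS]b2; congr (e *: _ + _).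
move: x; apply: itens_ext => [d x y||x b]; [|exact: itens_fun_linear|].
  by rewrite itens_fun_linear // b2.
by rewrite !itens_funE // !amulA.
Qed.

Fact itens_Theta_act g phi : itens_Theta phi ->
  itens_Theta (fun x => aact g (phi (itens_act g^-1%g x))).
Proof.
move: phi; apply: lspan_ind => [|e phi psi [f [c [hf ->]]] IH].
  rewrite (_ : (fun=> _) = 0); first exact: lspan0.
  by apply/funext => x; exact: (lin0 (al g)).
pose f' x := aact g (f (mact g^-1%g x)).
have hf' : Theta f' by exact: Theta_act.
rewrite (_ : (fun=> _) = e *: itens_fun f' (aact g c) +
                         (fun x => aact g (psi (itens_act g^-1%g x)))).
  by apply: lspanL => //; apply: lspan_incl; exists f', (aact g c).
apply/funext => x; rewrite [LHS]al; congr (e *: _ + _).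
move: x; apply: itens_ext => [d x y||x b]; [|exact: itens_fun_linear|].
  by rewrite itens_act_lin itens_fun_linear // al.
by rewrite itens_actE !itens_funE // !aactM aactVK -ah_act.
Qed.

Definition itensor : fmod B :=
  @FMod B itens_rmod itens_act itens_act_lin itens_act_ract itens_act1
    itens_act_mul itens_Theta itens_Theta_lin itens_Theta_ract itens_Theta0
    itens_ThetaB itens_Theta_mul itens_Theta_act.

End InternalTensor.

Section TensorAlgebra.
Variables A B : galg.
Let T : lmodType C := tensor A B.

Definition talg_mul : T -> T -> T := tpair (@amul A) (@amul B).
Definition talg_act g : T -> T := tmap (@aact A g) (@aact B g).

Let bA := amul_bilin A.
Let bB := amul_bilin B.
Let lA g : linear (@aact A g). Proof. exact: aact_lin. Qed.
Let lB g : linear (@aact B g). Proof. exact: aact_lin. Qed.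

Fact talg_mul_bilin : bilin talg_mul.
Proof. exact: tpair_bilin. Qed.
Let mE := tpairE bA bB.
Let ml := talg_mul_bilin.1.
Let mr := talg_mul_bilin.2.

Fact talg_mulA s t u : talg_mul s (talg_mul t u) = talg_mul (talg_mul s t) u.
Proof.
move: s; apply: tens_ext => [|c x y|a b]; [exact: ml|by rewrite !(ml, mr)|].
move: t; apply: tens_ext => [c x y|c x y|a' b']; [by rewrite ml mr|by rewrite mr ml|].
move: u; apply: tens_ext => [c x y|c x y|a'' b'']; [by rewrite !mr|by rewrite mr|].
by rewrite /talg_mul !mE !amulA.
Qed.
Fact talg_act_lin g : linear (talg_act g).
Proof. exact: tmap_linear. Qed.
Let aE g := tmapE (lA g) (lB g).
Fact talg_actM g s t :
  talg_act g (talg_mul s t) = talg_mul (talg_act g s) (talg_act g t).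
Proof.
have la := @talg_act_lin g.
move: s; apply: tens_ext => [c x y|c x y|a b]; [by rewrite ml la|by rewrite la ml|].
move: t; apply: tens_ext => [c x y|c x y|a' b']; [by rewrite mr la|by rewrite la mr|].
by rewrite /talg_mul /talg_act mE !aE mE !aactM.
Qed.
Fact talg_act1 s : talg_act 1%g s = s.
Proof.
move: s; apply: tens_ext => [|//|a b]; first exact: talg_act_lin.
by rewrite /talg_act aE !aact1.
Qed.
Fact talg_act_mul g h s : talg_act (g * h)%g s = talg_act g (talg_act h s).
Proof.
move: s; apply: tens_ext => [|c x y|a b]; first exact: talg_act_lin.
  by rewrite !talg_act_lin.
by rewrite /talg_act !aE !aact_mul.
Qed.

Definition talg : galg :=
  GAlg talg_mulA talg_mul_bilin talg_act_lin talg_actM talg_act1 talg_act_mul.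

End TensorAlgebra.

Section ExternalTensor.
Variables (A B : galg) (E : fmod A) (F : fmod B).

Definition etens_car : lmodType C := tensor E F.
Definition etens_ract : etens_car -> talg A B -> etens_car :=
  tpair (@ract A E) (@ract B F).
Definition etens_act g : etens_car -> etens_car :=
  tmap (@mact A E g) (@mact B F g).

Let bE := ract_bilin E.
Let bF := ract_bilin F.
Let lE g : linear (@mact A E g). Proof. exact: mact_lin. Qed.
Let lF g : linear (@mact B F g). Proof. exact: mact_lin. Qed.

Fact etens_ract_bilin : bilin etens_ract.
Proof. exact: tpair_bilin. Qed.
Let rE := tpairE bE bF.
Let rl := etens_ract_bilin.1.
Let rr := etens_ract_bilin.2.
Let ml := (talg_mul_bilin A B).1.
Let mr := (talg_mul_bilin A B).2.
Let mE := tpairE (amul_bilin A) (amul_bilin B).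

Fact etens_ractA x s t : etens_ract (etens_ract x s) t = etens_ract x (s ** t).
Proof.
move: x; apply: tens_ext => [c x y||x y]; [by rewrite !rl|exact: rl|].
move: s; apply: tens_ext => [c s s'|c s s'|a b].
- by rewrite rr rl.
- by rewrite [(_ + _) ** _]ml rr.
move: t; apply: tens_ext => [c t t'|c t t'|a' b'].
- by rewrite rr.
- by rewrite [_ ** _]mr rr.
by rewrite [_ ** _]mE /etens_ract !rE !ractA.
Qed.
Definition etens_rmod : rmod (talg A B) := RMod etens_ract_bilin etens_ractA.

Fact etens_act_lin g : linear (etens_act g).
Proof. exact: tmap_linear. Qed.
Let aE g := tmapE (lE g) (lF g).
Let tE g := tmapE (@aact_lin A g) (@aact_lin B g).
Fact etens_act_ract g x s :
  etens_act g (etens_ract x s) = etens_ract (etens_act g x) (aact g s).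
Proof.
have la := @etens_act_lin g.
move: x; apply: tens_ext => [c x y|c x y|x y]; [by rewrite rl la|by rewrite la rl|].
move: s; apply: tens_ext => [c s s'|c s s'|a b]; [by rewrite rr la|by rewrite aact_lin rr|].
by rewrite [aact g _]tE /etens_ract /etens_act rE !aE rE !mact_ract.
Qed.
Fact etens_act1 x : etens_act 1%g x = x.
Proof.
move: x; apply: tens_ext => [|//|x y]; first exact: etens_act_lin.
by rewrite /etens_act aE !mact1.
Qed.
Fact etens_act_mul g h x : etens_act (g * h)%g x = etens_act g (etens_act h x).
Proof.
move: x; apply: tens_ext => [|c x y|x y]; first exact: etens_act_lin.
  by rewrite !etens_act_lin.
by rewrite /etens_act !aE !mact_mul.
Qed.

Definition etens_gen : set (etens_car -> talg A B) :=
  [set chi | exists (phi : E -> A) (psi : F -> B),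
     [/\ Theta phi, Theta psi & chi = tmap phi psi]].
Definition etens_Theta : set (etens_car -> talg A B) := lspan etens_gen.

Let tl (phi : E -> A) (psi : F -> B) : Theta phi -> Theta psi ->
  linear (tmap phi psi).
Proof. by move=> hp hq; apply: tmap_linear; exact: Theta_lin. Qed.

Let tmE (phi : E -> A) (psi : F -> B) : Theta phi -> Theta psi ->
  forall x y, tmap phi psi (x *t y) = phi x *t psi y.
Proof. by move=> hp hq x y; apply: tmapE; exact: Theta_lin. Qed.

Fact etens_Theta_lin phi : etens_Theta phi -> linear phi.
Proof.
move: phi; apply: lspan_ind => [d x y|e phi psi [f [f' [hf hf' ->]]] IH d x y].
  by rewrite [LHS]/GRing.zero /= scaler0 addr0.
rewrite -![(_ + psi) _]/(e *: _ + psi _) tl // IH.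
rewrite !scalerDr !scalerA [e * d]mulrC !addrA.
by congr (_ + _); rewrite -!addrA; congr (_ + _); rewrite addrC.
Qed.

Fact etens_Theta_ract phi : etens_Theta phi ->
  forall x a, phi (etens_ract x a) = phi x ** a.
Proof.
move: phi; apply: lspan_ind => [x a|e phi psi [f [f' [hf hf' ->]]] IH x a].
  by rewrite [RHS](lin0 (ml a)).
rewrite -![(_ + psi) _]/(e *: _ + psi _) IH [RHS](ml a); congr (e *: _ + _).
move: x; apply: tens_ext => [d x y|d x y|x y].
- by rewrite rl tl.
- by rewrite tl // [LHS]ml.
move: a; apply: tens_ext => [d a b|d a b|a b].
- by rewrite rr tl.
- by rewrite [LHS]mr.
by rewrite /etens_ract rE !tmE // [RHS]mE (Theta_ract hf) (Theta_ract hf').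
Qed.

Fact etens_Theta0 : etens_Theta (fun=> 0).
Proof. exact: lspan0. Qed.

Fact etens_ThetaB phi psi : etens_Theta phi -> etens_Theta psi ->
  etens_Theta (fun x => phi x - psi x).
Proof.
move=> hp hq; rewrite (_ : (fun=> _) = (-1) *: psi + phi); first exact: lspanL.
by apply/funext => x; rewrite addrC -scaleN1r.
Qed.

Fact etens_Theta_mul a phi : etens_Theta phi -> etens_Theta (fun x => a ** phi x).
Proof.
move: phi; apply: lspan_ind => [|e phi psi [f [f' [hf hf' ->]]] IH].
  rewrite (_ : (fun=> _) = 0); first exact: lspan0.
  by apply/funext => x; exact: (lin0 (mr a)).
rewrite (_ : (fun=> _) = e *: (fun x => (a : talg A B) ** tmap f f' x) + (fun x => a ** psi x)).
  apply: lspanL => //; elim/tens_ind: a {IH} => [|c a b t IH].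
    rewrite (_ : (fun=> _) = 0); first exact: lspan0.
    by apply/funext => x; exact: (lin0 (ml _)).
  rewrite (_ : (fun=> _) = c *: tmap (fun x => a ** f x) (fun x => b ** f' x) +
     (fun x => (t : talg A B) ** tmap f f' x)).
    apply: lspanL => //; apply: lspan_incl.
    by do 2 eexists; split; last reflexivity; exact: Theta_mul.
  apply/funext => x; rewrite [LHS]ml; congr (c *: _ + _).
  have h1 := Theta_mul a hf; have h2 := Theta_mul b hf'.
  move: x; apply: tens_ext => [d x y||x y]; [|exact: tl|].
    by rewrite tl // [LHS]mr.
  by rewrite !tmE // [LHS]mE.
by apply/funext => x; exact: (mr a).
Qed.

Fact etens_Theta_act g phi : etens_Theta phi ->
  etens_Theta (fun x => aact g (phi (etens_act g^-1%g x))).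
Proof.
have al := @talg_act_lin A B g.
move: phi; apply: lspan_ind => [|e phi psi [f [f' [hf hf' ->]]] IH].
  rewrite (_ : (fun=> _) = 0); first exact: lspan0.
  by apply/funext => x; exact: (lin0 al).
pose k x := aact g (f (mact g^-1%g x)); pose k' x := aact g (f' (mact g^-1%g x)).
have hk : Theta k by exact: Theta_act.
have hk' : Theta k' by exact: Theta_act.
rewrite (_ : (fun=> _) = e *: tmap k k' +
                         (fun x => aact g (psi (etens_act g^-1%g x)))).
  by apply: lspanL => //; apply: lspan_incl; exists k, k'.
apply/funext => x; rewrite [LHS]al; congr (e *: _ + _).
move: x; apply: tens_ext => [d x y||x y]; [|exact: tl|].
  by rewrite etens_act_lin tl // al.
by rewrite {1}/etens_act aE !tmE // [LHS]tE.
Qed.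

Definition etensor : fmod (talg A B) :=
  @FMod (talg A B) etens_rmod etens_act etens_act_lin etens_act_ract etens_act1
    etens_act_mul etens_Theta etens_Theta_lin etens_Theta_ract etens_Theta0
    etens_ThetaB etens_Theta_mul etens_Theta_act.

End ExternalTensor.

Section Corner.
Variables (A : galg) (hA : has_approximate_unit A) (E : fmod A).
Let EA : fmod A := sum2 E (self_mod A).

Definition corner_alg : galg := Kalg EA.

Definition mop_fun (b : A) : EA -> EA := fun x => (0, b ** x.2).

Fact mop_compact b : @compact_ops A EA (mop_fun b).
Proof.
have [b1 b2] := amul_bilin A.
elim/fin_sums_ind: (au_quadratik hA b) => [|x y [c [d ->]] IH].
  rewrite (_ : mop_fun 0 = 0); first exact: fin_sums0.
  by apply/funext => x; rewrite /mop_fun (lin0 (b1 _)).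
rewrite (_ : mop_fun _ = rank_one ((0, c) : EA) (fun x : EA => 0 + d ** x.2)
                         + mop_fun y).
  apply: fin_sumsD => //; apply: fin_sums1; do 2 eexists; split; last reflexivity.
  exists (fun=> 0), (amul d); split=> //; first exact: Theta0.
  by exists d.
apply/funext => z.
have e1 : (0 : E) = 0 |* (0 + d ** z.2) + 0.
  by rewrite addr0 (lin0 ((ract_bilin E).1 _)).
have e2 : (c ** d + y) ** z.2 = c ** (0 + d ** z.2) + y ** z.2.
  by rewrite add0r (linD (b1 _)) amulA.
exact: (congr2 pair e1 e2).
Qed.

Definition mop (b : A) : corner_alg := mk_compact (mop_compact b).

Lemma mopE b : cop (mop b) = mop_fun b. Proof. by []. Qed.

Lemma mop_linear : linear mop.
Proof.
move=> c a b; apply: cop_inj; apply/funext => x.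
rewrite [RHS]/(c *: mop_fun a x + mop_fun b x) [LHS]/= /mop_fun.
rewrite ((amul_bilin A).1 _); congr (_, _).
by rewrite /= scaler0 addr0.
Qed.

Lemma mop_mul a b : mop (a ** b) = mop a ** mop b.
Proof.
by apply: cop_inj; apply/funext => x; rewrite [LHS]/= /mop_fun -amulA.
Qed.

Lemma mop_act g b : mop (aact g b) = aact g (mop b).
Proof.
apply: cop_inj; apply/funext => x; rewrite [RHS]/= /sum2_act /mop_fun /=.
by rewrite aactM aactVK (lin0 (@mact_lin A E g)).
Qed.

Lemma mop_inj : injective mop.
Proof.
move=> a b h; have [e [_ ae _ be]] := au2 hA a b.
have := congr1 (fun T : corner_alg => (cop T ((0, e) : EA)).2) h.
by rewrite [LHS]/= [RHS]/= ae be.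
Qed.

Lemma mop_corner a b (T : corner_alg) : exists c, mop a ** T ** mop b = mop c.
Proof.
have [b1 b2] := amul_bilin A.
suff [d hd] : exists d : A, forall x, (cop T ((0, b ** x) : EA)).2 = d ** x.
  exists (a ** d); apply: cop_inj; apply/funext => x.
  by rewrite [LHS]/= /mop_fun /= hd amulA.
have : @compact_ops A EA (cop T) by exact: copP.
move: (cop T); apply: fin_sums_ind => [|T1 T2 [eta [phi [hphi ->]]] [d hd]].
  by exists 0 => x; rewrite (lin0 (b1 _)).
exists ((eta : EA).2 ** phi ((0, b) : EA) + d) => x.
rewrite -![(_ + T2) _]/(_ + T2 _) [LHS]/= hd (linD (b1 _)); congr (_ + _).
rewrite /rank_one [LHS]/= -amulA; congr (_ ** _).
rewrite -(Theta_ract hphi); congr phi.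
by rewrite [RHS]/= /sum2_ract /= (lin0 ((ract_bilin E).1 _)).
Qed.

Variable F : fmod corner_alg.

Definition corner_set : set F := [set x | exists (xi : F) b, x = xi |* mop b].

Fact corner_set0 : corner_set 0.
Proof. by exists 0, 0; rewrite (lin0 ((ract_bilin F).1 _)). Qed.

Fact corner_setL c x y : corner_set x -> corner_set y -> corner_set (c *: x + y).
Proof.
move=> [xi [a ->]] [eta [b ->]]; have [e [_ ae _ be]] := au2 hA a b.
exists (c *: (xi |* mop a) + eta |* mop b), e.
by rewrite ((ract_bilin F).1 _) !ractA -!mop_mul ae be.
Qed.

Definition corner_space : subspace F := Subspace corner_set0 corner_setL.
Definition corner_car : lmodType C := sub_of corner_space.

Definition cval (x : corner_car) : F := sub_val x.
Definition mk_corner (x : F) (hx : corner_set x) : corner_car :=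
  SubOf (introT (sp_predP corner_space x) hx).

Lemma cvalP (x : corner_car) : corner_set (cval x).
Proof. exact: (elimT (sp_predP corner_space _) (sub_valP x)). Qed.

Lemma cval_inj : injective cval. Proof. exact: val_inj. Qed.

Lemma cval_linear : linear cval. Proof. by []. Qed.

Fact corner_ract_in (x : corner_car) (c : A) : corner_set (cval x |* mop c).
Proof. by exists (cval x), c. Qed.

(* (xi m_b) c = xi m_(bc) *)
Definition corner_ract (x : corner_car) (c : A) : corner_car :=
  mk_corner (corner_ract_in x c).

Fact corner_ract_bilin : bilin corner_ract.
Proof.
split=> [c d x y|x d a b]; apply: cval_inj.
  exact: (ract_bilin F).1.
by rewrite [LHS]/= mop_linear; exact: (ract_bilin F).2.
Qed.
Fact corner_ractA x a b :
  corner_ract (corner_ract x a) b = corner_ract x (a ** b).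
Proof. by apply: cval_inj; rewrite [RHS]/= mop_mul; exact: ractA. Qed.
Definition corner_rmod : rmod A := RMod corner_ract_bilin corner_ractA.

Fact corner_act_in g (x : corner_car) : corner_set (mact g (cval x)).
Proof.
have [xi [b ->]] := cvalP x; exists (mact g xi), (aact g b).
by rewrite mact_ract mop_act.
Qed.
Definition corner_act g (x : corner_car) : corner_car :=
  mk_corner (corner_act_in g x).
Fact corner_act_lin g : linear (corner_act g).
Proof. by move=> c x y; apply: cval_inj; exact: (@mact_lin _ F g). Qed.
Fact corner_act_ract g x a :
  corner_act g (corner_ract x a) = corner_ract (corner_act g x) (aact g a).
Proof. by apply: cval_inj; rewrite [RHS]/= mop_act; exact: mact_ract. Qed.
Fact corner_act1 x : corner_act 1%g x = x.
Proof. by apply: cval_inj; exact: mact1. Qed.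
Fact corner_act_mul g h x : corner_act (g * h)%g x = corner_act g (corner_act h x).
Proof. by apply: cval_inj; exact: mact_mul. Qed.

(* psi is m_b phi restricted to F M_A, with values read in A along b |-> mop b,
   which identifies A with M_A (mop_inj). *)
Definition is_corner_fun (b : A) (phi : F -> corner_alg) (psi : corner_car -> A) :=
  forall x, mop (psi x) = mop b ** phi (cval x).

Lemma corner_fun_exists b phi : Theta phi -> exists psi, is_corner_fun b phi psi.
Proof.
move=> hphi.
suff /choice [psi h] : forall x, exists a, mop a = mop b ** phi (cval x) by exists psi.
move=> x.
have [xi [c ->]] := cvalP x; have [d hd] := mop_corner b c (phi xi).
by exists d; rewrite -hd (Theta_ract hphi) amulA.
Qed.

Definition corner_Theta : set (corner_car -> A) :=
  [set psi | exists b phi, Theta phi /\ is_corner_fun b phi psi].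

Let kb1 := (amul_bilin corner_alg).1.
Let kb2 := (amul_bilin corner_alg).2.

Fact corner_Theta_lin psi : corner_Theta psi -> linear psi.
Proof.
move=> [b [phi [hphi h]]] c x y; apply: mop_inj.
by rewrite mop_linear !h (Theta_lin hphi) kb2.
Qed.
Fact corner_Theta_ract psi : corner_Theta psi ->
  forall x a, psi (corner_ract x a) = psi x ** a.
Proof.
move=> [b [phi [hphi h]]] x a; apply: mop_inj.
by rewrite mop_mul !h -amulA -(Theta_ract hphi).
Qed.
Fact corner_Theta0 : corner_Theta (fun=> 0).
Proof.
exists 0, (fun=> 0); split=> [|x]; first exact: Theta0.
by rewrite (lin0 mop_linear) (lin0 (kb1 _)).
Qed.
Fact corner_ThetaB phi psi : corner_Theta phi -> corner_Theta psi ->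
  corner_Theta (fun x => phi x - psi x).
Proof.
move=> [b [p [hp hb]]] [c [q [hq hc]]]; have [e [ea _ eb _]] := au2 hA b c.
exists e, (fun x => mop b ** p x - mop c ** q x); split=> [|x].
  by apply: ThetaB; exact: Theta_mul.
by rewrite (linB mop_linear) hb hc (linB (kb2 _)) !amulA -!mop_mul ea eb.
Qed.
Fact corner_Theta_mul a phi : corner_Theta phi -> corner_Theta (fun x => a ** phi x).
Proof.
move=> [b [p [hp hb]]]; exists (a ** b), p; split=> // x.
by rewrite !mop_mul hb amulA.
Qed.
Fact corner_Theta_act g phi : corner_Theta phi ->
  corner_Theta (fun x => aact g (phi (corner_act g^-1%g x))).
Proof.
move=> [b [p [hp hb]]].
exists (aact g b), (fun x => aact g (p (mact g^-1%g x))); split=> [|x].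
  exact: Theta_act.
by rewrite !mop_act hb aactM.
Qed.

Definition corner : fmod A :=
  @FMod A corner_rmod corner_act corner_act_lin corner_act_ract corner_act1
    corner_act_mul corner_Theta corner_Theta_lin corner_Theta_ract corner_Theta0
    corner_ThetaB corner_Theta_mul corner_Theta_act.

End Corner.

End FunctionalModules.

Notation "a ** b" := (amul a b).
Notation "x |* a" := (ract x a).

(* Main.v *)
Require Import Defs.
From HB Require Import structures.
From mathcomp Require Import all_boot all_order all_algebra complex.
From mathcomp Require Import finmap boolp classical_sets functions cardinality.
From mathcomp Require Import fsbigop reals.

(** The class is first described by conditions that are easy to check on
    generators.

    An algebra has an approximate unit as soon as every element has a left unit
    and a right unit: units for finitely many elements are made from single ones
    by the composite [e + f - f e] ([common_unit], [au_of_units]).  Applied to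
    [K(E)], this turns the approximate unit of [K(E)] together with the two
    cofullness conditions into local units: every point [x] is of the form
    [\sum_j x_j psi_j(x)], and every functional [phi] is of the form
    [\sum_j phi(x_j) psi_j].  In the presence of local units, injectivity and
    density of a functional extension hold for every homomorphism of functional
    modules ([hom_extension]).  Thus a module over an algebra with an approximate
    unit is in the class when it has local units and a homomorphism to a plain
    module with tensor action ([inC_of_hom]).

    Such a homomorphism is handled in the form of a [frame]: an equivariant map
    from [E] to [A^n] and an equivariant relation between functionals on [E] and
    families in [A^n] representing them, such that the expansion of a functional
    is also an expansion of its family.  A relation can be given on generators;
    the expansions imply that it is single-valued ([fcov_eq0], [frame_hom]) and
    that the functionals have local units ([frame_right_units]).  Conversely
    every module in the class has a frame ([inC_frame]), over an action on [C^n]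
    whose matrices have finite rows, so that the action can be reused with other
    coefficients.

    It then remains to produce local units for points and a frame in each case.
    For a plain module with an arbitrary action of a finite group, the action is
    untwisted by the regular representation, and functionals are averaged over
    the group ([finite_group_frame]).  For direct sums everything is done
    coordinatewise ([sum_frame]).  For [E (x)_pi B] and for the external tensor
    product the families are [c pi(p)] and the exterior products of families
    ([itens_frame], [etens_frame]).  For a corner module, the coordinates of [F]
    are operators on [E (+) A]; multiplied by [m_b], they become columns and rows,
    that is, vectors and functionals of [E (+) A], to which the frame of [E (+) A]
    applies ([corner_frame]). *)

Set Implicit Arguments.
Unset Strict Implicit.
Unset Printing Implicit Defensive.

Import GRing.Theory.
Local Open Scope classical_set_scope.
Local Open Scope ring_scope.
Local Open Scope complex_scope.

(** * Finitely supported families as tensor products *)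

Section Families.
Variable R : realType.
Local Notation C := (R[i]).
Local Notation "X ^^ n" := (fspow n X) (at level 30).
Local Notation dlt := (@delta C _).

Lemma fs_sum (n : choiceType) (V : n -> lmodType C) (I : Type) (r : seq I)
    (P : pred I) (F : I -> fsfam V) j :
  (\sum_(i <- r | P i) F i) j = \sum_(i <- r | P i) F i j.
Proof.
elim: r => [|i r IH]; rewrite ?big_nil // !big_cons; case: (P i) => //.
by rewrite fsDE IH.
Qed.

Section PureTensor.
Variables (n : choiceType) (X : lmodType C).

Fact scale0_any (x : X) (i : n) : (0 : C^o) *: x = 0.
Proof. exact: scale0r. Qed.

Definition ptens (x : X) (v : C^o ^^ n) : X ^^ n :=
  fs_map (fun (_ : n) (c : C^o) => (c : C) *: x) (scale0_any x) v.

Lemma ptensE x v i : ptens x v i = (v i : C) *: x.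
Proof. by []. Qed.

Lemma ptens_bilin : bilin ptens.
Proof.
split=> [v c x y|x c v w]; apply: fs_ext => i; rewrite fsLE !ptensE.
  by rewrite scalerDr !scalerA mulrC.
by rewrite fsLE scalerDl scalerA.
Qed.

Lemma ptens_deltaE x i j : ptens x (dlt i) j = if j == i then x else 0.
Proof. by rewrite ptensE deltaE; case: eqP => _; rewrite ?scale1r ?scale0r. Qed.

Lemma ptens_sum (y : X ^^ n) :
  y = \sum_(i <- fset_set [set i | y i != 0]) ptens (y i) (dlt i).
Proof.
apply: fs_ext => j; rewrite fs_sum.
under eq_bigr do rewrite ptens_deltaE.
have [jy|jy] := boolP (j \in fset_set [set i | y i != 0]).
  rewrite (big_fsetD1 j) //= eqxx big1_fset ?addr0 // => i.
  by rewrite !inE eq_sym => /andP[/negbTE -> _].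
rewrite big1_fset => [|i iy _]; last by case: eqP => // ji; rewrite ji iy in jy.
apply/eqP; apply: contraNT jy => yj; rewrite in_fset_set ?inE //; exact: fs_fin.
Qed.

Lemma ptens_ind (P : X ^^ n -> Prop) : P 0 ->
  (forall x i y, P y -> P (ptens x (dlt i) + y)) -> forall y, P y.
Proof.
move=> P0 PD y; rewrite (ptens_sum y).
by elim: (enum_fset _) => [|i r IH]; rewrite ?big_nil // big_cons; apply: PD.
Qed.

(** The tensors of basis vectors span [X^n], so an identity between linear maps
    on families need only be checked on them.  Nearly every computation with
    families below is an instance of this. *)
Lemma ptens_ext (U : lmodType C) (f g : X ^^ n -> U) : linear f -> linear g ->
  (forall x i, f (ptens x (dlt i)) = g (ptens x (dlt i))) -> f =1 g.
Proof.
move=> lf lg h; elim/ptens_ind => [|x i y IH]; first by rewrite !lin0.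
by rewrite !linD // h IH.
Qed.

Lemma fs_total_delta (U : lmodType C) (f : n -> X -> U) x i :
  (forall i, f i 0 = 0) -> fs_total f (ptens x (dlt i)) = f i x.
Proof.
move=> f0; rewrite /fs_total (fsbigTE [fset i]%fset) => [|j].
  by rewrite big_seq_fset1 ptens_deltaE eqxx.
by rewrite inE ptens_deltaE => /negbTE ->.
Qed.

End PureTensor.

Lemma ptens_scal (n : choiceType) (c : C) (i : n) :
  ptens (c : C^o) (dlt i) = c *: dlt i.
Proof.
by apply: fs_ext => j; rewrite ptens_deltaE fsZE deltaE; case: eqP => _;
   rewrite /GRing.scale /= ?mulr1 ?mulr0.
Qed.

Lemma delta_ext (n : choiceType) (U : lmodType C) (f g : C^o ^^ n -> U) :
  linear f -> linear g -> (forall i, f (dlt i) = g (dlt i)) -> f =1 g.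
Proof.
move=> lf lg h; apply: ptens_ext => // x i.
by rewrite ptens_scal !linZ // h.
Qed.

Section TensorOfMaps.
Variables (n m : choiceType) (X Y : lmodType C).

(** The operator [a (x) f] from [X (x) C^n] to [Y (x) C^m]. *)
Definition tm (a : X -> Y) (f : C^o ^^ n -> C^o ^^ m) : X ^^ n -> Y ^^ m :=
  fs_total (fun i x => ptens (a x) (f (dlt i))).

Variables (a : X -> Y) (f : C^o ^^ n -> C^o ^^ m).
Hypothesis la : linear a.

Lemma tm_linear : linear (tm a f).
Proof.
by apply: fs_totalL => i c x y; rewrite la; exact: (ptens_bilin _ _).1.
Qed.

Lemma tm_delta x i : tm a f (ptens x (dlt i)) = ptens (a x) (f (dlt i)).
Proof.
by rewrite /tm fs_total_delta // => j; rewrite lin0 // (lin0 ((ptens_bilin _ _).1 _)).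
Qed.

Lemma tmE : linear f -> forall x v, tm a f (ptens x v) = ptens (a x) (f v).
Proof.
move=> lf x; apply: delta_ext => [c v w|c v w|i]; last exact: tm_delta.
  by rewrite (ptens_bilin _ _).2 tm_linear.
by rewrite lf (ptens_bilin _ _).2.
Qed.
End TensorOfMaps.

Lemma tm_id (n : choiceType) (X : lmodType C) (y : X ^^ n) : tm id id y = y.
Proof.
move: y; apply: (@ptens_ext _ _ _ _ id) => // [|x i]; first exact: tm_linear.
by rewrite tm_delta.
Qed.

Lemma tm_comp (n m k : choiceType) (X Y Z : lmodType C) (a : Y -> Z) (b : X -> Y)
    (f : C^o ^^ m -> C^o ^^ k) (g : C^o ^^ n -> C^o ^^ m) y :
  linear a -> linear b -> linear f -> tm a f (tm b g y) = tm (a \o b) (f \o g) y.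
Proof.
move=> la lb lf.
have lab : linear (a \o b) by move=> c u v /=; rewrite lb la.
move: y; apply: ptens_ext => [c u v||x i].
- by rewrite tm_linear // tm_linear.
- exact: tm_linear.
- by rewrite !tm_delta //= tmE.
Qed.

Lemma eq_tm (n m : choiceType) (X Y : lmodType C) (a b : X -> Y)
    (f g : C^o ^^ n -> C^o ^^ m) :
  a =1 b -> f =1 g -> tm a f =1 tm b g.
Proof. by move=> /funext -> /funext ->. Qed.

Section Dot.
Variables (n : choiceType) (X Y Z : lmodType C) (h : X -> Y -> Z).
Hypothesis hb : bilin h.

Definition dot (p : X ^^ n) (y : Y ^^ n) : Z := fs_total (fun i => h (p i)) y.

Lemma dot_delta p y i : dot p (ptens y (dlt i)) = h (p i) y.
Proof. by rewrite /dot fs_total_delta // => j; rewrite (lin0 (hb.2 _)). Qed.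

Lemma dot_linr p : linear (dot p).
Proof. by apply: fs_totalL => i; exact: hb.2. Qed.

Lemma dot_linl y : linear (dot^~ y).
Proof.
move=> c p q; move: y; apply: ptens_ext => [||y i]; try exact: dot_linr.
  move=> d y z; rewrite !dot_linr !scalerDr !scalerA mulrC !addrA.
  by congr (_ + _); rewrite -!addrA; congr (_ + _); rewrite addrC.
by rewrite !dot_delta fsLE hb.1.
Qed.

Lemma dot_deltal x i y : dot (ptens x (dlt i)) y = h x (y i).
Proof.
move: y; apply: ptens_ext => [|c y z|y j]; first exact: dot_linr.
  by rewrite fsLE hb.2.
rewrite dot_delta !ptens_deltaE eq_sym; case: eqP => // _.
by rewrite (lin0 (hb.1 _)) (lin0 (hb.2 _)).
Qed.
End Dot.

Lemma mul_bilin : bilin (fun c d : C^o => c * d : C^o).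
Proof.
by split=> [d c z z'|z c d d']; rewrite /GRing.scale /= ?mulrDl ?mulrDr ?mulrA //;
   rewrite [z * c]mulrC.
Qed.

(** The standard pairing [<p, v> = \sum_i p_i v_i] of [C^n] with itself. *)
Definition scal (n : choiceType) : C^o ^^ n -> C^o ^^ n -> C^o :=
  dot (fun c d : C^o => c * d : C^o).

Lemma scal_bilin n : bilin (@scal n).
Proof.
by split=> v; [exact: (dot_linl mul_bilin) | exact: (dot_linr mul_bilin)].
Qed.


Lemma scal_delta n (v : C^o ^^ n) i : scal v (dlt i) = v i.
Proof.
have := dot_delta mul_bilin v 1 i; rewrite ptens_scal scale1r mulr1.
exact.
Qed.

Lemma scal_deltal n (v : C^o ^^ n) i : scal (dlt i) v = v i.
Proof.
have := dot_deltal mul_bilin (1 : C^o) i v; rewrite ptens_scal scale1r mul1r.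
exact.
Qed.

Lemma comp_lin (X Y Z : lmodType C) (f : Y -> Z) (g : X -> Y) :
  linear f -> linear g -> linear (fun x => f (g x)).
Proof. by move=> lf lg c x y; rewrite lg lf. Qed.

Lemma dot_ptens (n : choiceType) (X Y Z : lmodType C) (h : X -> Y -> Z) x v y w :
  bilin h -> dot h (ptens x v) (ptens y w : Y ^^ n) = (scal v w : C) *: h x y.
Proof.
move=> hb.
have [[p1 p2] [q1 q2]] := (@ptens_bilin n X, @ptens_bilin n Y).
have [s1 s2] := @scal_bilin n.
move: w; apply: delta_ext.
- exact: comp_lin (dot_linr hb _) (q2 y).
- by move=> c w w'; rewrite s2 scalerDl scalerA.
by move=> i; rewrite dot_delta // ptensE scal_delta (linZ (hb.1 _)).
Qed.

(** If [f] and [g] preserve the standard pairing and [a], [b], [c] intertwine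
    [h] and [h'], then so do their tensor products: this is what makes the
    functional space [A^n] invariant under a tensor action. *)
Lemma dot_tm (n m : choiceType) (X Y Z X' Y' Z' : lmodType C)
    (h : X -> Y -> Z) (h' : X' -> Y' -> Z') (a : X -> X') (b : Y -> Y') (c : Z -> Z')
    (f g : C^o ^^ n -> C^o ^^ m) p y :
  bilin h -> bilin h' -> linear a -> linear b -> linear c ->
  (forall x y, h' (a x) (b y) = c (h x y)) ->
  (forall v w, scal (f v) (g w) = scal v w) ->
  dot h' (tm a f p) (tm b g y) = c (dot h p y).
Proof.
move=> hb hb' la lb lc hE fg.
move: y; apply: ptens_ext.
- exact: comp_lin (dot_linr hb' _) (tm_linear _ lb).
- exact: comp_lin lc (dot_linr hb _).
move=> y j; move: p; apply: ptens_ext.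
- exact: comp_lin (dot_linl hb' _) (tm_linear _ la).
- exact: comp_lin lc (dot_linl hb _).
by move=> x i; rewrite !tm_delta // !dot_ptens // hE fg (linZ lc).
Qed.

Section Box.
Variables (n m : choiceType) (X Y Z : lmodType C) (h : X -> Y -> Z).
Hypothesis hb : bilin h.

Fact box_fin (p : X ^^ n) (q : Y ^^ m) :
  finite_set [set ij : n * m | h (p ij.1) (q ij.2) != 0].
Proof.
apply: sub_finite_set (finite_setX (fs_fin p) (fs_fin q)) => -[i j] /= hij.
split=> /=; apply: contraNN hij => /eqP ->.
  by rewrite (lin0 (hb.1 _)).
by rewrite (lin0 (hb.2 _)).
Qed.

(** The exterior product of two families. *)
Definition box (p : X ^^ n) (q : Y ^^ m) : Z ^^ (n * m)%type :=
  @FsFam C (n * m)%type (fun=> Z) _ (box_fin p q).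

Lemma boxE p q i j : box p q (i, j) = h (p i) (q j).
Proof. by []. Qed.

Lemma box_bilin : bilin box.
Proof.
split=> [q c p p'|p c q q']; apply: fs_ext => -[i j]; rewrite fsLE !boxE fsLE.
  by rewrite hb.1.
by rewrite hb.2.
Qed.

Lemma box_delta x y i j :
  box (ptens x (dlt i)) (ptens y (dlt j)) = ptens (h x y) (dlt (i, j)).
Proof.
apply: fs_ext => -[k l]; rewrite boxE !ptens_deltaE xpair_eqE.
case: eqP => _; case: eqP => _ //=.
- by rewrite (lin0 (hb.2 _)).
- by rewrite (lin0 (hb.1 _)).
- by rewrite (lin0 (hb.1 _)).
Qed.
End Box.

Section BoxMaps.
Variables (n m : choiceType).

Definition vbox : C^o ^^ n -> C^o ^^ m -> C^o ^^ (n * m)%type := box mul_bilin.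

Lemma vbox_delta i j : vbox (dlt i) (dlt j) = dlt (i, j).
Proof.
have e (k : choiceType) (l : k) : dlt l = ptens (1 : C^o) (dlt l) by rewrite ptens_scal scale1r.
by rewrite /vbox (e n) (e m) box_delta mulr1 -e.
Qed.

Lemma vbox_bilin : bilin vbox. Proof. exact: box_bilin. Qed.

Lemma box_ptens (X Y Z : lmodType C) (h : X -> Y -> Z) (hb : bilin h) x y v w :
  box hb (ptens x v) (ptens y w) = ptens (h x y) (vbox v w).
Proof.
apply: fs_ext => -[i j]; rewrite boxE !ptensE (linZ (hb.1 _)) (linZ (hb.2 _)).
by rewrite scalerA.
Qed.
End BoxMaps.

Section TensorPairMaps.
Variables (n m n' m' : choiceType).
Variables (f : C^o ^^ n -> C^o ^^ n') (g : C^o ^^ m -> C^o ^^ m').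

(** [f (x) g], for [C^(n*m)] read as [C^n (x) C^m]. *)
Definition tmap2 : C^o ^^ (n * m)%type -> C^o ^^ (n' * m')%type :=
  free_ext (fun ij => vbox (f (dlt ij.1)) (g (dlt ij.2))).

Lemma tmap2_linear : linear tmap2.
Proof. exact: free_ext_linear. Qed.

Lemma tmap2_delta i j : tmap2 (dlt (i, j)) = vbox (f (dlt i)) (g (dlt j)).
Proof. exact: free_extE. Qed.

Hypotheses (lf : linear f) (lg : linear g).

Lemma tmap2E v w : tmap2 (vbox v w) = vbox (f v) (g w).
Proof.
move: v; apply: delta_ext => [||i].
- exact: comp_lin tmap2_linear ((vbox_bilin _ _).1 _).
- exact: comp_lin ((vbox_bilin _ _).1 _) lf.
move: w; apply: delta_ext => [||j].
- exact: comp_lin tmap2_linear ((vbox_bilin _ _).2 _).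
- exact: comp_lin ((vbox_bilin _ _).2 _) lg.
by rewrite vbox_delta tmap2_delta.
Qed.

Lemma tm_box (X Y Z X' Y' Z' : lmodType C) (h : X -> Y -> Z) (h' : X' -> Y' -> Z')
    (hb : bilin h) (hb' : bilin h') (a : X -> X') (b : Y -> Y') (c : Z -> Z') y z :
  linear a -> linear b -> linear c -> (forall x y, c (h x y) = h' (a x) (b y)) ->
  tm c tmap2 (box hb y z) = box hb' (tm a f y) (tm b g z).
Proof.
move=> la lb lc hE; have [b1 b2] := box_bilin n m hb; have [d1 d2] := box_bilin n' m' hb'.
move: y; apply: ptens_ext => [||x i].
- exact: comp_lin (tm_linear _ lc) (b1 _).
- exact: comp_lin (d1 _) (tm_linear _ la).
move: z; apply: ptens_ext => [||y j].
- exact: comp_lin (tm_linear _ lc) (b2 _).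
- exact: comp_lin (d2 _) (tm_linear _ lb).
by rewrite box_delta !tm_delta // box_ptens hE tmap2_delta.
Qed.
End TensorPairMaps.

Lemma dot_box (n m : choiceType) (X Y Z X' Y' Z' X'' Y'' Z'' : lmodType C)
   (h : X -> Y -> Z) (hb : bilin h) (h' : X' -> Y' -> Z') (hb' : bilin h')
   (k : X -> X' -> X'') (l : Y -> Y' -> Y'') (o : Z -> Z' -> Z'')
   (o' : X'' -> Y'' -> Z'') (p : X ^^ n) (q : Y ^^ m) y z :
  bilin k -> bilin l -> bilin o -> bilin o' ->
  (forall x y x' y', o (h x y) (h' x' y') = o' (k x x') (l y y')) ->
  dot o (box hb p q) (box hb' y z) = o' (dot k p y) (dot l q z).
Proof.
move=> kb lb ob ob' hE; have [d1 d2] := box_bilin n m hb'.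
move: y; apply: ptens_ext => [||x i].
- exact: comp_lin (dot_linr ob _) (d1 _).
- exact: comp_lin (ob'.1 _) (dot_linr kb _).
move: z; apply: ptens_ext => [||y j].
- exact: comp_lin (dot_linr ob _) (d2 _).
- exact: comp_lin (ob'.2 _) (dot_linr lb _).
by rewrite box_delta !dot_delta // boxE hE.
Qed.


Section Push.
Variables (n m : choiceType) (f : n -> m).
Hypothesis f_inj : injective f.

Definition pushv : C^o ^^ n -> C^o ^^ m := free_ext (fun i => dlt (f i)).

Lemma pushv_linear : linear pushv.
Proof. exact: free_ext_linear. Qed.

Lemma pushv_delta i : pushv (dlt i) = dlt (f i).
Proof. exact: free_extE. Qed.

Definition push (X : lmodType C) : X ^^ n -> X ^^ m := tm id pushv.

Lemma push_linear X : linear (@push X).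
Proof. exact: tm_linear. Qed.

Lemma push_delta (X : lmodType C) (x : X) i :
  push (ptens x (dlt i)) = ptens x (dlt (f i)).
Proof. by rewrite /push tm_delta // pushv_delta. Qed.

Section Pull.
Variable X : lmodType C.

Fact pull_fin (q : X ^^ m) : finite_set [set i | q (f i) != 0].
Proof.
apply: (@finite_preimage _ _ [set j | q j != 0] f); last exact: fs_fin.
by move=> i j _ _; exact: f_inj.
Qed.

Definition pull (q : X ^^ m) : X ^^ n := FsFam (pull_fin q).

Lemma pullE q i : pull q i = q (f i). Proof. by []. Qed.

Lemma pull_linear : linear pull.
Proof. by move=> c p q; apply: fs_ext => i; rewrite fsLE !pullE fsLE. Qed.

Lemma pushK : cancel (@push X) pull.
Proof.
apply: (@ptens_ext _ _ _ (fun y => pull (push y)) id) => //.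
  exact: comp_lin pull_linear (@push_linear X).
move=> x i; rewrite push_delta; apply: fs_ext => j.
by rewrite pullE !ptens_deltaE (inj_eq f_inj).
Qed.
End Pull.

Variables (X Y Z : lmodType C) (h : X -> Y -> Z).
Hypothesis hb : bilin h.

Lemma dot_pushr p y : dot h p (push y) = dot h (pull p) y.
Proof.
move: y; apply: ptens_ext => [||y i].
- exact: comp_lin (dot_linr hb _) (@push_linear Y).
- exact: dot_linr.
by rewrite push_delta !dot_delta.
Qed.

End Push.

Section Spread.
Variables (n m : choiceType) (X Y : lmodType C).

Fact scale_bilin (V : lmodType C) : bilin (fun (c : C^o) (v : V) => (c : C) *: v).
Proof.
split=> [v d c c'|c d v w]; first by rewrite scalerDl scalerA.
by rewrite scalerDr !scalerA mulrC.
Qed.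

(** Under the identification of [Y^(n*m)] with [(Y^m)^n], the map [w] applied in
    each of the [n] places. *)
Definition spread (w : X -> Y ^^ m) (y : X ^^ n) : Y ^^ (n * m)%type :=
  fs_total (fun i x => box (scale_bilin Y) (dlt i) (w x)) y.

Variable w : X -> Y ^^ m.
Hypothesis lw : linear w.

Let b2 := (box_bilin n m (scale_bilin Y)).2.

Lemma spread_linear : linear (spread w).
Proof. by apply: fs_totalL => i; exact: comp_lin (b2 _) lw. Qed.

Lemma spread_delta x i :
  spread w (ptens x (dlt i)) = box (scale_bilin Y) (dlt i) (w x).
Proof. by rewrite /spread fs_total_delta // => j; rewrite (lin0 lw) (lin0 (b2 _)). Qed.

Lemma spreadE y i j : spread w y (i, j) = w (y i) j.
Proof.
elim/ptens_ind: y => [|x k y IH].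
  by rewrite (lin0 spread_linear) (lin0 lw).
rewrite (linD spread_linear) fsDE IH fsDE (linD lw) fsDE spread_delta boxE.
rewrite ptens_deltaE deltaE; case: eqP => _; rewrite ?scale1r //.
by rewrite (lin0 lw) scale0r.
Qed.
End Spread.

(** An equivariant map [w] from [X] to [Y^m] spreads to an equivariant map
    from [X (x) C^n] to [Y (x) C^n (x) C^m]. *)
Lemma tm_spread (n m n' m' : choiceType) (X Y X' Y' : lmodType C)
    (w : X -> Y ^^ m) (w' : X' -> Y' ^^ m') (a : Y -> Y') (b : X -> X')
    (f : C^o ^^ n -> C^o ^^ n') (g : C^o ^^ m -> C^o ^^ m') y :
  linear w -> linear w' -> linear a -> linear b -> linear g ->
  (forall x, tm a g (w x) = w' (b x)) ->
  tm a (tmap2 f g) (spread w y) = spread w' (tm b f y).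
Proof.
move=> lw lw' la lb lg wE; move: y; apply: ptens_ext => [||x i].
- exact: comp_lin (tm_linear _ la) (spread_linear lw).
- exact: comp_lin (spread_linear lw') (tm_linear _ lb).
rewrite spread_delta // tm_delta //.
have e k (l : k : choiceType) : dlt l = ptens (1 : C^o) (dlt l).
  by rewrite ptens_scal scale1r.
apply: fs_ext => -[k l]; rewrite spreadE // ptensE (linZ lw') -wE fsZE.
have [_ d2] := box_bilin n m (scale_bilin Y).
rewrite -[RHS](boxE (scale_bilin Y') (f (dlt i)) (tm a g (w x))); congr (fs_val _ (k, l)).
move: (w x); apply: ptens_ext => [||z j].
- exact: comp_lin (tm_linear _ la) (d2 _).
- exact: comp_lin ((box_bilin n' m' (scale_bilin Y')).2 _) (tm_linear _ la).
rewrite {1}e box_delta scale1r !tm_delta // tmap2_delta.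
by apply: fs_ext => -[u v]; rewrite boxE !ptensE scalerA.
Qed.

Lemma dot_spread (n m : choiceType) (X Y Z X' Y' Z' : lmodType C)
    (h : X -> Y -> Z) (h' : X' -> Y' -> Z') (w : X -> X' ^^ m) (w' : Y -> Y' ^^ m)
    (t : Z -> Z') (p : X ^^ n) y :
  bilin h -> bilin h' -> linear w -> linear w' -> linear t ->
  (forall x y, dot h' (w x) (w' y) = t (h x y)) ->
  dot h' (spread w p) (spread w' y) = t (dot h p y).
Proof.
move=> hb hb' lw lw' lt wE; move: y; apply: ptens_ext => [||y i].
- exact: comp_lin (dot_linr hb' _) (spread_linear lw').
- exact: comp_lin lt (dot_linr hb _).
rewrite dot_delta // -wE spread_delta //.
have [_ d2] := box_bilin n m (scale_bilin Y').
move: (w' y); apply: ptens_ext => [||z j].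
- exact: comp_lin (dot_linr hb' _) (d2 _).
- exact: dot_linr.
have -> : dlt i = ptens (1 : C^o) (dlt i) by rewrite ptens_scal scale1r.
by rewrite box_delta scale1r !dot_delta // spreadE.
Qed.

End Families.

(** * Dual pairs of representations and plain modules *)

Section Representations.
Variables (R : realType) (G : groupType).
Local Notation C := (R[i]).
Local Notation "X ^^ n" := (fspow n X) (at level 30).
Local Notation dlt := (@delta C _).

(** A linear action [rmu] of [G] on [C^n] gives a tensor action on the module
    [A^n] with functional space [A^n] only when the matrices of [rmu] have
    finite rows.  This is recorded by the contragredient maps [rnu]: they are
    the transposes of the inverses of [rmu], and exist on finitely supported
    vectors exactly when the rows are finite.  With both maps at hand, the
    points and the functionals of [A^n] are treated alike. *)
Record grep := GRep {
  rdim : choiceType;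
  rmu : G -> C^o ^^ rdim -> C^o ^^ rdim;
  rnu : G -> C^o ^^ rdim -> C^o ^^ rdim;
  rmu_lin : forall g, linear (rmu g);
  rnu_lin : forall g, linear (rnu g);
  rmu1 : forall v, rmu 1%g v = v;
  rmuM : forall g h v, rmu (g * h)%g v = rmu g (rmu h v);
  rscal : forall g v w, scal (rnu g v) (rmu g w) = scal v w }.

Section TrivialRep.
Variable n : choiceType.
Definition rep_triv : grep :=
  @GRep n (fun=> id) (fun=> id) (fun=> fun _ _ _ => erefl) (fun=> fun _ _ _ => erefl)
    (fun=> erefl) (fun _ _ _ => erefl) (fun _ _ _ => erefl).
End TrivialRep.

Section RegularRep.
Definition translate (g : G) : C^o ^^ G -> C^o ^^ G :=
  @pushv R _ _ (fun h : G => (g * h)%g).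

Fact translate_lin g : linear (translate g).
Proof. exact: pushv_linear. Qed.
Fact translate1 v : translate 1%g v = v.
Proof.
move: v; apply: (@delta_ext _ _ _ _ id) => // [|h]; first exact: translate_lin.
by rewrite /translate pushv_delta mul1g.
Qed.
Fact translateM g h v : translate (g * h)%g v = translate g (translate h v).
Proof.
move: v; apply: delta_ext => [||k]; first exact: translate_lin.
  exact: comp_lin (@translate_lin g) (@translate_lin h).
by rewrite /translate !pushv_delta mulgA.
Qed.
Fact translate_scal g v w : scal (translate g v) (translate g w) = scal v w.
Proof.
have [s1 s2] := @scal_bilin R G.
move: v; apply: delta_ext => [||i]; [|exact: s1|].
  exact: comp_lin (s1 _) (@translate_lin g).
move: w; apply: delta_ext => [||j]; [|exact: s2|].
  exact: comp_lin (s2 _) (@translate_lin g).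
rewrite /translate !pushv_delta !scal_delta !deltaE.
by rewrite (inj_eq (mulgI g)).
Qed.
Definition rep_reg : grep :=
  GRep translate_lin translate_lin translate1 translateM translate_scal.
End RegularRep.

Section ProductRep.
Variables r s : grep.
Let n := (rdim r * rdim s)%type.

Definition prod_mu g : C^o ^^ n -> C^o ^^ n := tmap2 (rmu g) (rmu g).
Definition prod_nu g : C^o ^^ n -> C^o ^^ n := tmap2 (@rnu r g) (@rnu s g).

Fact prod_mu_lin g : linear (prod_mu g). Proof. exact: tmap2_linear. Qed.
Fact prod_nu_lin g : linear (prod_nu g). Proof. exact: tmap2_linear. Qed.
Fact prod_mu1 v : prod_mu 1%g v = v.
Proof.
move: v; apply: (@delta_ext _ _ _ _ id) => // [|[i j]]; first exact: prod_mu_lin.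
by rewrite /prod_mu tmap2_delta !rmu1 vbox_delta.
Qed.
Fact prod_muM g h v : prod_mu (g * h)%g v = prod_mu g (prod_mu h v).
Proof.
move: v; apply: delta_ext => [||[i j]]; first exact: prod_mu_lin.
  exact: comp_lin (@prod_mu_lin g) (@prod_mu_lin h).
by rewrite /prod_mu !tmap2_delta tmap2E ?rmuM //; exact: rmu_lin.
Qed.
Fact prod_scal g v w : scal (prod_nu g v) (prod_mu g w) = scal v w.
Proof.
have [s1 s2] := @scal_bilin R n.
have sbox (x x' : C^o ^^ rdim r) (y y' : C^o ^^ rdim s) :
    scal (vbox x y) (vbox x' y') = scal x x' * scal y y'.
  apply: dot_box; try exact: mul_bilin.
  by move=> a b c d; rewrite mulrACA.
move: v; apply: delta_ext => [||[i k]]; [|exact: s1|].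
  exact: comp_lin (s1 _) (@prod_nu_lin g).
move: w; apply: delta_ext => [||[j l]]; [|exact: s2|].
  exact: comp_lin (s2 _) (@prod_mu_lin g).
by rewrite /prod_nu /prod_mu !tmap2_delta sbox !rscal -sbox !vbox_delta.
Qed.
Definition rep_prod : grep :=
  GRep prod_mu_lin prod_nu_lin prod_mu1 prod_muM prod_scal.
End ProductRep.

Section SumRep.
Variables (I : choiceType) (r : I -> grep).
Definition sum_idx : choiceType := {i : I & rdim (r i)}.

Definition sidx i (l : rdim (r i)) : sum_idx := existT _ i l.

Lemma sidx_inj i : injective (@sidx i).
Proof. by move=> k l /eqP; rewrite -tag_eqE /tag_eq /= eqxx tagged_asE => /eqP. Qed.

Definition sum_mu g : C^o ^^ sum_idx -> C^o ^^ sum_idx :=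
  free_ext (fun k => @pushv R _ _ (@sidx (tag k)) (rmu g (dlt (tagged k)))).
Definition sum_nu g : C^o ^^ sum_idx -> C^o ^^ sum_idx :=
  free_ext (fun k => @pushv R _ _ (@sidx (tag k)) (rnu g (dlt (tagged k)))).

Fact sum_mu_lin g : linear (sum_mu g). Proof. exact: free_ext_linear. Qed.
Fact sum_nu_lin g : linear (sum_nu g). Proof. exact: free_ext_linear. Qed.

Lemma sum_muE g i v : sum_mu g (@pushv R _ _ (@sidx i) v) = @pushv R _ _ (@sidx i) (rmu g v).
Proof.
move: v; apply: delta_ext => [||l].
- exact: comp_lin (@sum_mu_lin g) (pushv_linear _).
- exact: comp_lin (pushv_linear _) (@rmu_lin _ g).
by rewrite pushv_delta [LHS]free_extE.
Qed.
Lemma sum_nuE g i v : sum_nu g (@pushv R _ _ (@sidx i) v) = @pushv R _ _ (@sidx i) (rnu g v).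
Proof.
move: v; apply: delta_ext => [||l].
- exact: comp_lin (@sum_nu_lin g) (pushv_linear _).
- exact: comp_lin (pushv_linear _) (@rnu_lin _ g).
by rewrite pushv_delta [LHS]free_extE.
Qed.

Lemma sum_delta (k : sum_idx) : dlt k = @pushv R _ _ (@sidx (tag k)) (dlt (tagged k)).
Proof. by case: k => i l; rewrite pushv_delta. Qed.

(** Vectors supported on different summands are orthogonal; on one summand the
    pairing is the given one.  The cast transports [v] along [i = j]. *)
Lemma scal_push i j v w : scal (@pushv R _ _ (@sidx i) v) (@pushv R _ _ (@sidx j) w) =
  if eqP is ReflectT e then scal (ecast z (C^o ^^ rdim (r z)) e v) w else 0.
Proof.
have [s1 s2] := @scal_bilin R sum_idx.
move: w; apply: delta_ext => [||l].
- exact: comp_lin (s2 _) (pushv_linear _).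
- case: eqP => [e|_]; first exact: (@scal_bilin R _).2.
  by move=> c x y; rewrite scaler0 addr0.
rewrite pushv_delta scal_delta.
move: v; apply: delta_ext => [||k].
- by move=> c x y; rewrite pushv_linear fsLE.
- case: eqP => [e|_]; last by move=> c x y; rewrite scaler0 addr0.
  by destruct e => /=; exact: (@scal_bilin R _).1.
rewrite pushv_delta deltaE; case: eqP => [e|ij].
  by destruct e; rewrite /= scal_delta deltaE (inj_eq (@sidx_inj _)).
by case: eqP => // -[]/esym.
Qed.

Fact sum_mu1 v : sum_mu 1%g v = v.
Proof.
move: v; apply: (@delta_ext _ _ _ _ id) => // [|k]; first exact: sum_mu_lin.
by rewrite sum_delta sum_muE rmu1.
Qed.
Fact sum_muM g h v : sum_mu (g * h)%g v = sum_mu g (sum_mu h v).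
Proof.
move: v; apply: delta_ext => [||k]; first exact: sum_mu_lin.
  exact: comp_lin (@sum_mu_lin g) (@sum_mu_lin h).
by rewrite sum_delta !sum_muE rmuM.
Qed.
Fact sum_scal g v w : scal (sum_nu g v) (sum_mu g w) = scal v w.
Proof.
have [s1 s2] := @scal_bilin R sum_idx.
move: v; apply: delta_ext => [||k]; [|exact: s1|].
  exact: comp_lin (s1 _) (@sum_nu_lin g).
move: w; apply: delta_ext => [||l]; [|exact: s2|].
  exact: comp_lin (s2 _) (@sum_mu_lin g).
rewrite (sum_delta k) (sum_delta l) sum_nuE sum_muE !scal_push.
case: l => j l; case: k => i k /=; case: eqP => // e.
by destruct e; rewrite /= rscal.
Qed.
Definition rep_sum : grep := GRep sum_mu_lin sum_nu_lin sum_mu1 sum_muM sum_scal.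
End SumRep.

Section Target.
Variables (A : galg R G) (r : grep).
Local Notation n := (rdim r).

Definition tact g : A ^^ n -> A ^^ n := tm (@aact _ _ A g) (@rmu r g).
Definition tdual g : A ^^ n -> A ^^ n := tm (@aact _ _ A g) (@rnu r g).

Lemma tact_lin g : linear (tact g). Proof. exact/tm_linear/aact_lin. Qed.
Lemma tdual_lin g : linear (tdual g). Proof. exact/tm_linear/aact_lin. Qed.

(** Functionals moved by [rnu] and points moved by [rmu] keep their pairing up
    to the action on [A]; invariance of the functional space follows. *)
Lemma pow_fun_dual g p y : pow_fun (tdual g p) (tact g y) = aact g (pow_fun p y).
Proof.
have la : linear (@aact _ _ A g) by exact: aact_lin.
apply: (dot_tm (h := @amul _ _ A)) => //; try exact: amul_bilin.
  by move=> x z; rewrite aactM.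
exact: rscal.
Qed.

Lemma pow_ract_ptens (m : choiceType) (x a : A) v :
  pow_ract (ptens x v : A ^^ m) a = ptens (x ** a) v.
Proof. by apply: fs_ext => i; rewrite /= (linZ ((amul_bilin A).1 _)). Qed.

Lemma pow_lact_ptens (m : choiceType) (x a : A) v :
  pow_lact a (ptens x v : A ^^ m) = ptens (a ** x) v.
Proof. by apply: fs_ext => i; rewrite /= (linZ ((amul_bilin A).2 _)). Qed.

Lemma pow_lact_bilin (m : choiceType) : bilin (@pow_lact _ _ A m).
Proof.
split=> [y c a b|a c x y]; apply: fs_ext => i; rewrite fsLE.
  exact: (amul_bilin A).1.
by rewrite /pow_lact !fs_mapE fsLE; exact: (amul_bilin A).2.
Qed.

Lemma pow_fun_lact (m : choiceType) a (p : A ^^ m) y :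
  pow_fun (pow_lact a p) y = a ** pow_fun p y.
Proof.
rewrite /pow_fun (fs_total_comp y ((amul_bilin A).2 a)) => [|i].
  by apply: fs_total_ext => i; rewrite amulA.
exact: (lin0 ((amul_bilin A).2 _)).
Qed.

Fact tact_ract g x a : tact g (pow_ract x a) = pow_ract (tact g x) (aact g a).
Proof.
have l c : linear (fun x : A ^^ n => pow_ract x c) by exact: (pow_ract_bilin A n).1.
move: x; apply: ptens_ext => [||x i].
- exact: comp_lin (@tact_lin g) (l a).
- exact: comp_lin (l _) (@tact_lin g).
have la : linear (@aact _ _ A g) by exact: aact_lin.
by rewrite /tact pow_ract_ptens !tm_delta // aactM pow_ract_ptens.
Qed.

Lemma tdual_lact g p a : tdual g (pow_lact a p) = pow_lact (aact g a) (tdual g p).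
Proof.
have l c : linear (@pow_lact _ _ A n c) by exact: (pow_lact_bilin n).2.
move: p; apply: ptens_ext => [||x i].
- exact: comp_lin (@tdual_lin g) (l a).
- exact: comp_lin (l _) (@tdual_lin g).
have la : linear (@aact _ _ A g) by exact: aact_lin.
by rewrite /tdual pow_lact_ptens !tm_delta // aactM pow_lact_ptens.
Qed.

Fact tact1 x : tact 1%g x = x.
Proof.
rewrite -[RHS]tm_id; apply: eq_tm => y; [exact: aact1|exact: rmu1].
Qed.

Fact tactM g h x : tact (g * h)%g x = tact g (tact h x).
Proof.
rewrite /tact tm_comp; [|exact: aact_lin|exact: aact_lin|exact: rmu_lin].
apply: eq_tm => y; [exact: aact_mul|exact: rmuM].
Qed.

Fact tact_Theta g phi : @pow_Theta _ _ A n phi ->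
  @pow_Theta _ _ A n (fun x => aact g (phi (tact g^-1%g x))).
Proof.
move=> [p ->]; exists (tdual g p); apply/funext => x.
by rewrite -pow_fun_dual -tactM mulgV tact1.
Qed.

Definition target : plain_action A n :=
  PlainAction tact_lin tact_ract tact1 tactM tact_Theta.

Lemma pow_tensE (m : choiceType) (a : A) (v : C^o ^^ m) : pow_tens a v = ptens a v.
Proof. exact: fs_ext. Qed.

Lemma target_tensor : is_tensor_action target (@rmu r).
Proof.
split; first by split; [exact: rmu_lin|exact: rmu1|exact: rmuM].
by move=> g a v; rewrite !pow_tensE; apply: tmE; [exact: aact_lin|exact: rmu_lin].
Qed.
End Target.

End Representations.

(** * Local units *)

(** If every element has its own unit in [O], then finitely many elements have
    a common one: when [e] fixes the first ones and [f] fixes [m - e m], the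
    circle composite [f + e - f e] fixes them all and [m] as well.  The operators
    in [O] are arbitrary maps so that the lemma applies to multiplications of
    an algebra on either side, to compact operators acting on a module, and to
    compact operators acting on its functionals; in the last case the circle
    composite is available only on the subset [S]. *)
Lemma common_unit (M : zmodType) (S : set M) (O : set (M -> M)) :
  S 0 -> (forall m m', S m -> S m' -> S (m - m')) ->
  (forall f m, O f -> S m -> S (f m)) ->
  (forall f m m', O f -> S m -> S m' -> f (m - m') = f m - f m') ->
  (forall f e, O f -> O e ->
     exists2 g, O g & forall m, S m -> g m = f m + e m - f (e m)) ->
  (forall m, S m -> exists2 f, O f & f m = m) ->
  forall s : seq M, (forall m, m \in s -> S m) ->
    exists2 f, O f & forall m, m \in s -> f m = m.
Proof.
move=> S0 SB SO OB circ unit; elim=> [|m s IH] sS.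
  by have [f Of _] := unit 0 S0; exists f.
have [e Oe eP] : exists2 f, O f & forall m, m \in s -> f m = m.
  by apply: IH => m' m's; apply: sS; rewrite inE m's orbT.
have Sm : S m by apply: sS; rewrite mem_head.
have [f Of fP] := unit _ (SB _ _ Sm (SO _ _ Oe Sm)).
have [g Og gP] := circ f e Of Oe; exists g => // m'; rewrite inE.
case/predU1P=> [->|m's]; rewrite gP //.
- by rewrite addrAC -OB //; [rewrite fP subrK|exact: SO].
- by rewrite eP // addrAC subrr add0r.
- by apply: sS; rewrite inE m's orbT.
Qed.

Section Units.
Variables (R : realType) (G : groupType).
Local Notation C := (R[i]).

Section Algebra.
Variable A : galg R G.
Let b1 := (amul_bilin A).1.
Let b2 := (amul_bilin A).2.

Lemma au_seq : has_approximate_unit A -> forall s : seq A,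
  exists e : A, forall a, a \in s -> e ** a = a /\ a ** e = a.
Proof.
move=> [I [le [x [[inh _ tr dir] xP]]]] s.
suff [j hj] : exists j, forall i, le j i -> forall a, a \in s ->
    x i ** a = a /\ a ** x i = a.
  by have [k [jk _]] := dir j j; exists (x k); exact: hj.
elim: s => [|a s [j hj]]; first by case: inh => i; exists i.
have [k hk] := xP a; have [l [jl kl]] := dir j k.
exists l => i li b; rewrite inE => /predU1P[->|bs].
  by apply: hk; exact: tr li.
by apply: hj bs; exact: tr li.
Qed.

Lemma au_left : (forall a : A, exists e, e ** a = a) ->
  forall s : seq A, exists e, forall a, a \in s -> e ** a = a.
Proof.
move=> u s.
have [] := @common_unit A setT [set f | exists e, f = amul e] _ _ _ _ _ _ s _ => //.
- by move=> _ m m' [e ->] _ _; exact: linB.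
- move=> _ _ [e ->] [f ->]; exists (amul (e + f - e ** f)); first by eexists.
  by move=> m _; rewrite (linB (b1 m)) (linD (b1 m)) amulA.
- by move=> a _; have [e ea] := u a; exists (amul e) => //; exists e.
- by move=> f [e ->] eP; exists e.
Qed.

Lemma au_right : (forall a : A, exists e, a ** e = a) ->
  forall s : seq A, exists e, forall a, a \in s -> a ** e = a.
Proof.
move=> u s.
have [] := @common_unit A setT [set f | exists e : A, f = (fun a => a ** e)]
  _ _ _ _ _ _ s _ => //.
- by move=> _ m m' [e ->] _ _; exact: (linB (b1 e)).
- move=> _ _ [e ->] [f ->]; exists (fun a => a ** (e + f - f ** e)); first by eexists.
  by move=> m _; rewrite (linB (b2 m)) (linD (b2 m)) amulA.
- by move=> a _; have [e ea] := u a; exists (fun a => a ** e) => //; exists e.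
- by move=> f [e ->] eP; exists e.
Qed.

(** An algebra has an approximate unit as soon as each element has a left unit
    and a right unit.  The net is indexed by finite lists of elements; a two-sided
    unit for a list is again a circle composite [e + f - f e]. *)
Lemma au_of_units : (forall a : A, exists e, e ** a = a) ->
  (forall a : A, exists e, a ** e = a) -> discrete_alg_au A.
Proof.
move=> ul ur.
suff h : has_approximate_unit A by split=> //; exact: au_quadratik.
have /choice [e eP] : forall s : seq A, exists e, forall a, a \in s ->
    e ** a = a /\ a ** e = a.
  move=> s; have [[e eP] [f fP]] := (au_left ul s, au_right ur s).
  exists (e + f - f ** e) => a sa.
  rewrite (linB (b1 a)) (linD (b1 a)) (linB (b2 a)) (linD (b2 a)); split.
    by rewrite -amulA eP // addrK.
  by rewrite amulA fP // addrAC subrr add0r.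
exists (seq A), (fun s t : seq A => {subset s <= t}), e; split.
  split=> [|s //|s t u st tu a /st /tu //|s t]; first exact: (inhabits [::]).
  by exists (s ++ t); split=> a sa; rewrite mem_cat sa ?orbT.
by move=> a; exists [:: a] => s sub; apply: eP; apply: sub; rewrite mem_head.
Qed.

Lemma pow_fun_inj (n : choiceType) : has_approximate_unit A ->
  injective (@pow_fun _ _ A n).
Proof.
move=> /au2 hA p q pq; apply: fs_ext => i; have [e [_ pe _ qe]] := hA (p i) (q i).
have : pow_fun p (ptens e (delta C i)) = pow_fun q (ptens e (delta C i)).
  by rewrite pq.
by rewrite -[LHS]/(dot _ _ _) -[RHS]/(dot _ _ _) !(dot_delta (amul_bilin A)) pe qe.
Qed.
End Algebra.

Section Modules.
Variables (A : galg R G) (E : fmod A).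
(** That [K(E)] has local units on [E] and, in [right_units], on its functional
    space is the working form of three conditions at once: both cofullness
    conditions and the approximate unit of [K(E)]. *)
Definition left_units := forall x : E, exists2 k, compact_ops k & k x = x.

Definition right_units := forall phi : E -> A, Theta phi ->
  exists2 k : E -> E, compact_ops k & phi \o k = phi.

Lemma compact_opsP (k : E -> E) : compact_ops k ->
  exists l (x : 'I_l -> E) (phi : 'I_l -> E -> A),
    (forall j, Theta (phi j)) /\ k = (fun y => \sum_(j < l) x j |* phi j y).
Proof.
move=> [l [T [/choice [x /choice [phi hT]] ->]]].
exists l, x, phi; split=> [j|]; first by case: (hT j).
apply/funext => y; rewrite fct_sumE; apply: eq_bigr => j _.
by rewrite (hT j).2.
Qed.

Lemma compact_ops_sum l (x : 'I_l -> E) (phi : 'I_l -> E -> A) :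
  (forall j, Theta (phi j)) ->
  compact_ops (fun y => \sum_(j < l) x j |* phi j y).
Proof.
move=> h; exists l, (fun j => rank_one (x j) (phi j)); split.
  by move=> j; exists (x j), (phi j).
by apply/funext => y; rewrite fct_sumE.
Qed.

Lemma compact_ops_big (J : Type) (s : seq J) (x : J -> E) (phi : J -> E -> A) :
  (forall j, Theta (phi j)) ->
  compact_ops (fun y => \sum_(j <- s) x j |* phi j y).
Proof.
move=> h; elim: s => [|j s IH].
  by under eq_fun do rewrite big_nil; exact: fin_sums0.
under eq_fun do rewrite big_cons.
by apply: fin_sumsD IH; apply: fin_sums1; exists (x j), (phi j).
Qed.

Lemma compact_circ f e : compact_ops f -> compact_ops e ->
  compact_ops (fun x : E => f x + e x - f (e x)).
Proof.
move=> hf he.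
have hfe : compact_ops (f \o e) := compact_comp (mk_compact hf) (mk_compact he).
rewrite (_ : (fun=> _) = (-1) *: (f \o e) + (1 *: f + e)).
  by apply: compact_opsL => //; exact: compact_opsL.
by apply/funext => x; rewrite scale1r scaleN1r addrC.
Qed.

Lemma left_units_seq : left_units -> forall s : seq E,
  exists2 k, compact_ops k & forall x, x \in s -> k x = x.
Proof.
move=> u s; apply: (@common_unit _ setT) => //.
- by move=> f m m' hf _ _; exact: (linB (compact_lin hf)).
- by move=> f e hf he; exists (fun x => f x + e x - f (e x)) => //; exact: compact_circ.
Qed.

Lemma Theta_compact (phi : E -> A) (k : E -> E) :
  Theta phi -> compact_ops k -> @Theta _ _ A E (phi \o k).
Proof.
move=> hphi; move: k; apply: fin_sums_ind => [|T T' [x [psi [hpsi ->]]] IH].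
  rewrite (_ : _ \o _ = fun=> 0); first exact: Theta0.
  by apply/funext => x; exact: (lin0 (Theta_lin hphi)).
rewrite (_ : _ \o _ = fun y => phi x ** psi y + (phi \o T') y).
  by apply: ThetaD => //; exact: Theta_mul.
apply/funext => y; rewrite /= -![(_ + T') _]/(_ + T' _).
by rewrite (linD (Theta_lin hphi)) /rank_one (Theta_ract hphi).
Qed.

Lemma right_units_seq : right_units -> forall s : seq (E -> A),
  (forall phi, phi \in s -> Theta phi) ->
  exists2 k : E -> E, compact_ops k & forall phi, phi \in s -> phi \o k = phi.
Proof.
move=> u s sT.
have [] := @common_unit _ (@Theta _ _ A E)
  [set f : (E -> A) -> (E -> A) | exists2 k : E -> E, compact_ops k &
     f = (fun phi x => phi (k x))]
  _ _ _ _ _ _ s sT => //.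
- exact: Theta0.
- exact: ThetaB.
- by move=> _ phi [k hk ->] hphi; exact: Theta_compact.
- by move=> _ m m' [k hk ->].
- move=> _ _ [k hk ->] [k' hk' ->].
  exists (fun phi x => phi (k' x + k x - k' (k x))).
    by eexists; last reflexivity; exact: compact_circ.
  move=> phi hphi; apply/funext => x /=.
  by rewrite (linB (Theta_lin hphi)) (linD (Theta_lin hphi)) (addrC (phi (k' x))).
- move=> phi /u [k hk e]; exists (fun phi x => phi (k x)); last exact: e.
  by exists k.
- by move=> f [k hk ->] kP; exists k.
Qed.

Lemma cofull_left_units : left_units -> cofull E.
Proof.
move=> u x; have [k /compact_opsP [l [y [phi [hphi ->]]]] <-] := u x.
by exists l, (fun j => y j |* phi j x); split=> // j; exists (y j), x, (phi j).
Qed.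

Lemma cofull_right_units : right_units -> cofull_Theta E.
Proof.
move=> u phi hphi; have [k /compact_opsP [l [y [psi [hpsi ek]]]] e] := u _ hphi.
exists l, (fun j x => phi (y j) ** psi j x); split=> [j|].
  by exists phi, (psi j), (y j).
apply/funext => x; rewrite fct_sumE -[in LHS]e /= ek (lin_sum _ _ _ (Theta_lin hphi)).
by apply: eq_bigr => j _; exact: (Theta_ract hphi).
Qed.

End Modules.
End Units.

(** * Frames *)

Section Frames.
Variables (R : realType) (G : groupType).
Local Notation C := (R[i]).
Local Notation "X ^^ n" := (fspow n X) (at level 30).
Local Notation dlt := (@delta C _).

Definition ord_cat (T : Type) (l l' : nat) (u : 'I_l -> T) (v : 'I_l' -> T)
  (i : 'I_(l + l')) : T :=
  match fintype.split i with inl j => u j | inr j => v j end.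

Lemma ord_catl T l l' (u : 'I_l -> T) (v : 'I_l' -> T) i :
  ord_cat u v (lshift l' i) = u i.
Proof. by rewrite /ord_cat (unsplitK (inl i)). Qed.

Lemma ord_catr T l l' (u : 'I_l -> T) (v : 'I_l' -> T) i :
  ord_cat u v (rshift l i) = v i.
Proof. by rewrite /ord_cat (unsplitK (inr i)). Qed.

Section Expands.
Variables (A : galg R G) (E : fmod A) (n : choiceType).
Variable cov : (E -> A) -> A ^^ n -> Prop.

(** Every functional is to be recovered from its values at finitely many points,
    [phi = \sum_j phi(x_j) psi_j], and the family [p] representing it must
    follow the same formula. *)
Definition expands (phi : E -> A) (p : A ^^ n) : Prop :=
  exists l (x : 'I_l -> E) (psi : 'I_l -> E -> A) q,
    (forall j, cov (psi j) (q j)) /\ p = \sum_(j < l) pow_lact (phi (x j)) (q j).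

Lemma expandsD phi p p' : expands phi p -> expands phi p' -> expands phi (p + p').
Proof.
move=> [l [x [psi [q [h ->]]]]] [l' [x' [psi' [q' [h' ->]]]]].
exists (l + l')%N, (ord_cat x x'), (ord_cat psi psi'), (ord_cat q q'); split.
  by move=> j; rewrite /ord_cat; case: (fintype.split j).
by rewrite big_split_ord; congr (_ + _); apply: eq_bigr => j _;
   rewrite ?ord_catl ?ord_catr.
Qed.

Lemma expands_big (J : Type) (s : seq J) phi (p : J -> A ^^ n) :
  (forall j, expands phi (p j)) -> expands phi (\sum_(j <- s) p j).
Proof.
move=> h; elim: s => [|j s IH]; last by rewrite big_cons; exact: expandsD.
rewrite big_nil; exists 0%N, (fun=> 0), (fun=> phi), (fun=> 0).
by split; [case|rewrite big_ord0].
Qed.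

Lemma expands1 (phi : E -> A) x psi q : cov psi q -> expands phi (pow_lact (phi x) q).
Proof.
by move=> h; exists 1%N, (fun=> x), (fun=> psi), (fun=> q); rewrite big_ord1.
Qed.
End Expands.

(** A frame is a homomorphism of functional modules from [E] to a plain module
    with tensor action, presented so that it can be built on generators.  The map
    of functional spaces is given as a relation [fcov] between a functional and
    the family in [A^n] that represents it: on tensor products functionals are
    sums of elementary ones, and a relation may be declared on these without
    checking that the family does not depend on the chosen sum.  That the relation
    is single-valued comes afterwards, from [fcov_loc]. *)
Record frame (A : galg R G) (E : fmod A) := Frame {
  frep : grep R G;
  fmap : E -> A ^^ (rdim frep);
  fcov : (E -> A) -> A ^^ (rdim frep) -> Prop;
  fmap_lin : linear fmap;
  fmap_ract : forall x a, fmap (x |* a) = pow_ract (fmap x) a;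
  fmap_act : forall g x, fmap (mact g x) = tact g (fmap x);
  fcov_Theta : forall phi p, fcov phi p -> Theta phi;
  fcov_total : forall phi, Theta phi -> exists p, fcov phi p;
  fcov0 : fcov (fun=> 0) 0;
  fcovL : forall c phi p psi q, fcov phi p -> fcov psi q ->
    fcov (fun x => c *: phi x + psi x) (c *: p + q);
  fcov_mul : forall a phi p, fcov phi p ->
    fcov (fun x => a ** phi x) (pow_lact a p);
  fcov_act : forall g phi p, fcov phi p ->
    fcov (fun x => aact g (phi (mact g^-1%g x))) (tdual g p);
  fcovE : forall phi p, fcov phi p -> forall x, pow_fun p (fmap x) = phi x;
  fcov_loc : forall phi p, fcov phi p -> expands fcov phi p }.

Section Theory.
Variables (A : galg R G) (E : fmod A) (F : frame E).
Local Notation n := (rdim (frep F)).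
Local Notation cov := (@fcov A E F).
Let l1 := (@pow_lact_bilin R G A n).1.
Let l2 := (@pow_lact_bilin R G A n).2.

Lemma fcovD phi p psi q : cov phi p -> cov psi q ->
  cov (fun x => phi x + psi x) (p + q).
Proof.
move=> hp hq; have := fcovL 1 hp hq; rewrite scale1r.
by under eq_fun do rewrite scale1r.
Qed.

Lemma fcovB phi p psi q : cov phi p -> cov psi q ->
  cov (fun x => phi x - psi x) (p - q).
Proof.
move=> hp hq; have := fcovL (-1) hq hp; rewrite scaleN1r addrC.
by under eq_fun do rewrite scaleN1r addrC.
Qed.

Lemma fcov_sum l (a : 'I_l -> A) (psi : 'I_l -> E -> A) q :
  (forall j, cov (psi j) (q j)) ->
  cov (fun x => \sum_(j < l) a j ** psi j x) (\sum_(j < l) pow_lact (a j) (q j)).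
Proof.
elim: l a psi q => [|l IH] a psi q h.
  by rewrite big_ord0; under eq_fun do rewrite big_ord0; exact: fcov0.
rewrite big_ord_recl; under eq_fun do rewrite big_ord_recl.
by apply: fcovD; [exact: fcov_mul|apply: IH => j; exact: h].
Qed.

(** An expansion of the zero functional has only zero coefficients. *)
Lemma fcov_eq0 p : cov (fun=> 0) p -> p = 0.
Proof.
move=> /fcov_loc [l [x [psi [q [_ ->]]]]].
by rewrite big1 // => j _; rewrite (lin0 (l1 _)).
Qed.

Lemma fcov_uniq phi p q : cov phi p -> cov phi q -> p = q.
Proof.
move=> hp hq; apply/eqP; rewrite -subr_eq0; apply/eqP/fcov_eq0.
by have := fcovB hp hq; under eq_fun do rewrite subrr.
Qed.

Lemma fcov_loc_fun phi p l (x : 'I_l -> E) (psi : 'I_l -> E -> A) q :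
  cov phi p -> (forall j, cov (psi j) (q j)) ->
  p = \sum_(j < l) pow_lact (phi (x j)) (q j) ->
  forall y, phi y = \sum_(j < l) phi (x j) ** psi j y.
Proof.
move=> hp hq e y.
rewrite -(fcovE hp) {1}e -(fcovE (fcov_sum (fun j => phi (x j)) hq)).
by [].
Qed.

(** The operators that expand along a fixed finite list of points and
    functionals satisfy the hypotheses of [common_unit], so finitely many
    functionals can be expanded along the same list. *)
Lemma fcov_loc_seq (s : seq ((E -> A) * (A ^^ n))) :
  (forall m, m \in s -> cov m.1 m.2) ->
  exists l (x : 'I_l -> E) (psi : 'I_l -> E -> A) q,
    (forall j, cov (psi j) (q j)) /\
    forall m, m \in s -> m.2 = \sum_(j < l) pow_lact (m.1 (x j)) (q j).
Proof.
move=> sc.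
pose M : lmodType C := ((E -> A) * (A ^^ n))%type.
pose op l (x : 'I_l -> E) (psi : 'I_l -> E -> A) q (m : M) : M :=
  ((fun y => \sum_(j < l) m.1 (x j) ** psi j y), \sum_(j < l) pow_lact (m.1 (x j)) (q j)).
pose O : set (M -> M) := [set f | exists l (x : 'I_l -> E) (psi : 'I_l -> E -> A) q,
  (forall j, cov (psi j) (q j)) /\ f = op l x psi q].
have [||||||f [l [x [psi [q [h ->]]]]] hf] :=
    @common_unit M [set m | cov m.1 m.2] O _ _ _ _ _ _ s sc.
- exact: fcov0.
- by move=> m m' hm hm'; exact: fcovB.
- by move=> _ m [l [x [psi [q [h ->]]]]] hm; exact: fcov_sum.
- move=> _ m m' [l [x [psi [q [h ->]]]]] _ _; congr pair.
    apply/funext => y; rewrite -[RHS]/(_ - _) -sumrB; apply: eq_bigr => j _.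
    exact: (linB ((amul_bilin A).1 _)).
  by rewrite -sumrB; apply: eq_bigr => j _; exact: (linB (l1 _)).
- move=> _ _ [l [x [psi [q [h ->]]]]] [l' [x' [psi' [q' [h' ->]]]]].
  (* composing with the second expansion replaces the points [x j] by [y j] *)
  pose y j := \sum_(i < l') x' i |* psi' i (x j).
  exists (op _ (ord_cat (fun j => x j - y j) x') (ord_cat psi psi') (ord_cat q q')).
    do 4 eexists; split; last reflexivity.
    by move=> j; rewrite /ord_cat; case: (fintype.split j).
  move=> m hm; have hT := fcov_Theta hm.
  have e1 j : m.1 (x j - y j) = m.1 (x j) - \sum_(i < l') m.1 (x' i) ** psi' i (x j).
    rewrite (linB (Theta_lin hT)) (lin_sum _ _ _ (Theta_lin hT)); congr (_ - _).
    by apply: eq_bigr => i _; exact: (Theta_ract hT).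
  rewrite addrAC; congr pair.
    apply/funext => z; rewrite -[RHS]/(_ - _ + _) -sumrB big_split_ord /=.
    congr (_ + _); apply: eq_bigr => i _; rewrite ?ord_catl ?ord_catr //.
    by rewrite e1 (linB ((amul_bilin A).1 _)).
  rewrite -[RHS]/(_ - _ + _) -sumrB big_split_ord /=.
  congr (_ + _); apply: eq_bigr => i _; rewrite ?ord_catl ?ord_catr //.
  by rewrite e1 (linB (l1 _)).
- move=> m hm; have [l [x [psi [q [h e]]]]] := fcov_loc hm.
  exists (op l x psi q); first by exists l, x, psi, q.
  rewrite /op -e [RHS]surjective_pairing; congr pair; apply/funext => y.
  by rewrite -(fcov_loc_fun hm h e).
- by exists l, x, psi, q; split=> // m /hf {1}<-.
Qed.

Lemma frame_right_units : right_units E.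
Proof.
move=> phi hphi; have [p hp] := fcov_total F hphi.
have [l [x [psi [q [h e]]]]] := fcov_loc hp.
exists (fun y => \sum_(j < l) x j |* psi j y).
  by apply: compact_ops_sum => j; exact: fcov_Theta (h j).
apply/funext => y; rewrite /= (lin_sum _ _ _ (Theta_lin hphi)).
rewrite (fcov_loc_fun hp h e); apply: eq_bigr => j _.
exact: (Theta_ract hphi).
Qed.

Lemma frame_fun : exists v : (E -> A) -> A ^^ n, forall phi, Theta phi -> cov phi (v phi).
Proof.
have /choice [v hv] : forall phi : E -> A, exists p, Theta phi -> cov phi p.
  move=> phi; have [hphi|h] := pselect (Theta phi); last by exists 0.
  by have [p hp] := fcov_total F hphi; exists p.
by exists v.
Qed.

(** Single-valuedness turns the relation into a function, and makes that function
    additive, linear over [A] and equivariant. *)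
Lemma frame_hom : has_approximate_unit A ->
  exists Us, @fmod_hom _ _ A E (plain_mod (target A (frep F))) (@fmap A E F) Us.
Proof.
move=> hA; have [v hv] := frame_fun; exists (fun phi => pow_fun (v phi)).
have uniq phi p : cov phi p -> v phi = p.
  by move=> hp; apply: (fcov_uniq _ hp); apply: hv; exact: fcov_Theta hp.
split.
- split; [exact: (linD (@fmap_lin _ _ F))|exact: fmap_ract|exact: fmap_act].
- by move=> phi _; exists (v phi).
- split=> [phi psi hp hq|a phi hp|g phi hp].
  + rewrite (uniq _ _ (fcovD (hv _ hp) (hv _ hq))).
    apply/funext => y; exact: (linD (dot_linl (amul_bilin A) y)).
  + rewrite (uniq _ _ (fcov_mul a (hv _ hp))).
    by apply/funext => y; exact: pow_fun_lact.
  + rewrite (uniq _ _ (fcov_act g (hv _ hp))).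
    apply/funext => y; rewrite /= -pow_fun_dual -tactM mulgV tact1.
    by [].
- by move=> phi hp x; exact: (fcovE (hv _ hp)).
Qed.

End Theory.
End Frames.

(** * The class in terms of local units and frames *)

Section ClassC.
Variables (R : realType) (G : groupType).
Local Notation C := (R[i]).
Local Notation "X ^^ n" := (fspow n X) (at level 30).
Local Notation dlt := (@delta C _).

Section Homs.
Variables (A : galg R G) (E F : fmod A) (U : E -> F) (Us : (E -> A) -> (F -> A)).
Hypothesis hU : fmod_hom U Us.

Lemma hom0 : Us (fun=> 0) = fun=> 0.
Proof.
have [_ _ [UD _ _] _] := hU.
have := UD _ _ (Theta0 E) (Theta0 E); under eq_fun do rewrite addr0.
move=> h; apply/funext => y; apply: (addrI (Us (fun=> 0) y)).
by rewrite addr0 {3}h.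
Qed.

Lemma hom_sum l (a : 'I_l -> A) (psi : 'I_l -> E -> A) :
  (forall j, Theta (psi j)) ->
  Us (fun x => \sum_(j < l) a j ** psi j x) = fun y => \sum_(j < l) a j ** Us (psi j) y.
Proof.
have [_ _ [UD UM _] _] := hU.
elim: l a psi => [|l IH] a psi h.
  under eq_fun do rewrite big_ord0; rewrite hom0.
  by apply/funext => y; rewrite big_ord0.
under eq_fun do rewrite big_ord_recl.
rewrite UD ?UM ?IH //; first by apply/funext => y; rewrite big_ord_recl.
  exact: Theta_mul.
have Th (S : seq 'I_l) : Theta (fun x : E => \sum_(j <- S) a (lift ord0 j) ** psi (lift ord0 j) x).
  elim: S => [|j S IS]; first by under eq_fun do rewrite big_nil; exact: Theta0.
  by under eq_fun do rewrite big_cons; apply: ThetaD => //; exact: Theta_mul.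
exact: Th.
Qed.

Lemma right_units_sum phi : right_units E -> Theta phi ->
  exists l (x : 'I_l -> E) (psi : 'I_l -> E -> A), (forall j, Theta (psi j)) /\
    phi = fun y => \sum_(j < l) phi (x j) ** psi j y.
Proof.
move=> hR hphi; have [k /compact_opsP [l [x [psi [hpsi ek]]]] e] := hR _ hphi.
exists l, x, psi; split=> //; apply/funext => y.
rewrite -{1}e /= ek (lin_sum _ _ _ (Theta_lin hphi)).
by apply: eq_bigr => j _; exact: (Theta_ract hphi).
Qed.

(** With local units, a homomorphism is automatically a functional extension.
    It is injective since functionals separate points.  For the density condition
    write the given functionals as [\sum_j phi_i(z_j) psi_j] with common [z_j]
    and [psi_j]; then [\sum_j z_j Us(psi_j)(eta)] is the required point. *)
Lemma hom_extension : left_units E -> right_units E -> functional_extension U Us.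
Proof.
move=> hL hR; have [[UD Ur Ua] UT _ UE] := hU.
split=> // [x y exy|k phi hphi eta].
  have [K /compact_opsP [l [z [psi [hpsi eK]]]] xyK] := hL (x - y).
  apply/eqP; rewrite -subr_eq0 -xyK eK big1 // => j _.
  rewrite (linB (Theta_lin (hpsi j))) -!UE // exy subrr.
  exact: (lin0 ((ract_bilin E).2 _)).
have [|K /compact_opsP [l [z [psi [hpsi eK]]]] phiK] :=
    right_units_seq hR (s := [seq phi i | i <- enum 'I_k]).
  by move=> f /mapP [i _ ->].
exists (\sum_(j < l) z j |* Us (psi j) eta) => i.
have {1}<- : phi i \o K = phi i by apply: phiK; apply: map_f; rewrite mem_enum.
have li := Theta_lin (hphi i).
have -> : phi i \o K = fun x => \sum_(j < l) phi i (z j) ** psi j x.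
  apply/funext => x; rewrite /= eK (lin_sum _ _ _ li).
  by apply: eq_bigr => j _; exact: (Theta_ract (hphi i)).
rewrite hom_sum // (lin_sum _ _ _ li); apply: eq_bigr => j _.
by rewrite (Theta_ract (hphi i)).
Qed.
End Homs.

Lemma Kalg_au (A : galg R G) (E : fmod A) :
  left_units E -> right_units E -> discrete_alg_au (Kalg E).
Proof.
move=> hL hR; apply: au_of_units => T.
- have /compact_opsP [l [x [phi [hphi eT]]]] := copP T.
  have [k hk kP] := left_units_seq hL [seq x j | j <- enum 'I_l].
  exists (mk_compact hk); apply: cop_inj; apply/funext => y.
  rewrite /= eT (lin_sum _ _ _ (compact_lin hk)); apply: eq_bigr => j _.
  by rewrite (compact_ract hk) kP // map_f // mem_enum.
- have /compact_opsP [l [x [phi [hphi eT]]]] := copP T.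
  have [|k hk kP] := right_units_seq hR (s := [seq phi j | j <- enum 'I_l]).
    by move=> f /mapP [j _ ->].
  exists (mk_compact hk); apply: cop_inj; apply/funext => y.
  rewrite /= eT; apply: eq_bigr => j _.
  have <- // : (phi j \o k) y = phi j y.
  by rewrite kP // map_f // mem_enum.
Qed.

Lemma inC_of_hom (A : galg R G) (E : fmod A) (n : choiceType) (gamma : plain_action A n)
    mu (U : E -> plain_mod gamma) Us :
  has_approximate_unit A -> left_units E -> right_units E ->
  is_tensor_action gamma mu -> fmod_hom U Us -> in_C E.
Proof.
move=> hA hL hR ht hU; split.
- by split=> //; exact: au_quadratik.
- exact: cofull_left_units.
- exact: cofull_right_units.
- exact: Kalg_au.
- by exists n, gamma, mu; split=> //; exists U, Us; exact: hom_extension.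
Qed.

Lemma inC_of_frame (A : galg R G) (E : fmod A) :
  has_approximate_unit A -> left_units E -> frame E -> in_C E.
Proof.
move=> hA hL F; have [Us hU] := frame_hom F hA.
exact: (inC_of_hom hA hL (frame_right_units F) (target_tensor A (frep F)) hU).
Qed.

Section FromC.
Variables (A : galg R G) (E : fmod A).
Hypothesis hE : in_C E.

(** By cofullness an element is a finite sum of values of rank one operators, and
    a common left unit for these operators in [K(E)] fixes it. *)
Lemma inC_left_units : left_units E.
Proof.
have [_ cE _ [_ hK] _] := hE => x.
have [l [y [/choice [xi /choice [eta /choice [phi h]]] ->]]] := cE x.
pose T j : Kalg E := mk_compact (fin_sums1 (ex_intro _ (xi j) (ex_intro _ (phi j)
  (conj (h j).1 (erefl (rank_one (xi j) (phi j))))))).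
have [k kP] := au_seq hK [seq T j | j <- enum 'I_l].
exists (cop k); first exact: copP.
rewrite (lin_sum _ _ _ (compact_lin (copP k))); apply: eq_bigr => j _.
have [kT _] : k ** T j = T j /\ T j ** k = T j by apply: kP; rewrite map_f // mem_enum.
by rewrite (h j).2; exact: (congr1 (fun S : Kalg E => cop S (eta j)) kT).
Qed.

Lemma inC_right_units : right_units E.
Proof.
have [_ _ cT [_ hK] _] := hE => phi hphi.
have [l [psi [/choice [phi' /choice [tau /choice [xi h]]] ->]]] := cT phi hphi.
have ht j : Theta (tau j) by case: (h j).
pose T j : Kalg E := mk_compact (fin_sums1 (ex_intro _ (xi j) (ex_intro _ (tau j)
  (conj (ht j) (erefl (rank_one (xi j) (tau j))))))).
have [k kP] := au_seq hK [seq T j | j <- enum 'I_l].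
exists (cop k); first exact: copP.
apply/funext => x; rewrite /= !fct_sumE; apply: eq_bigr => j _.
have [_ Tk] : k ** T j = T j /\ T j ** k = T j by apply: kP; rewrite map_f // mem_enum.
have [hp _ ->] := h j; rewrite -!(Theta_ract hp).
by congr (phi' j); exact: (congr1 (fun S : Kalg E => cop S x) Tk).
Qed.

(** Over the zero algebra the given action on [C^n] need not have finite rows, but
    the module is zero as well and embeds in the plain module without coordinates. *)
Lemma zero_frame : (forall a : A, a = 0) -> frame E.
Proof.
move=> A0; have E0 (x : E) : x = 0.
  have [k /compact_opsP [l [y [phi [_ ek]]]] kx] := inC_left_units x.
  by rewrite -kx ek big1 // => j _; rewrite (A0 (phi j x)) (lin0 ((ract_bilin E).2 _)).
have P0 (p q : A ^^ void) : p = q by apply: fs_ext => -[].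
have T0 (phi : E -> A) : Theta phi.
  by rewrite (_ : phi = fun=> 0); [exact: Theta0|apply/funext => x; exact: A0].
apply: (@Frame _ _ A E (rep_triv R G void) (fun=> 0) (fun _ _ => True)) => //.
- by move=> c x y; rewrite scaler0 addr0.
- by move=> phi _; exists 0.
- by move=> phi p _ x; rewrite (A0 (phi x)); exact: A0.
- move=> phi p _; exists 0%N, (fun=> 0), (fun=> phi), (fun=> 0).
  by split=> //; exact: P0.
Qed.

Section Nonzero.
Variables (n : choiceType) (gamma : plain_action A n) (mu : G -> C^o ^^ n -> C^o ^^ n).
Hypothesis hmu : is_tensor_action gamma mu.
Hypothesis hA : has_approximate_unit A.

(** The functional space is invariant, so moving by [g] the functional that takes
    the multiple by [e] of coordinate [i] yields again a finitely supported
    family [z]; on [a (x) delta_j] it reads off the matrix entry times [a]. *)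
Lemma row_finite (a : A) : a != 0 -> forall g i, exists z : C^o ^^ n,
  forall j, z j = mu g^-1%g (dlt j) i.
Proof.
move=> a0 g i; have [e [ea _ _ _]] := au2 hA a a.
have [|z hz] := @pa_Theta _ _ _ _ gamma g (pow_fun (ptens (aact g^-1%g e) (dlt i))).
  by eexists.
have zE j : z j ** a = (mu g^-1%g (dlt j) i : C) *: a.
  have <- : pow_fun z (ptens a (dlt j)) = z j ** a by exact: (dot_delta (amul_bilin A)).
  have <- := congr1 (fun f : A ^^ n -> A => f (ptens a (dlt j))) hz.
  rewrite -(pow_tensE a) hmu.2 pow_tensE.
  have -> : pow_fun (ptens (aact g^-1%g e) (dlt i))
      (ptens (aact g^-1%g a) (mu g^-1%g (dlt j))) =
      aact g^-1%g e ** ((mu g^-1%g (dlt j) i : C) *: aact g^-1%g a).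
    exact: (dot_deltal (amul_bilin A)).
  rewrite (linZ ((amul_bilin A).2 _)) -aactM (linZ (@aact_lin _ _ A g)) aactVK.
  by rewrite ea.
have fin : finite_set [set j | mu g^-1%g (dlt j) i != 0].
  apply: sub_finite_set (fs_fin z) => j /=; apply: contraNN => /eqP zj.
  have := zE j; rewrite zj (lin0 ((amul_bilin A).1 _)) => /esym/eqP.
  by rewrite scaler_eq0 (negbTE a0) orbF.
by exists (@FsFam C n (fun=> C^o) _ fin).
Qed.

Variable a : A.
Hypothesis a0 : a != 0.

Lemma contragredient : exists nu : G -> C^o ^^ n -> C^o ^^ n,
  (forall g, linear (nu g)) /\ forall g v w, scal (nu g v) (mu g w) = scal v w.
Proof.
have /choice [z /= hz] : forall gi : G * n, exists z : C^o ^^ n,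
  forall j, z j = mu gi.1^-1%g (dlt j) gi.2.
  by move=> [g i]; exact: row_finite a0 g i.
have [[mulin mu1 muM] _] := hmu.
pose nu g : C^o ^^ n -> C^o ^^ n := free_ext (fun i => z (g, i)).
have nulin g : linear (nu g) by exact: free_ext_linear.
have [s1 s2] := @scal_bilin R n.
exists nu; split=> // g v w.
rewrite -[w in RHS]mu1 -(mulVg g) muM; move: (mu g w) => {}w.
move: v; apply: delta_ext => [||i]; [exact: comp_lin (s1 _) (nulin g)|exact: s1|].
move: w; apply: delta_ext => [||j]; [exact: s2|exact: comp_lin (s2 _) (mulin _)|].
by rewrite /nu free_extE scal_delta scal_deltal hz.
Qed.

(** The relation is the graph of the given map of functional spaces; it is single
    valued in the family because [A] has an approximate unit. *)
Lemma hom_frame (U : E -> plain_mod gamma) Us : fmod_hom U Us -> inhabited (frame E).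
Proof.
move=> hU; have [[UD Ur Ua] UT [TD TM Ta] UE] := hU.
have [nu [nulin nuscal]] := contragredient.
have [[mulin mu1 muM] _] := hmu.
pose r : grep R G := GRep mulin nulin mu1 muM nuscal.
have actE g y : gamma g y = tact (r := r) g y.
  move: y; apply: ptens_ext => [||x i]; [exact: pa_lin|exact: (tact_lin (r := r))|].
  have la : linear (@aact _ _ A g) by exact: aact_lin.
  by rewrite /tact tm_delta // -pow_tensE hmu.2 pow_tensE.
have hL := inC_left_units; have hR := inC_right_units.
have Ulin : linear (U : E -> A ^^ n).
  have MA (x : E) : fin_sums [set y | exists (z : E) a, y = z |* a] x.
    have [k /compact_opsP [l [y [phi [_ ek]]]] kx] := hL x.
    exists l, (fun j => y j |* phi j x); split=> [j|]; first by do 2 eexists.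
    by rewrite -[LHS]kx ek.
  have lid : linear (id : A -> A) by [].
  exact: (@Defs.additive_semilinear _ _ A A E (pow_rmod A n) id U MA lid UD Ur).
pose cov phi p := Theta phi /\ Us phi = pow_fun p.
have covt phi : Theta phi -> exists p, Us phi = pow_fun p by move=> /UT [p ->]; exists p.
have covZ c phi : Theta phi -> Theta (fun x => c *: phi x) /\
    Us (fun x => c *: phi x) = (fun y => c *: Us phi y).
  move=> hphi; have [l [x [psi [hpsi e]]]] := right_units_sum hR hphi.
  have eE (T : Type) (f : 'I_l -> T -> A) y : c *: (\sum_(j < l) phi (x j) ** f j y) =
      \sum_(j < l) (c *: phi (x j)) ** f j y.
    by rewrite scaler_sumr; apply: eq_bigr => j _; rewrite (linZ ((amul_bilin A).1 _)).
  have e' : (fun x => c *: phi x) = (fun y => \sum_(j < l) (c *: phi (x j)) ** psi j y).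
    by apply/funext => y; rewrite -(eE _ psi); congr (_ *: _); exact: (congr1 (fun f => f y) e).
  split.
    rewrite e'; elim: (index_enum _) => [|j s IH].
      by under eq_fun do rewrite big_nil; exact: Theta0.
    by under eq_fun do rewrite big_cons; apply: ThetaD => //; exact: Theta_mul.
  rewrite e' (hom_sum hU) //; apply/funext => y.
  rewrite -(eE _ (fun j => Us (psi j))); congr (_ *: _).
  have := congr1 (fun f => f y) (hom_sum hU (fun j => phi (x j)) hpsi).
  by rewrite -e.
split; apply: (@Frame _ _ A E r U cov) => //.
- by move=> g x; rewrite Ua; exact: actE.
- by move=> phi p [].
- by move=> phi hphi; have [p hp] := covt phi hphi; exists p.
- split; first exact: Theta0.
  by rewrite (hom0 hU); apply/funext => y; exact/esym/(lin0 (dot_linl (amul_bilin A) y)).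
- move=> c phi p psi q [hp ep] [hq eq]; have [hc ec] := covZ c _ hp.
  split; first exact: ThetaD.
  rewrite TD // ec ep eq; apply/funext => y.
  by rewrite [RHS](dot_linl (amul_bilin A) y).
- move=> b phi p [hp ep]; split; first exact: Theta_mul.
  by rewrite TM // ep; apply/funext => y; rewrite pow_fun_lact.
- move=> g phi p [hp ep]; split; first exact: Theta_act.
  rewrite Ta // ep; apply/funext => y.
  have -> : aact g (pow_fun p (gamma g^-1%g y)) =
      pow_fun (tdual (r := r) g p) (tact (r := r) g (gamma g^-1%g y)).
    exact/esym/(@pow_fun_dual _ _ A r).
  by rewrite -actE -pa_act_mul mulgV pa_act1.
- by move=> phi p [hp ep] x; rewrite -ep UE.
- move=> phi p [hp ep]; have [l [x [psi [hpsi e]]]] := right_units_sum hR hp.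
  have /choice [q hq] : forall j, exists q, Us (psi j) = pow_fun q by move=> j; exact: covt.
  exists l, x, psi, q; split=> //; apply: (pow_fun_inj hA).
  rewrite -ep {1}e (hom_sum hU) //; apply/funext => y.
  rewrite [RHS](lin_sum _ _ _ (dot_linl (amul_bilin A) y)); apply: eq_bigr => j _.
  by rewrite hq; exact/esym/pow_fun_lact.
Qed.

End Nonzero.

Lemma inC_frame : inhabited (frame E).
Proof.
have [[_ hA] _ _ _ [n [gamma [mu [hmu [U [Us [hU _ _]]]]]]]] := hE.
have [A0|/existsNP [a /eqP a0]] := pselect (forall a : A, a = 0).
  by split; exact: zero_frame.
exact: (hom_frame hmu hA a0 hU).
Qed.

End FromC.
End ClassC.

(** * Plain modules *)

Section Plain.
Variables (R : realType) (G : groupType).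
Local Notation C := (R[i]).
Local Notation "X ^^ n" := (fspow n X) (at level 30).
Local Notation dlt := (@delta C _).

Section PushModule.
Variables (A : galg R G) (m m' : choiceType) (f : m -> m').
Lemma push_ract (z : A ^^ m) a :
  push f (pow_ract z a) = pow_ract (push f z) a.
Proof.
have pl := @push_linear R _ _ f A.
move: z; apply: ptens_ext => [||x i].
- exact: comp_lin pl ((pow_ract_bilin A m).1 a).
- exact: comp_lin ((pow_ract_bilin A m').1 a) pl.
by rewrite pow_ract_ptens !push_delta pow_ract_ptens.
Qed.

Lemma push_lact (z : A ^^ m) a : push f (pow_lact a z) = pow_lact a (push f z).
Proof.
have pl := @push_linear R _ _ f A.
move: z; apply: ptens_ext => [||x i].
- exact: comp_lin pl ((@pow_lact_bilin _ _ A m).2 a).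
- exact: comp_lin ((@pow_lact_bilin _ _ A m').2 a) pl.
by rewrite pow_lact_ptens !push_delta pow_lact_ptens.
Qed.
End PushModule.

Section Units.
Variables (A : galg R G) (n : choiceType) (gamma : plain_action A n).
Hypothesis hA : has_approximate_unit A.

Let cut (e : A) (s : seq n) (z : plain_mod gamma) : plain_mod gamma :=
  \sum_(i <- s) ((ptens e (dlt i) : plain_mod gamma) |* pow_fun (ptens e (dlt i)) z).

Let cut_compact e s : compact_ops (cut e s).
Proof. by apply: compact_ops_big => i; exists (ptens e (dlt i)). Qed.

Let cutE e s z : cut e s z = \sum_(i <- s) ptens (e ** (e ** z i)) (dlt i).
Proof.
apply: eq_bigr => i _; rewrite [LHS]pow_ract_ptens; congr (ptens (_ ** _) _).
exact: (dot_deltal (amul_bilin A)).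
Qed.

Lemma plain_left_units : left_units (plain_mod gamma).
Proof.
move=> y; pose s : seq n := fset_set [set i | y i != 0].
have [e eP] := au_seq hA [seq y i | i <- s].
exists (cut e s); first exact: cut_compact.
rewrite cutE [RHS]ptens_sum; apply: eq_big_seq => i si.
by have [ey _] := eP (y i) (map_f _ si); rewrite !ey.
Qed.

Lemma plain_right_units : right_units (plain_mod gamma).
Proof.
move=> _ [p ->]; pose s : seq n := fset_set [set i | p i != 0].
have [e eP] := au_seq hA [seq p i | i <- s].
exists (cut e s); first exact: cut_compact.
apply/funext => y; rewrite /= cutE.
rewrite [LHS](lin_sum _ _ _ (dot_linr (amul_bilin A) p)).
rewrite {2}(ptens_sum p) [RHS](lin_sum _ _ _ (dot_linl (amul_bilin A) y)); apply: eq_big_seq => i si.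
have [_ pe] := eP (p i) (map_f _ si).
by rewrite dot_delta ?dot_deltal ?amulA ?pe //; exact: amul_bilin.
Qed.

Lemma plain_inC mu : is_tensor_action gamma mu -> in_C (plain_mod gamma).
Proof.
move=> hmu; apply: (inC_of_hom (U := id) (Us := id) hA _ _ hmu) => //.
- exact: plain_left_units.
- exact: plain_right_units.
Qed.
End Units.

Section FiniteGroup.
Hypothesis finG : finite_set [set: G].
Variables (A : galg R G) (n : choiceType) (gamma : plain_action A n).
Hypothesis hA : has_approximate_unit A.

Let D : seq G := fset_set [set: G].
Let inD g : g \in D. Proof. by rewrite in_fset_set // inE. Qed.
Let N : C := (size D)%:R.
Let N0 : N != 0.
Proof.
rewrite Num.Theory.pnatr_eq0; apply/eqP => /size0nil e.
by have := inD 1%g; rewrite e.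
Qed.

Lemma sum_translate (V : zmodType) (f : G -> V) g :
  \sum_(h <- D) f (g * h)%g = \sum_(h <- D) f h.
Proof.
rewrite -(big_map (fun h => (g * h)%g) xpredT f); apply: perm_big.
apply: uniq_perm; rewrite ?fset_uniq //.
  by rewrite map_inj_uniq ?fset_uniq //; exact: mulgI.
move=> h; rewrite inD; apply/mapP; exists (g^-1 * h)%g => //.
by rewrite mulVKg.
Qed.

Let r0 := rep_triv R G n.
Let r := rep_prod r0 (rep_reg R G).
Local Notation b g := (@tact _ _ A r0 g).

Let at_ (h : G) (i : n) : n * G := (i, h).
Let at_inj h : injective (at_ h). Proof. by move=> i j []. Qed.
Local Notation slot h := (push (at_ h)).

(** [A^(n*G)] is the direct sum of copies of [A^n] indexed by [G]; [slot h] is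
    the inclusion of the copy at [h], and the tensor action of the regular
    representation permutes the copies while acting by [alpha] on coefficients. *)
Lemma slotE h (z : A ^^ n) i k : slot h z (i, k) = if k == h then z i else 0.
Proof.
elim/ptens_ind: z => [|x j z IH]; first by rewrite (lin0 (@push_linear _ _ _ _ A)); case: eqP.
rewrite (linD (@push_linear _ _ _ _ A)) fsDE IH fsDE push_delta !ptens_deltaE.
by rewrite xpair_eqE; case: (k == h); rewrite ?andbT ?andbF ?addr0.
Qed.

Lemma slot_act g h z : tact (r := r) g (slot h z) = slot (g * h)%g (b g z).
Proof.
have pl k := @push_linear R _ _ (at_ k) A.
have la : linear (@aact _ _ A g) by exact: aact_lin.
move: z; apply: ptens_ext => [||x i].
- exact: comp_lin (@tact_lin _ _ A r g) (pl h).
- exact: comp_lin (pl _) (@tact_lin _ _ A r0 g).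
rewrite push_delta /tact !tm_delta // push_delta; congr ptens.
by rewrite [LHS]tmap2_delta /= /translate pushv_delta vbox_delta.
Qed.

(** The coefficientwise action [b] and the given action [gamma] differ; in the copy
    at [h] they are compared by [b_h gamma_(h^-1)], and translation of [h] turns
    [gamma] into [b] together with the regular representation. *)
Let U (y : plain_mod gamma) : A ^^ (n * G)%type :=
  \sum_(h <- D) slot h (b h (gamma h^-1%g y)).

(** Each of the [N] copies can recover [phi]; only their average is equivariant,
    and this is where the finiteness of [G] enters. *)
Let cov (phi : plain_mod gamma -> A) (q : A ^^ (n * G)%type) := Theta phi /\
  forall h z, pow_fun q (slot h z) = N^-1 *: phi (gamma h (b h^-1%g z)).

Let bK h z : b h (b h^-1%g z) = z.
Proof. by rewrite -tactM mulgV tact1. Qed.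

Let cov_total phi : Theta phi -> exists q, cov phi q.
Proof.
move=> hphi.
have /choice [q hq] : forall h, exists q, forall z,
    phi (gamma h (b h^-1%g z)) = pow_fun q z.
  move=> h; have [p hp] := pa_Theta gamma h^-1%g hphi.
  exists (tdual (r := r0) h p) => z; rewrite -[z in RHS](bK h) pow_fun_dual.
  have <- := congr1 (fun f : A ^^ n -> A => f (b h^-1%g z)) hp.
  by rewrite /= invgK -aact_mul mulgV aact1.
exists (\sum_(h <- D) slot h (N^-1 *: q h)); split=> // h z.
rewrite [LHS](dot_pushr (@at_inj h) (amul_bilin A)) hq.
rewrite (_ : pull _ _ = N^-1 *: q h).
  exact: (linZ (dot_linl (amul_bilin A) z)).
apply: fs_ext => i; rewrite pullE fs_sum.
under eq_bigr do rewrite slotE.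
rewrite (bigD1_seq h) ?fset_uniq //= eqxx big1 ?addr0 // => k /negbTE kh.
by rewrite eq_sym kh.
Qed.

Let cov_uniq phi q q' : cov phi q -> cov phi q' -> q = q'.
Proof.
move=> [_ hq] [_ hq']; apply: fs_ext => -[i h].
have [e [_ qe _ qe']] := au2 hA (q (i, h)) (q' (i, h)).
have : pow_fun q (slot h (ptens e (dlt i))) = pow_fun q' (slot h (ptens e (dlt i))).
  by rewrite hq hq'.
by rewrite push_delta -[LHS]/(dot _ _ _) -[RHS]/(dot _ _ _) !(dot_delta (amul_bilin A)) qe qe'.
Qed.

Lemma finite_group_frame : frame (plain_mod gamma).
Proof.
have pl k := @push_linear R _ _ (at_ k) A.
have dl := dot_linl (amul_bilin A).
have cov0 : cov (fun=> 0) 0.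
  split; first exact: pow_Theta0.
  by move=> h z; rewrite scaler0; exact: (lin0 (dl _ _)).
have covL c phi p psi q : cov phi p -> cov psi q ->
    cov (fun x => c *: phi x + psi x) (c *: p + q).
  move=> [[p' ep] hp] [[q' eq] hq]; split.
    exists (c *: p' + q'); apply/funext => x; rewrite ep eq.
    by rewrite [RHS](dl _ x).
  move=> h z.
  have -> : pow_fun (c *: p + q) (slot h z) =
      c *: pow_fun p (slot h z) + pow_fun q (slot h z) by exact: dl.
  by rewrite hp hq scalerDr !scalerA [c * _]mulrC.
have cov_mul a phi p : cov phi p -> cov (fun x => a ** phi x) (pow_lact a p).
  move=> [h1 h2]; split; first exact: Theta_mul.
  by move=> h z; rewrite pow_fun_lact h2 (linZ ((amul_bilin A).2 _)).
apply: (@Frame _ _ A (plain_mod gamma) r U cov) => //.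
- move=> c x y; rewrite /U scaler_sumr -big_split; apply: eq_bigr => h _.
  by rewrite (pa_lin gamma) (tact_lin (r := r0)) pl.
- move=> x a; rewrite /U.
  rewrite [RHS](lin_sum _ _ _ ((pow_ract_bilin A _).1 a)); apply: eq_bigr => h _.
  by rewrite [gamma _ _]pa_ract (tact_ract (r := r0)) aactVK push_ract.
- move=> g x; rewrite /U -[LHS](sum_translate _ g).
  rewrite (lin_sum _ _ _ (@tact_lin _ _ A r g)); apply: eq_bigr => h _.
  rewrite slot_act -(tactM (r := r0)) -pa_act_mul invgM -mulgA mulVg mulg1.
  by [].
- by move=> phi p [].
- move=> g phi p [h1 h2]; split; first exact: Theta_act.
  move=> h z; have -> : slot h z = tact (r := r) g (slot (g^-1 * h)%g (b g^-1%g z)).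
    by rewrite slot_act bK mulVKg.
  rewrite [LHS](@pow_fun_dual _ _ A r) h2 (linZ (@aact_lin _ _ A g)); congr (_ *: aact g (phi _)).
  by rewrite [RHS]/= -pa_act_mul -(tactM (r := r0)) invgM invgK -mulgA mulgV mulg1.
- move=> phi p [[p' ep] h2] x; rewrite /U.
  rewrite [LHS](lin_sum _ _ _ (dot_linr (amul_bilin A) p)) (eq_bigr (fun=> N^-1 *: phi x)) => [|h _].
    rewrite big_const_seq count_predT iter_addr_0 -scaler_nat scalerA mulfV ?scale1r //.
  rewrite [LHS]h2 -(tactM (r := r0)) mulVg tact1 -pa_act_mul mulgV.
  by rewrite pa_act1.
- move=> phi p hp.
  have [l [x [psi [hpsi e]]]] := right_units_sum (plain_right_units (gamma := gamma) hA) hp.1.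
  have /choice [q hq] : forall j, exists q, cov (psi j) q by move=> j; exact: cov_total.
  exists l, x, psi, q; split=> //; apply: cov_uniq hp _; rewrite {1}e.
  elim: (index_enum _) => [|j s IH].
    by rewrite big_nil; under eq_fun do rewrite big_nil.
  rewrite big_cons; under eq_fun do rewrite big_cons.
  have := covL 1 _ _ _ _ (cov_mul (phi (x j)) _ _ (hq j)) IH.
  by rewrite scale1r; under eq_fun do rewrite scale1r.
Qed.
End FiniteGroup.
End Plain.

(** * Direct sums *)

Section DirectSums.
Variables (R : realType) (G : groupType).
Local Notation C := (R[i]).
Local Notation "X ^^ n" := (fspow n X) (at level 30).
Local Notation dlt := (@delta C _).

Section SumFamilies.
Variables (I : choiceType) (r : I -> grep R G).
Local Notation inj i := (push (@sidx R G I r i)).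
Local Notation comp i := (pull (@sidx_inj R G I r i)).
Variable X : lmodType C.
Implicit Types p q : X ^^ (sum_idx r).

Lemma comp_ext p q : (forall i, comp i p = comp i q) -> p = q.
Proof.
move=> h; apply: fs_ext => -[i l].
by have := congr1 (fun z : X ^^ _ => z l) (h i).
Qed.

Lemma comp_inj i (z : X ^^ (rdim (r i))) : comp i (inj i z) = z.
Proof. exact: pushK. Qed.

Lemma comp_inj0 i j (z : X ^^ (rdim (r i))) : i != j -> comp j (inj i z) = 0.
Proof.
move=> ij; elim/ptens_ind: z => [|x k z IH].
  by rewrite (lin0 (@push_linear _ _ _ _ X)) (lin0 (pull_linear _ (X := X))).
rewrite (linD (@push_linear _ _ _ _ X)) (linD (pull_linear _ (X := X))) IH addr0 push_delta.
apply: fs_ext => l; rewrite pullE ptens_deltaE -tag_eqE /tag_eq /=.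
by rewrite eq_sym (negbTE ij).
Qed.

Lemma sum_inj (s : seq I) (z : forall i, X ^^ (rdim (r i))) : uniq s ->
  (forall i, i \notin s -> z i = 0) ->
  forall i, comp i (\sum_(j <- s) inj j (z j)) = z i.
Proof.
move=> us zs i; rewrite (lin_sum _ _ _ (pull_linear _ (X := X))).
have [si|si] := boolP (i \in s).
  rewrite (bigD1_seq i) //= comp_inj big1 ?addr0 // => j ji.
  exact: comp_inj0.
rewrite zs // big1_seq // => j /andP[_ sj]; apply: comp_inj0.
by apply: contraNneq si => <-.
Qed.

Lemma sum_comp q (s : seq I) : uniq s -> (forall i, i \notin s -> comp i q = 0) ->
  q = \sum_(i <- s) inj i (comp i q).
Proof. by move=> us qs; apply: comp_ext => i; rewrite sum_inj. Qed.

End SumFamilies.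

Section SumActions.
Variables (A : galg R G) (I : choiceType) (r : I -> grep R G).
Local Notation inj i := (push (@sidx R G I r i)).
Local Notation comp i := (pull (@sidx_inj R G I r i)).
Local Notation rs := (rep_sum r).

Lemma comp_tact g i (q : A ^^ (rdim rs)) :
  comp i (tact (r := rs) g q) = tact (r := r i) g (comp i q).
Proof.
have la : linear (@aact _ _ A g) by exact: aact_lin.
have pl j := @push_linear R _ _ (@sidx R G I r j) A.
move: q; apply: ptens_ext => [||x [j l]].
- exact: comp_lin (pull_linear _ (X := A)) (@tact_lin _ _ A rs g).
- exact: comp_lin (@tact_lin _ _ A (r i) g) (pull_linear _ (X := A)).
rewrite -(push_delta (@sidx R G I r j)).
have -> : tact (r := rs) g (inj j (ptens x (dlt l))) = inj j (tact (r := r j) g (ptens x (dlt l))).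
  rewrite push_delta /tact !tm_delta // /push tmE //; last exact: pushv_linear.
  by congr ptens; rewrite -sum_muE pushv_delta.
have [<-|ji] := eqVneq j i; first by rewrite !comp_inj.
by rewrite !comp_inj0 // (lin0 (@tact_lin _ _ A (r i) g)).
Qed.

Lemma comp_tdual g i (q : A ^^ (rdim rs)) :
  comp i (tdual (r := rs) g q) = tdual (r := r i) g (comp i q).
Proof.
have la : linear (@aact _ _ A g) by exact: aact_lin.
have pl j := @push_linear R _ _ (@sidx R G I r j) A.
move: q; apply: ptens_ext => [||x [j l]].
- exact: comp_lin (pull_linear _ (X := A)) (@tdual_lin _ _ A rs g).
- exact: comp_lin (@tdual_lin _ _ A (r i) g) (pull_linear _ (X := A)).
rewrite -(push_delta (@sidx R G I r j)).
have -> : tdual (r := rs) g (inj j (ptens x (dlt l))) = inj j (tdual (r := r j) g (ptens x (dlt l))).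
  rewrite push_delta /tdual !tm_delta // /push tmE //; last exact: pushv_linear.
  by congr ptens; rewrite -sum_nuE pushv_delta.
have [<-|ji] := eqVneq j i; first by rewrite !comp_inj.
by rewrite !comp_inj0 // (lin0 (@tdual_lin _ _ A (r i) g)).
Qed.
End SumActions.

(** Characterisation of a direct sum by its inclusions and projections.  It covers
    at once the finitely supported families and the binary sum with [A], which is
    needed for corner modules. *)
Record sum_of (A : galg R G) (I : choiceType) (E : I -> fmod A) (F : fmod A) := SumOf {
  inc : forall i, E i -> F;
  prj : forall i, F -> E i;
  inc_lin : forall i, linear (@inc i);
  prj_lin : forall i, linear (@prj i);
  inc_ract : forall i x a, inc (x |* a) = @inc i x |* a;
  prj_ract : forall i x a, prj i (x |* a) = prj i x |* a;
  inc_act : forall i g x, inc (mact g x) = mact g (@inc i x);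
  prj_act : forall i g x, prj i (mact g x) = mact g (prj i x);
  prjK : forall i x, prj i (@inc i x) = x;
  prj_inc0 : forall i j x, i != j -> prj j (@inc i x) = 0;
  sum_supp : forall x, exists2 s : seq I, uniq s &
    (forall i, i \notin s -> prj i x = 0) /\ x = \sum_(i <- s) inc (prj i x);
  Theta_prj : forall i phi, @Theta _ _ A (E i) phi -> @Theta _ _ A F (fun x => phi (prj i x));
  Theta_inc : forall i phi, Theta phi -> Theta (fun x => phi (@inc i x));
  Theta_supp : forall phi, @Theta _ _ A F phi -> exists2 s : seq I, uniq s &
    forall i, i \notin s -> forall x, phi (@inc i x) = 0 }.

Section SumOf.
Variables (A : galg R G) (I : choiceType) (E : I -> fmod A) (F : fmod A).
Variable S : sum_of E F.
Local Notation inc i := (@inc _ _ _ _ S i).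
Local Notation prj i := (@prj _ _ _ _ S i).

(** Finitely many coordinates of a point are nonzero; sum local units of these. *)
Lemma sum_left_units : (forall i, left_units (E i)) -> left_units F.
Proof.
move=> hE x; have [s us [_ xs]] := sum_supp S x.
have ex i : exists k, compact_ops k /\ k (prj i x) = prj i x.
  by have [k hk kx] := hE i (prj i x); exists k.
pose k i := sval (cid (ex i)).
have kP i : compact_ops (k i) /\ k i (prj i x) = prj i x by exact: svalP (cid (ex i)).
exists (fun y => \sum_(i <- s) inc i (k i (prj i y))).
  elim: s {us xs} => [|i s IH].
    by under eq_fun do rewrite big_nil; exact: fin_sums0.
  under eq_fun do rewrite big_cons.
  apply: fin_sumsD IH; have /compact_opsP [l [z [phi [hphi ->]]]] := (kP i).1.
  rewrite (_ : (fun=> _) = fun y => \sum_(j < l) inc i (z j) |* phi j (prj i y)).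
    by apply: compact_ops_sum => j; exact: Theta_prj.
  apply/funext => y; rewrite (lin_sum _ _ _ (@inc_lin _ _ _ _ S i)); apply: eq_bigr => j _.
  exact: inc_ract.
by rewrite [RHS]xs; apply: eq_bigr => i _; rewrite (kP i).2.
Qed.

Variable Fr : forall i, frame (E i).
Let r i := frep (Fr i).
Let rs := rep_sum r.
Local Notation inj i := (push (@sidx R G I r i)).
Local Notation comp i := (pull (@sidx_inj R G I r i)).

(** Coordinatewise: the frame maps and the relations of the summands are combined
    over the disjoint union of the index sets.  Since only finitely many
    coordinates matter for a point or a functional, all sums are finite. *)
Lemma sum_frame : inhabited (frame F).
Proof.
have /choice [U hU] : forall x : F, exists q : A ^^ (rdim rs),
    forall i, comp i q = fmap (Fr i) (prj i x).
  move=> x; have [s us [sx _]] := sum_supp S x.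
  exists (\sum_(i <- s) inj i (fmap (Fr i) (prj i x))) => i.
  apply: (sum_inj (z := fun i => fmap (Fr i) (prj i x))) => // j /sx ->.
  exact: (lin0 (@fmap_lin _ _ _ _ (Fr j))).
pose cov (phi : F -> A) (q : A ^^ (rdim rs)) := Theta phi /\
  forall i, @fcov _ _ _ _ (Fr i) (fun x => phi (inc i x)) (comp i q).
have pl i := @pull_linear R _ _ _ (@sidx_inj R G I r i) A.
have il i := @push_linear R _ _ (@sidx R G I r i) A.
have covt phi : Theta phi -> exists q, cov phi q.
  move=> hphi; pose v i := sval (cid (frame_fun (Fr i))).
  have hv i := svalP (cid (frame_fun (Fr i))).
  have [s us sphi] := Theta_supp S hphi.
  pose z i := v i (fun x => phi (inc i x)).
  have hz i : @fcov _ _ _ _ (Fr i) (fun x => phi (inc i x)) (z i).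
    by apply: hv; exact: Theta_inc.
  exists (\sum_(i <- s) inj i (z i)); split=> // i; rewrite sum_inj // => j /sphi e.
  by apply: (fcov_eq0 (F := Fr j)); have := hz j; under eq_fun do rewrite e.
have cov_supp phi p : cov phi p -> exists2 s : seq I, uniq s &
    p = \sum_(i <- s) inj i (comp i p).
  move=> [hphi h]; have [s us sphi] := Theta_supp S hphi.
  exists s => //; apply: sum_comp => // i /sphi e.
  by apply: (fcov_eq0 (F := Fr i)); have := h i; under eq_fun do rewrite e.
have covE phi p : cov phi p -> forall x, pow_fun p (U x) = phi x.
  move=> [hphi h] x; have [s us [sx xE]] := sum_supp S x.
  have -> : U x = \sum_(i <- s) inj i (comp i (U x)).
    apply: sum_comp => // i /sx e.
    by rewrite hU e; exact: (lin0 (@fmap_lin _ _ _ _ (Fr i))).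
  rewrite [LHS](lin_sum _ _ _ (dot_linr (amul_bilin A) p)).
  rewrite [in RHS]xE (lin_sum _ _ _ (Theta_lin hphi)); apply: eq_bigr => i _.
  rewrite (dot_pushr (@sidx_inj R G I r i) (amul_bilin A)) hU.
  exact: (fcovE (h i)).
have ThetaZ c phi : Theta phi -> Theta (fun x : F => c *: phi x).
  move=> hphi; have [p hp] := covt phi hphi; have [s us sphi] := Theta_supp S hphi.
  have ThZ i : Theta (fun x : E i => c *: phi (inc i x)).
    have := fcov_Theta (fcovL c (hp.2 i) (fcov0 (Fr i))).
    by under eq_fun do rewrite addr0.
  have -> : (fun x => c *: phi x) = fun x => \sum_(i <- s) c *: phi (inc i (prj i x)).
    apply/funext => x; have [s' us' [sx' xE]] := sum_supp S x.
    rewrite {1}xE (lin_sum _ _ _ (Theta_lin hphi)) scaler_sumr.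
    have e0 i : (i \notin s) || (i \notin s') -> c *: phi (inc i (prj i x)) = 0.
      move=> /orP[/sphi ->|/sx' ->]; first exact: scaler0.
      by rewrite (lin0 (@inc_lin _ _ _ _ S i)) (lin0 (Theta_lin hphi)) scaler0.
    rewrite [LHS](bigID (mem s)) [RHS](bigID (mem s')) /=.
    rewrite [X in _ + X]big1 ?addr0 => [|i si]; last by rewrite e0 ?si.
    rewrite [X in _ = _ + X]big1 ?addr0 => [|i si]; last by rewrite e0 ?si ?orbT.
    rewrite -[LHS]big_filter -[RHS]big_filter; apply: perm_big.
    apply: uniq_perm; rewrite ?filter_uniq //.
    by move=> i; rewrite !mem_filter andbC.
  elim: s {us sphi} => [|i s IH].
    by under eq_fun do rewrite big_nil; exact: Theta0.
  under eq_fun do rewrite big_cons; apply: ThetaD => //.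
  exact: (Theta_prj S (ThZ i)).
split; apply: (@Frame _ _ A F rs U cov) => //.
- move=> c x y; apply: comp_ext => i; rewrite pl !hU prj_lin.
  exact: (@fmap_lin _ _ _ _ (Fr i)).
- move=> x a; apply: comp_ext => i; rewrite hU prj_ract fmap_ract -hU.
  exact: fs_ext.
- move=> g x; apply: comp_ext => i; rewrite (comp_tact (r := r)) !hU prj_act.
  exact: fmap_act.
- by move=> phi p [].
- by split=> [|i]; [exact: Theta0|rewrite (lin0 (pl i)); exact: fcov0].
- move=> c phi p psi q [hp h] [hq h'].
  split=> [|i]; first by apply: ThetaD => //; exact: ThetaZ.
  by rewrite pl; exact: fcovL.
- move=> a phi p [hp h]; split=> [|i]; first exact: Theta_mul.
  by have := fcov_mul a (h i); congr fcov; exact: fs_ext.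
- move=> g phi p [hp h]; split=> [|i]; first exact: Theta_act.
  rewrite (comp_tdual (r := r)).
  have := fcov_act g (h i); congr fcov; apply/funext => x.
  by rewrite inc_act.
- move=> phi p hp; have [s us ->] := cov_supp phi p hp.
  apply: expands_big => i; have [l [x [psi [q [h ->]]]]] := fcov_loc (hp.2 i).
  rewrite (lin_sum _ _ _ (il i)); apply: expands_big => j.
  have -> : inj i (pow_lact (phi (inc i (x j))) (q j)) =
      pow_lact (phi (inc i (x j))) (inj i (q j)).
    exact: push_lact.
  apply: (@expands1 _ _ _ _ _ cov phi _ (fun y => psi j (prj i y))); split.
    by apply: Theta_prj; exact: fcov_Theta (h j).
  move=> k; have [<-|ik] := eqVneq i k.
    by rewrite comp_inj; under eq_fun do rewrite prjK; exact: h.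
  have e x0 : prj i (inc k x0) = 0 by rewrite prj_inc0 // eq_sym.
  rewrite comp_inj0 //; under eq_fun do rewrite e.
  have -> : psi j 0 = 0 by exact: (lin0 (Theta_lin (fcov_Theta (h j)))).
  exact: fcov0.
Qed.
End SumOf.

Section Dsum.
Variables (A : galg R G) (I : choiceType) (E : I -> fmod A).

Fact single_fin i (x : E i) :
  finite_set [set j | dfwith (fun j => 0 : E j) x j != 0].
Proof.
apply: (sub_finite_set _ (finite_set1 i)) => j /=; apply: contraNP => /eqP ji.
by rewrite dfwith_out // eq_sym.
Qed.

Definition single i (x : E i) : dsum E :=
  @FsFam C I (fun i => E i : lmodType C) _ (single_fin x).

Lemma single_id i (x : E i) : single x i = x. Proof. exact: dfwith_in. Qed.
Lemma single_neq i j (x : E i) : i != j -> single x j = 0.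
Proof. exact: dfwith_out. Qed.

Definition dsum_prj i (x : dsum E) : E i := (x : fsfam _) i.

Let D (i : I) : lmodType C := (E i -> A).

Lemma dsum_sum : inhabited (sum_of E (dsum E)).
Proof.
have slin i : linear (@single i).
  move=> c x y; apply: fs_ext => j; rewrite fsLE.
  have [<-|ij] := eqVneq i j; first by rewrite !single_id.
  by rewrite !single_neq // scaler0 addr0.
have ext (x y : dsum E) : (forall i, dsum_prj i x = dsum_prj i y) -> x = y.
  exact: fs_ext.
have supp (x : dsum E) : exists2 s : seq I, uniq s &
    (forall i, i \notin s -> dsum_prj i x = 0) /\ x = \sum_(i <- s) single (dsum_prj i x).
  pose s : seq I := fset_set [set i | dsum_prj i x != 0].
  have sx i : i \notin s -> dsum_prj i x = 0.
    move=> si; apply/eqP; apply: contraNT si => xi.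
    by rewrite in_fset_set ?inE //; exact: (@fs_fin _ _ _ x).
  exists s; first exact: fset_uniq.
  split=> //; apply: fs_ext => j; rewrite fs_sum.
  have [sj|sj] := boolP (j \in s).
    rewrite (bigD1_seq j) ?fset_uniq // single_id big1 => [|i ij]; first exact/esym/addr0.
    exact: single_neq.
  rewrite [LHS]sx // big1_seq // => i /andP[_ si]; apply: single_neq.
  by apply: contraNneq sj => <-.
have Tsingle (phi : fsfam D) : (forall i, Theta (phi i : E i -> A)) ->
    forall i x, dsum_fun phi (single x) = (phi i : E i -> A) x.
  move=> hphi i x; rewrite /dsum_fun /fs_total (fsbigTE [fset i]%fset) => [|j].
    by rewrite big_seq_fset1 single_id.
  rewrite inE eq_sym => ij; rewrite single_neq //.
  exact: (lin0 (Theta_lin (hphi j))).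
split; apply: (@SumOf A I E (dsum E) single dsum_prj) => //.
- by move=> i c x y; exact: (fsLE c x y i).
- move=> i x a; apply: ext => j.
  rewrite -[RHS]/(single x j |* a) /dsum_prj.
  have [<-|ij] := eqVneq i j; first by rewrite !single_id.
  by rewrite !single_neq // (lin0 ((ract_bilin (E j)).1 a)).
- move=> i g x; apply: ext => j.
  rewrite -[RHS]/(mact g (single x j)) /dsum_prj.
  have [<-|ij] := eqVneq i j; first by rewrite !single_id.
  by rewrite !single_neq // (lin0 (@mact_lin _ _ A (E j) g)).
- by move=> i x; exact: single_id.
- by move=> i j x; exact: single_neq.
- move=> i phi hphi.
  have fin : finite_set [set j | dfwith (fun j => 0 : D j) (phi : D i) j != 0].
    apply: (sub_finite_set _ (finite_set1 i)) => j /=; apply: contraNP => /eqP ji.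
    by rewrite dfwith_out // eq_sym.
  pose Phi : fsfam D := FsFam fin.
  have hPhi j : Theta (Phi j : E j -> A).
    rewrite /=; have [<-|ij] := eqVneq i j; first by rewrite dfwith_in.
    by rewrite dfwith_out //; exact: Theta0.
  exists Phi; split=> //; apply/funext => x; have [s us [sx xE]] := supp x.
  rewrite xE (lin_sum _ _ _ (dsum_Theta_lin (ex_intro _ Phi (conj hPhi erefl)))).
  rewrite /dsum_prj fs_sum (lin_sum _ _ _ (Theta_lin hphi)); apply: eq_bigr => j _.
  rewrite Tsingle // -[Phi j]/(dfwith (fun j => 0 : D j) (phi : D i) j).
  have [<-|ij] := eqVneq i j.
    by rewrite dfwith_in single_id.
  by rewrite dfwith_out // single_neq 1?eq_sym // (lin0 (Theta_lin hphi)).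
- move=> i _ [phi [hphi ->]]; rewrite (_ : (fun=> _) = phi i) //.
  by apply/funext => x; exact: Tsingle.
- move=> _ [phi [hphi ->]].
  exists (fset_set [set i | phi i != 0]); first exact: fset_uniq.
  move=> i; rewrite in_fset_set; last exact: fs_fin.
  by rewrite notin_setE => /negP; rewrite negbK => /eqP e x; rewrite Tsingle // e.
Qed.
End Dsum.

Section Sum2.
Variables (A : galg R G) (E F : fmod A).
Let S (b : bool) : fmod A := if b then E else F.

Definition sum2_inc b : S b -> sum2 E F :=
  match b return S b -> sum2 E F with true => fun x => (x, 0) | false => fun x => (0, x) end.
Definition sum2_prj b : sum2 E F -> S b :=
  match b return sum2 E F -> S b with true => fst | false => snd end.

Lemma sum2_sum : sum_of S (sum2 E F).
Proof.
have [rE rF] := ((ract_bilin E).1, (ract_bilin F).1).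
have [mE mF] := (@mact_lin _ _ A E, @mact_lin _ _ A F).
apply: (@SumOf A bool S (sum2 E F) sum2_inc sum2_prj).
- by move=> [] c x y; congr pair; rewrite /= scaler0 addr0.
- by case.
- by move=> [] x a; congr pair; rewrite /= ?(lin0 (rE a)) ?(lin0 (rF a)).
- by case.
- by move=> [] g x; congr pair; rewrite /= ?(lin0 (mE g)) ?(lin0 (mF g)).
- by case.
- by case.
- by case; case.
- move=> [x y]; exists [:: true; false] => //; split; first by case.
  by rewrite !big_cons big_nil addr0; congr pair; rewrite /= ?addr0 ?add0r.
- move=> [] phi hphi.
    exists phi, (fun=> 0); split=> //; first exact: Theta0.
    by apply/funext => x; rewrite addr0.
  exists (fun=> 0), phi; split=> //; first exact: Theta0.
  by apply/funext => x; rewrite add0r.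
- move=> b _ [phi [psi [hphi hpsi ->]]]; case: b => /=.
    by under eq_fun do rewrite (lin0 (Theta_lin hpsi)) addr0.
  by under eq_fun do rewrite (lin0 (Theta_lin hphi)) add0r.
- by move=> phi _; exists [:: true; false] => //; case.
Qed.

Lemma sum2_left_units : left_units E -> left_units F -> left_units (sum2 E F).
Proof. by move=> hE hF; apply: (sum_left_units sum2_sum); case. Qed.

Lemma sum2_frame : frame E -> frame F -> inhabited (frame (sum2 E F)).
Proof. by move=> hE hF; apply: (sum_frame sum2_sum); case. Qed.
End Sum2.

Section SelfModule.
Variable A : galg R G.
Hypothesis hA : has_approximate_unit A.

Lemma self_left_units : left_units (self_mod A).
Proof.
move=> a; have [e [ea _ _ _]] := au2 hA a a.
exists (fun x => e ** (e ** x)); last by rewrite !ea.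
apply: fin_sums1; exists e, (amul e); split=> //.
by exists e.
Qed.

(** [A] is the plain module with one coordinate. *)
Lemma self_frame : frame (self_mod A).
Proof.
pose u (a : A) : A ^^ unit := ptens a (dlt tt).
have [p1 _] := @ptens_bilin R unit A.
have ul : linear u by exact: p1.
have uE (a b : A) : pow_fun (u a) (u b) = a ** b.
  by rewrite [LHS](dot_delta (amul_bilin A)) ptens_deltaE.
have la g : linear (@aact _ _ A g) by exact: aact_lin.
apply: (@Frame _ _ A (self_mod A) (rep_triv R G unit) u
  (fun phi p => exists2 a, phi = amul a & p = u a)).
- exact: ul.
- by move=> x a; rewrite /u pow_ract_ptens.
- by move=> g x; rewrite /tact tm_delta.
- by move=> phi p [a -> _]; exists a.
- by move=> phi [a ->]; exists (u a), a.
- exists 0; last by rewrite (lin0 ul).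
  by apply/funext => x; exact/esym/(lin0 ((amul_bilin A).1 x)).
- move=> c _ _ _ _ [a -> ->] [b -> ->]; exists (c *: a + b); last by rewrite ul.
  by apply/funext => x; exact/esym/((amul_bilin A).1 x).
- move=> b _ _ [a -> ->]; exists (b ** a); last by rewrite /u pow_lact_ptens.
  by apply/funext => x; rewrite amulA.
- move=> g _ _ [a -> ->]; exists (aact g a); last by rewrite /tdual tm_delta.
  by apply/funext => x; rewrite aactM aactVK.
- by move=> _ _ [a -> ->] x; exact: uE.
- move=> _ _ [a -> ->]; have [e [_ ae _ _]] := au2 hA a a.
  have -> : u a = pow_lact (a ** e) (u e) by rewrite /u pow_lact_ptens ae ae.
  by apply: (@expands1 _ _ _ (self_mod A) _ _ (amul a) e (amul e)); exists e.
Qed.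
End SelfModule.

End DirectSums.

(** * Internal tensor products *)

Section Internal.
Variables (R : realType) (G : groupType).
Local Notation C := (R[i]).
Local Notation "X ^^ n" := (fspow n X) (at level 30).
Local Notation dlt := (@delta C _).
Variables (A B : galg R G) (pi : algHom A B) (E : fmod A).
Hypothesis hB : has_approximate_unit B.

Lemma itens_ind (P : itens_car pi E -> Prop) : P 0 ->
  (forall c x b z, P z -> P (c *: itens pi x b + z)) -> forall z, P z.
Proof.
move=> P0 PL z; rewrite -(qpi_repr z); elim/tens_ind: (repr z) => [|c v w t IH].
  by rewrite (lin0 (@qpi_linear _ _ _)).
by rewrite qpi_linear; exact: PL.
Qed.

Lemma itens_linl b : linear (fun x : E => itens pi x b).
Proof. exact: comp_lin (@qpi_linear _ _ _) ((tens_bilin E B).1 b). Qed.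

(** A local unit [\sum_j x_j psi_j] of [E] becomes
    [\sum_j (x_j (x) e)(psi_j (x) e)], where [e] is a unit of [B] for the finitely
    many elements [pi(psi_j(y)) b] that occur.  As [e] depends on the local unit
    of [E], the finite lists to be fixed are found one after the other. *)
Lemma itens_left_units : left_units E -> left_units (itensor pi E).
Proof.
move=> hE z.
suff [s sP] : exists s : seq E, forall l (x : 'I_l -> E) (psi : 'I_l -> E -> A),
    (forall j, Theta (psi j)) ->
    (forall y, y \in s -> y = \sum_(j < l) x j |* psi j y) ->
    exists t : seq B, forall e, (forall b, b \in t -> e ** b = b) ->
    z = \sum_(j < l) (itens pi (x j) e : itensor pi E) |* itens_fun (psi j) e z.
  have [k /compact_opsP [l [x [psi [hpsi ek]]]] kP] := left_units_seq hE s.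
  have [|t tP] := sP l x psi hpsi; first by move=> y /kP {1}<-; rewrite ek.
  have [e eP] := au_seq hB t.
  exists (fun y : itensor pi E =>
    \sum_(j < l) (itens pi (x j) e : itensor pi E) |* itens_fun (psi j) e y).
    apply: compact_ops_sum => j; apply: lspan_incl; by exists (psi j), e.
  by rewrite -tP // => b /eP [].
elim/itens_ind: z => [|c y b z [s sP]].
  exists [::] => l x psi hpsi _; exists [::] => e _; rewrite big1 // => j _.
  by rewrite (lin0 (itens_fun_linear _ (hpsi j))) (lin0 ((ract_bilin (itensor pi E)).2 _)).
exists (y :: s) => l x psi hpsi u.
have [|t tP] := sP l x psi hpsi; first by move=> w ws; apply: u; rewrite inE ws orbT.
exists ([seq pi (psi j y) ** b | j <- enum 'I_l] ++ t) => e eP.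
have eb j : e ** (pi (psi j y) ** b) = pi (psi j y) ** b.
  apply: eP; rewrite mem_cat (map_f (fun j => pi (psi j y) ** b)) //.
  by rewrite mem_enum.
have et w : w \in t -> e ** w = w by move=> wt; apply: eP; rewrite mem_cat wt orbT.
rewrite {1}(tP e et).
have yE : itens pi y b =
    \sum_(j < l) (itens pi (x j) e : itensor pi E) |* itens_fun (psi j) e (itens pi y b).
  rewrite {1}(u y (mem_head _ _)) (lin_sum _ _ _ (itens_linl b)); apply: eq_bigr => j _.
  by rewrite itens_funE // [RHS]itens_ractE itens_bal -amulA !eb.
rewrite {1}yE scaler_sumr -big_split; apply: eq_bigr => j _.
by rewrite (itens_fun_linear _ (hpsi j)) ((ract_bilin (itensor pi E)).2 _).
Qed.

Variable Fr : frame E.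
Local Notation r := (frep Fr).
Local Notation n := (rdim r).
Local Notation U := (@fmap _ _ _ _ Fr).
Local Notation cv := (@fcov _ _ _ _ Fr).

Let lpi : linear pi := ah_lin pi.
Local Notation piv := (tm pi (@id (C^o ^^ n))).

Let piv_lin : linear piv. Proof. exact: tm_linear. Qed.

Lemma piv_ract y a : piv (pow_ract y a) = pow_ract (piv y) (pi a).
Proof.
move: y; apply: ptens_ext => [||x i].
- exact: comp_lin piv_lin ((pow_ract_bilin A n).1 a).
- exact: comp_lin ((pow_ract_bilin B n).1 _) piv_lin.
by rewrite pow_ract_ptens !tm_delta // pow_ract_ptens ah_mul.
Qed.

Lemma piv_lact y a : piv (pow_lact a y) = pow_lact (pi a) (piv y).
Proof.
move: y; apply: ptens_ext => [||x i].
- exact: comp_lin piv_lin ((@pow_lact_bilin _ _ A n).2 a).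
- exact: comp_lin ((@pow_lact_bilin _ _ B n).2 _) piv_lin.
by rewrite pow_lact_ptens !tm_delta // pow_lact_ptens ah_mul.
Qed.

Lemma piv_tact g y : piv (tact (r := r) g y) = tact (r := r) g (piv y).
Proof.
have la : linear (@aact _ _ A g) by exact: aact_lin.
have lb : linear (@aact _ _ B g) by exact: aact_lin.
rewrite /tact !tm_comp //; last exact: rmu_lin.
by apply: eq_tm => x //=; rewrite ah_act.
Qed.

Lemma piv_tdual g y : piv (tdual (r := r) g y) = tdual (r := r) g (piv y).
Proof.
have la : linear (@aact _ _ A g) by exact: aact_lin.
have lb : linear (@aact _ _ B g) by exact: aact_lin.
rewrite /tdual !tm_comp //; last exact: rnu_lin.
by apply: eq_tm => x //=; rewrite ah_act.
Qed.

Lemma pow_fun_piv p y : pow_fun (piv p) (piv y) = pi (pow_fun p y).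
Proof.
apply: (dot_tm (h := @amul _ _ A)) => //; try exact: amul_bilin.
by move=> x z; rewrite ah_mul.
Qed.

Let h (x : E) (b : B) : B ^^ n := pow_ract (piv (U x)) b.

Let h_bilin : bilin h.
Proof.
have [r1 r2] := pow_ract_bilin B n.
split=> [b|x]; last exact: r2.
exact: comp_lin (r1 b) (comp_lin piv_lin (@fmap_lin _ _ _ _ Fr)).
Qed.

Let h_bal z : sp_set (span_subspace (itens_rel pi (E := E))) z -> tlift h z = 0.
Proof.
move: z; apply: (itens_rel_lift (tlift_linear h_bilin)) => x a b.
by rewrite !tliftE // /h fmap_ract piv_ract pow_ractA.
Qed.

(** [x (x) b] goes to the family [pi(U x) b]. *)
Definition itens_map : itensor pi E -> B ^^ n := qlift (tlift h).

Lemma itens_map_lin : linear itens_map.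
Proof. exact: qlift_linear (tlift_linear h_bilin) h_bal. Qed.

Lemma itens_mapE x b : itens_map (itens pi x b) = pow_ract (piv (U x)) b.
Proof. by rewrite /itens_map (qliftE (tlift_linear h_bilin) h_bal) tliftE. Qed.

Let M : lmodType C := ((itensor pi E -> B) * (B ^^ n))%type.

(** If [p] represents [phi], then [c pi(p)] represents [phi (x) c]. *)
Definition itens_cov_gen : set M := [set m | exists (phi : E -> A) p c,
  cv phi p /\ m = (itens_fun phi c, pow_lact c (piv p))].

Definition itens_cov (phi : itensor pi E -> B) (p : B ^^ n) :=
  lspan itens_cov_gen (phi, p).

Lemma itens_cov_ind (P : (itensor pi E -> B) -> B ^^ n -> Prop) :
  P (fun=> 0) 0 ->
  (forall c phi p e psi q, cv phi p -> P psi q ->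
     P (fun x => e *: itens_fun phi c x + psi x) (e *: pow_lact c (piv p) + q)) ->
  forall phi p, itens_cov phi p -> P phi p.
Proof.
move=> P0 PL phi p; rewrite /itens_cov.
suff : forall m : M, lspan itens_cov_gen m -> P m.1 m.2 by move=> H /H.
apply: lspan_ind => // e m m' [psi [q [c [hq ->]]]].
exact: PL.
Qed.

(** Expand all the functionals of [E] that occur in a sum of generators along one
    list, and insert a unit [e] of [B] as for points. *)
Lemma itens_cov_expands phi p : itens_cov phi p -> expands itens_cov phi p.
Proof.
have [l1 l2] := @pow_lact_bilin _ _ B n.
have [a1 a2] := amul_bilin B.
move=> hp.
suff [s [scov sP]] : exists s : seq ((E -> A) * (A ^^ n)),
    (forall m, m \in s -> cv m.1 m.2) /\
    forall l (x : 'I_l -> E) (psi : 'I_l -> E -> A) q,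
    (forall j, cv (psi j) (q j)) ->
    (forall m, m \in s -> m.2 = \sum_(j < l) pow_lact (m.1 (x j)) (q j)) ->
    exists t : seq B, forall e, (forall b, b \in t -> b ** e = b) ->
    p = \sum_(j < l) pow_lact (phi (itens pi (x j) e)) (pow_lact e (piv (q j))).
  have [l [x [psi [q [hq u]]]]] := fcov_loc_seq scov.
  have [t tP] := sP l x psi q hq u; have [e eP] := au_seq hB t.
  rewrite (tP e) => [|b /eP[] //]; apply: expands_big => j.
  apply: (@expands1 _ _ _ _ _ itens_cov phi _ (itens_fun (psi j) e)).
  by apply: lspan_incl; exists (psi j), (q j), e.
move: phi p hp; apply: itens_cov_ind => [|c phi p d psi q hp [s [scov sP]]].
  exists [::]; split=> // l x psi q _ _; exists [::] => e _.
  by rewrite big1 // => j _; rewrite (lin0 (l1 _)).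
exists ((phi, p) :: s); split.
  by move=> m; rewrite inE => /predU1P[-> //|]; exact: scov.
move=> l x psi' q' hq' u.
have [|t tP] := sP l x psi' q' hq'.
  by move=> m ms; apply: u; rewrite inE ms orbT.
exists ([seq c ** pi (phi (x j)) | j <- enum 'I_l] ++ t) => e eP.
have eb j : c ** pi (phi (x j)) ** e = c ** pi (phi (x j)).
  apply: eP; rewrite mem_cat (map_f (fun j => c ** pi (phi (x j)))) //.
  by rewrite mem_enum.
rewrite {1}(tP e) => [|b bt]; last by apply: eP; rewrite mem_cat bt orbT.
have lact2 a b z : pow_lact a (pow_lact b z) = pow_lact (a ** b) z :> B ^^ n.
  by apply: fs_ext => i /=; rewrite amulA.
have pE : p = \sum_(j < l) pow_lact (phi (x j)) (q' j) := u _ (mem_head _ _).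
rewrite {1}pE (lin_sum _ _ _ piv_lin) (lin_sum _ _ _ (l2 c)).
rewrite scaler_sumr -big_split; apply: eq_bigr => j _.
rewrite l1 /=; congr (_ *: _ + _).
rewrite itens_funE; last exact: fcov_Theta hp.
by rewrite piv_lact !lact2 !eb.
Qed.

Lemma itens_frame : frame (itensor pi E).
Proof.
have [l1 l2] := @pow_lact_bilin _ _ B n.
have a_bilin := amul_bilin B; have [a1 a2] := a_bilin.
have lact2 a b (z : B ^^ n) : pow_lact a (pow_lact b z) = pow_lact (a ** b) z.
  by apply: fs_ext => i /=; rewrite amulA.
have fl phi p (c : B) : cv phi p -> linear (itens_fun phi c : itensor pi E -> B).
  by move=> /fcov_Theta; exact: itens_fun_linear.
apply: (@Frame _ _ B (itensor pi E) r itens_map itens_cov).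
- exact: itens_map_lin.
- move=> x c; move: x; apply: itens_ext => [||x b].
  + exact: comp_lin itens_map_lin (itens_ract_linl c).
  + exact: comp_lin ((pow_ract_bilin B n).1 c) itens_map_lin.
  by rewrite [_ |* _]itens_ractE !itens_mapE pow_ractA.
- move=> g; apply: itens_ext => [||x b].
  + exact: comp_lin itens_map_lin (itens_act_lin g).
  + exact: comp_lin (@tact_lin _ _ B r g) itens_map_lin.
  by rewrite [mact _ _]itens_actE !itens_mapE tact_ract fmap_act piv_tact.
- apply: itens_cov_ind => [|c phi p e psi q hp IH]; first exact: itens_Theta0.
  apply: lspanL => //; apply: lspan_incl; exists phi, c; split=> //.
  exact: fcov_Theta hp.
- apply: lspan_ind => [|e _ psi [phi [c [hphi ->]]] [q hq]].
    by exists 0; exact: lspan0.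
  have [p hp] := fcov_total Fr hphi.
  exists (e *: pow_lact c (piv p) + q).
  by apply: (lspanL _ (x := (_, _)) _ hq); apply: lspan_incl; exists phi, p, c.
- exact: lspan0.
- by move=> c phi p psi q hp hq; exact: (lspanL _ hp hq).
- move=> a; apply: itens_cov_ind => [|c phi p e psi q hp IH].
    by rewrite (lin0 (l2 _)) (lin0 (a2 _)); exact: lspan0.
  have F (x : itensor pi E) : a ** itens_fun phi c x = itens_fun phi (a ** c) x.
    move: x; apply: itens_ext => [d y z||y b]; [by rewrite (fl _ _ _ hp) a2|exact: fl hp|].
    by rewrite !itens_funE ?amulA //; exact: fcov_Theta hp.
  have -> : (fun x => a ** (e *: itens_fun phi c x + psi x)) =
      (fun x => e *: itens_fun phi (a ** c) x + a ** psi x).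
    by apply/funext => x; rewrite a2 F.
  rewrite l2 lact2; apply: (lspanL e (x := (_, _)) _ IH).
  by apply: lspan_incl; exists phi, p, (a ** c).
- move=> g; have lb : linear (@aact _ _ B g) by exact: aact_lin.
  apply: itens_cov_ind => [|c phi p e psi q hp IH].
    by rewrite (lin0 (@tdual_lin _ _ B r g)) (lin0 lb); exact: lspan0.
  pose phi' x := aact g (phi (mact g^-1%g x)).
  have hp' : cv phi' (tdual g p) by exact: fcov_act.
  have F (x : itensor pi E) : aact g (itens_fun phi c (mact g^-1%g x)) = itens_fun phi' (aact g c) x.
    move: x; apply: itens_ext => [d y z||y b]; [|exact: fl hp'|].
      by rewrite (@mact_lin _ _ _ (itensor pi E) _) (fl _ _ _ hp) lb.
    have [tp tp'] := (fcov_Theta hp, fcov_Theta hp').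
    by rewrite [mact _ _]itens_actE !itens_funE // !aactM aactVK -ah_act.
  have H : itens_cov
      (fun x : itensor pi E => e *: itens_fun phi' (aact g c) x + aact g (psi (mact g^-1%g x)))
      (e *: pow_lact (aact g c) (piv (tdual g p)) + tdual g q).
    apply: (lspanL e (x := (_, _)) _ IH).
    by apply: lspan_incl; exists phi', (tdual g p), (aact g c).
  move: H; rewrite (@tdual_lin _ _ B r g) tdual_lact -piv_tdual.
  congr itens_cov; apply/funext => x.
  by rewrite -F lb.
- apply: itens_cov_ind => [x|c phi p e psi q hp IH x].
    exact: (lin0 (dot_linl a_bilin _)).
  rewrite [LHS](dot_linl a_bilin) -[dot _ q _]/(pow_fun q _) IH; congr (_ *: _ + _).
  move: x; apply: itens_ext => [||x b].
  + exact: comp_lin (dot_linr a_bilin _) itens_map_lin.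
  + exact: fl hp.
  rewrite itens_mapE itens_funE; last exact: fcov_Theta hp.
  rewrite -[LHS]/(pow_fun _ _) pow_fun_lact.
  have -> : pow_fun (piv p) (pow_ract (piv (U x)) b) = pow_fun (piv p) (piv (U x)) ** b.
    by apply: pow_Theta_ract; eexists.
  by rewrite pow_fun_piv (fcovE hp) amulA.
- exact: itens_cov_expands.
Qed.

End Internal.

(** * External tensor products *)

Section External.
Variables (R : realType) (G : groupType).
Local Notation C := (R[i]).
Local Notation "X ^^ n" := (fspow n X) (at level 30).
Local Notation dlt := (@delta C _).
Variables (A B : galg R G).
Local Notation T := (talg A B).

Lemma talg_mulE (a a' : A) (b b' : B) :
  ((a *t b : T) ** (a' *t b' : T)) = (a ** a') *t (b ** b').
Proof. exact: (tpairE (amul_bilin A) (amul_bilin B)). Qed.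

Lemma talg_actE g (a : A) (b : B) : aact g (a *t b : T) = aact g a *t aact g b.
Proof. by apply: tmapE; exact: aact_lin. Qed.

(** Common units [e] and [e'] for the tensor factors of an element give the unit
    [e (x) e']. *)
Lemma talg_au : has_approximate_unit A -> has_approximate_unit B -> has_approximate_unit T.
Proof.
move=> hA hB.
suff u (t : T) : exists e, e ** t = t /\ t ** e = t.
  by have [] : discrete_alg_au T by apply: au_of_units => t; have [e []] := u t; exists e.
suff [s [s' sP]] : exists (s : seq A) (s' : seq B), forall e e',
    (forall a, a \in s -> e ** a = a /\ a ** e = a) ->
    (forall b, b \in s' -> e' ** b = b /\ b ** e' = b) ->
    ((e *t e' : T) ** t = t /\ t ** (e *t e') = t).
  have [e eP] := au_seq hA s; have [e' eP'] := au_seq hB s'.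
  by exists (e *t e'); exact: sP.
have [m1 m2] := amul_bilin T.
elim/tens_ind: t => [|c a b t [s [s' sP]]].
  by exists [::], [::] => e e' _ _; rewrite (lin0 (m1 _)) (lin0 (m2 _)).
exists (a :: s), (b :: s') => e e' eP eP'.
have [ea ae] := eP a (mem_head _ _); have [eb be] := eP' b (mem_head _ _).
have [||h1 h2] := sP e e'.
- by move=> x xs; apply: eP; rewrite inE xs orbT.
- by move=> x xs; apply: eP'; rewrite inE xs orbT.
split.
  by rewrite [LHS]m2 talg_mulE ea eb h1.
by rewrite [LHS]m1 talg_mulE ae be h2.
Qed.

Variables (E : fmod A) (F : fmod B).

Lemma etens_ractE (x : E) (y : F) (a : A) (b : B) :
  (x *t y : etensor E F) |* (a *t b) = (x |* a) *t (y |* b).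
Proof. exact: (tpairE (ract_bilin E) (ract_bilin F)). Qed.

Lemma etens_actE g (x : E) (y : F) :
  mact g (x *t y : etensor E F) = mact g x *t mact g y.
Proof. by apply: tmapE; exact: mact_lin. Qed.

Lemma tmap_Theta (phi : E -> A) (psi : F -> B) : Theta phi -> Theta psi ->
  @Theta _ _ T (etensor E F) (tmap phi psi).
Proof. by move=> h h'; apply: lspan_incl; exists phi, psi. Qed.

Lemma tens_sum (V W : lmodType C) (I J : Type) (s : seq I) (t : seq J) (f : I -> V) (g : J -> W) :
  (\sum_(i <- s) f i) *t (\sum_(j <- t) g j) = \sum_(i <- s) \sum_(j <- t) f i *t g j.
Proof.
have [t1 t2] := @tens_bilin C V W.
rewrite (lin_sum _ _ _ (t1 _)); apply: eq_bigr => i _.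
exact: (lin_sum _ _ _ (t2 _)).
Qed.

(** Tensor products of local units, chosen common to the factors of the given
    element. *)
Lemma etens_left_units : left_units E -> left_units F -> left_units (etensor E F).
Proof.
move=> hE hF z.
suff [s [s' sP]] : exists (s : seq E) (s' : seq F),
    forall l (x : 'I_l -> E) (phi : 'I_l -> E -> A) l' (y : 'I_l' -> F) (psi : 'I_l' -> F -> B),
    (forall j, Theta (phi j)) -> (forall j, Theta (psi j)) ->
    (forall v, v \in s -> v = \sum_(j < l) x j |* phi j v) ->
    (forall w, w \in s' -> w = \sum_(j < l') y j |* psi j w) ->
    z = \sum_(i < l) \sum_(j < l') (x i *t y j : etensor E F) |* tmap (phi i) (psi j) z.
  have [k /compact_opsP [l [x [phi [hphi ek]]]] kP] := left_units_seq hE s.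
  have [k' /compact_opsP [l' [y [psi [hpsi ek']]]] kP'] := left_units_seq hF s'.
  exists (fun z : etensor E F =>
     \sum_(i < l) \sum_(j < l') (x i *t y j : etensor E F) |* tmap (phi i) (psi j) z).
    elim: (index_enum _) => [|i u IH].
      by under eq_fun do rewrite big_nil; exact: fin_sums0.
    under eq_fun do rewrite big_cons; apply: fin_sumsD IH.
    by apply: compact_ops_sum => j; exact: tmap_Theta.
  rewrite -sP // => [v /kP|w /kP'] e; first by rewrite -{1}e ek.
  by rewrite -{1}e ek'.
have [m1 m2] := ract_bilin (etensor E F).
elim/tens_ind: z => [|c v w z [s [s' sP]]].
  exists [::], [::] => l x phi l' y psi hphi hpsi _ _.
  rewrite big1 // => i _; rewrite big1 // => j _.
  by rewrite (lin0 (Theta_lin (tmap_Theta (hphi i) (hpsi j)))) (lin0 (m2 _)).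
exists (v :: s), (w :: s') => l x phi l' y psi hphi hpsi u u'.
have zE := sP l x phi l' y psi hphi hpsi.
rewrite {1}zE; last 2 first.
- by move=> k ks; apply: u; rewrite inE ks orbT.
- by move=> k ks; apply: u'; rewrite inE ks orbT.
have vE := u v (mem_head _ _); have wE := u' w (mem_head _ _).
rewrite {1}vE {1}wE tens_sum scaler_sumr -big_split; apply: eq_bigr => i _.
rewrite scaler_sumr -big_split; apply: eq_bigr => j _.
have lij := Theta_lin (tmap_Theta (hphi i) (hpsi j)).
rewrite lij [RHS]m2 tmapE; [|exact: Theta_lin..].
by rewrite etens_ractE.
Qed.

Variables (Fr : frame E) (Fs : frame F).
Local Notation r := (frep Fr).
Local Notation s := (frep Fs).
Local Notation rs := (rep_prod r s).
Local Notation n := (rdim r).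
Local Notation m := (rdim s).
Local Notation U := (@fmap _ _ _ _ Fr).
Local Notation V := (@fmap _ _ _ _ Fs).
Local Notation bx := (box (tens_bilin A B)).

Lemma bx_ract (y : A ^^ n) (z : B ^^ m) a b :
  pow_ract (bx y z : T ^^ _) (a *t b : T) = bx (pow_ract y a) (pow_ract z b).
Proof. by apply: fs_ext => -[i j]; exact: talg_mulE. Qed.

Lemma bx_lact (y : A ^^ n) (z : B ^^ m) a b :
  pow_lact (a *t b : T) (bx y z : T ^^ _) = bx (pow_lact a y) (pow_lact b z).
Proof. by apply: fs_ext => -[i j]; exact: talg_mulE. Qed.

Lemma bx_tact g (y : A ^^ n) (z : B ^^ m) :
  tact (A := T) (r := rs) g (bx y z) = bx (tact g y) (tact g z).
Proof.
apply: tm_box; try exact: aact_lin; try exact: rmu_lin.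
by move=> a b; exact: talg_actE.
Qed.

Lemma bx_tdual g (y : A ^^ n) (z : B ^^ m) :
  tdual (A := T) (r := rs) g (bx y z) = bx (tdual g y) (tdual g z).
Proof.
apply: tm_box; try exact: aact_lin; try exact: rnu_lin.
by move=> a b; exact: talg_actE.
Qed.

Lemma pow_fun_bx (p y : A ^^ n) (q z : B ^^ m) :
  pow_fun (bx p q : T ^^ _) (bx y z : T ^^ _) = pow_fun p y *t pow_fun q z.
Proof.
apply: dot_box.
- exact: amul_bilin.
- exact: amul_bilin.
- exact: (amul_bilin T).
- exact: tens_bilin.
- by move=> *; exact: talg_mulE.
Qed.

Let h (x : E) (y : F) : T ^^ (n * m)%type := bx (U x) (V y).

Let h_bilin : bilin h.
Proof.
have [b1 b2] := box_bilin n m (tens_bilin A B).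
split=> [y|x].
- exact: comp_lin (b1 _) (@fmap_lin _ _ _ _ Fr).
- exact: comp_lin (b2 _) (@fmap_lin _ _ _ _ Fs).
Qed.

Definition etens_map : etensor E F -> T ^^ (n * m)%type := tlift h.

Lemma etens_map_lin : linear etens_map.
Proof. exact: tlift_linear h_bilin. Qed.

Lemma etens_mapE x y : etens_map (x *t y) = bx (U x) (V y).
Proof. exact: (tliftE h_bilin). Qed.

Let M : lmodType C := ((etensor E F -> T) * (T ^^ (n * m)%type))%type.

(** The exterior product of representing families represents [phi (x) psi]. *)
Definition etens_cov_gen : set M := [set k | exists (phi : E -> A) p (psi : F -> B) q,
  [/\ @fcov _ _ _ _ Fr phi p, @fcov _ _ _ _ Fs psi q & k = (tmap phi psi, bx p q)]].

Definition etens_cov (phi : etensor E F -> T) (p : T ^^ (n * m)%type) :=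
  lspan etens_cov_gen (phi, p).

Lemma etens_cov_ind (P : (etensor E F -> T) -> T ^^ (n * m)%type -> Prop) :
  P (fun=> 0) 0 ->
  (forall c phi p psi q chi k, @fcov _ _ _ _ Fr phi p -> @fcov _ _ _ _ Fs psi q ->
     P chi k -> P (fun x => c *: tmap phi psi x + chi x) (c *: bx p q + k)) ->
  forall chi k, etens_cov chi k -> P chi k.
Proof.
move=> P0 PL phi p; rewrite /etens_cov.
suff : forall m : M, lspan etens_cov_gen m -> P m.1 m.2 by move=> H /H.
apply: lspan_ind => // e _ k' [f [p' [f' [q' [hp hq ->]]]]].
exact: PL.
Qed.

Lemma etens_covL c phi p psi q chi k : @fcov _ _ _ _ Fr phi p -> @fcov _ _ _ _ Fs psi q ->
  etens_cov chi k -> etens_cov (fun x => c *: tmap phi psi x + chi x) (c *: bx p q + k).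
Proof.
move=> hp hq hk; apply: (lspanL c (x := (_, _)) _ hk); apply: lspan_incl.
by exists phi, p, psi, q.
Qed.

Lemma etens_cov_expands phi p : etens_cov phi p -> expands etens_cov phi p.
Proof.
have [l1 l2] := @pow_lact_bilin _ _ T (n * m)%type.
move=> hp.
suff [S [S' [scov scov' sP]]] :
    exists (S : seq ((E -> A) * (A ^^ n))) (S' : seq ((F -> B) * (B ^^ m))),
    [/\ forall k, k \in S -> @fcov _ _ _ _ Fr k.1 k.2,
        forall k, k \in S' -> @fcov _ _ _ _ Fs k.1 k.2 &
    forall l (x : 'I_l -> E) (f : 'I_l -> E -> A) u l' (y : 'I_l' -> F) (f' : 'I_l' -> F -> B) u',
    (forall j, @fcov _ _ _ _ Fr (f j) (u j)) -> (forall j, @fcov _ _ _ _ Fs (f' j) (u' j)) ->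
    (forall k, k \in S -> k.2 = \sum_(j < l) pow_lact (k.1 (x j)) (u j)) ->
    (forall k, k \in S' -> k.2 = \sum_(j < l') pow_lact (k.1 (y j)) (u' j)) ->
    p = \sum_(i < l) \sum_(j < l') pow_lact (phi (x i *t y j)) (bx (u i) (u' j))].
  have [l [x [f [u [hu uP]]]]] := fcov_loc_seq scov.
  have [l' [y [f' [u' [hu' uP']]]]] := fcov_loc_seq scov'.
  rewrite (sP _ _ _ _ _ _ _ _ hu hu' uP uP').
  apply: expands_big => i; apply: expands_big => j.
  apply: (@expands1 _ _ _ _ _ etens_cov phi _ (tmap (f i) (f' j))).
  by apply: lspan_incl; exists (f i), (u i), (f' j), (u' j).
move: phi p hp; apply: etens_cov_ind => [|c phi p psi q chi k hp hq [S [S' [sc sc' sP]]]].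
  exists [::], [::]; split=> // l x f u l' y f' u' _ _ _ _.
  by rewrite big1 // => i _; rewrite big1 // => j _; rewrite (lin0 (l1 _)).
exists ((phi, p) :: S), ((psi, q) :: S'); split.
- by move=> d; rewrite inE => /predU1P[-> //|]; exact: sc.
- by move=> d; rewrite inE => /predU1P[-> //|]; exact: sc'.
move=> l x f u l' y f' u' hu hu' uP uP'.
have kE := sP l x f u l' y f' u' hu hu'.
rewrite {1}kE; last 2 first.
- by move=> d ds; apply: uP; rewrite inE ds orbT.
- by move=> d ds; apply: uP'; rewrite inE ds orbT.
have pE : p = \sum_(j < l) pow_lact (phi (x j)) (u j) := uP _ (mem_head _ _).
have qE : q = \sum_(j < l') pow_lact (psi (y j)) (u' j) := uP' _ (mem_head _ _).
have [b1 b2] := box_bilin n m (tens_bilin A B).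
rewrite {1}pE {1}qE (lin_sum _ _ _ (b1 _)) scaler_sumr -big_split; apply: eq_bigr => i _.
rewrite (lin_sum _ _ _ (b2 _)) scaler_sumr -big_split; apply: eq_bigr => j _.
have [tp tq] := (fcov_Theta hp, fcov_Theta hq).
rewrite [RHS]l1 tmapE; [|exact: Theta_lin..].
by rewrite bx_lact.
Qed.

Lemma etens_frame : frame (etensor E F).
Proof.
have [l1 l2] := @pow_lact_bilin _ _ T (n * m)%type.
have a_bilin := amul_bilin T; have [a1 a2] := a_bilin.
have [m1 m2] := ract_bilin (etensor E F).
have [p1 p2] := pow_ract_bilin T (n * m)%type.
have [U1 U2] := (@fmap_lin _ _ _ _ Fr, @fmap_lin _ _ _ _ Fs).
have tl phi p psi q : @fcov _ _ _ _ Fr phi p -> @fcov _ _ _ _ Fs psi q ->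
    linear (tmap phi psi : etensor E F -> T).
  by move=> hp hq; exact: (Theta_lin (tmap_Theta (fcov_Theta hp) (fcov_Theta hq))).
apply: (@Frame _ _ T (etensor E F) rs etens_map etens_cov).
- exact: etens_map_lin.
- move=> z t; move: z; apply: tens_ext => [||x y].
  + exact: comp_lin etens_map_lin (m1 t).
  + exact: comp_lin (p1 t) etens_map_lin.
  move: t; apply: tens_ext => [||a b].
  + exact: comp_lin etens_map_lin (m2 _).
  + exact: (p2 _).
  by rewrite etens_ractE !etens_mapE !fmap_ract bx_ract.
- move=> g; apply: tens_ext => [||x y].
  + exact: comp_lin etens_map_lin (@mact_lin _ _ _ (etensor E F) g).
  + exact: comp_lin (@tact_lin _ _ T rs g) etens_map_lin.
  by rewrite etens_actE !etens_mapE bx_tact !fmap_act.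
- apply: etens_cov_ind => [|c phi p psi q chi k hp hq IH]; first exact: etens_Theta0.
  by apply: lspanL => //; exact: (tmap_Theta (fcov_Theta hp) (fcov_Theta hq)).
- apply: lspan_ind => [|e _ chi [phi [psi [hphi hpsi ->]]] [k hk]].
    by exists 0; exact: lspan0.
  have [[p hp] [q hq]] := (fcov_total Fr hphi, fcov_total Fs hpsi).
  by exists (e *: bx p q + k); exact: etens_covL.
- exact: lspan0.
- by move=> c phi p psi q hp hq; exact: (lspanL _ hp hq).
- move=> t chi k hk; elim/tens_ind: t => [|d a b t IHt].
    rewrite (lin0 (l1 _)); have -> : (fun x => (0 : T) ** chi x) = fun=> 0.
      by apply/funext => x; rewrite (lin0 (a1 _)).
    exact: lspan0.
  have H1 : etens_cov (fun x => (a *t b : T) ** chi x) (pow_lact (a *t b : T) k).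
    move: chi k hk {IHt}; apply: etens_cov_ind => [|c phi p psi q chi k hp hq IH].
      by rewrite (lin0 (l2 _)) (lin0 (a2 _)); exact: lspan0.
    have H := etens_covL c (fcov_mul a hp) (fcov_mul b hq) IH.
    move: H; rewrite l2 bx_lact; congr etens_cov; apply/funext => x.
    rewrite a2; congr (_ *: _ + _).
    have tl' := tl _ _ _ _ (fcov_mul a hp) (fcov_mul b hq).
    move: x; apply: tens_ext => [||x y]; first exact: tl'.
      by move=> u v w; rewrite (tl _ _ _ _ hp hq) a2.
    have [tp tq] := (Theta_lin (fcov_Theta hp), Theta_lin (fcov_Theta hq)).
    have [tp' tq'] := (Theta_lin (fcov_Theta (fcov_mul a hp)), Theta_lin (fcov_Theta (fcov_mul b hq))).
    by rewrite !tmapE // talg_mulE.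
  have H : etens_cov (fun x => d *: ((a *t b : T) ** chi x) + (t : T) ** chi x)
      (d *: pow_lact (a *t b : T) k + pow_lact (t : T) k).
    exact: (lspanL d H1 IHt).
  move: H; rewrite l1; congr etens_cov; apply/funext => x.
  by rewrite a1.
- move=> g; have lt : linear (@aact _ _ T g) by exact: aact_lin.
  apply: etens_cov_ind => [|c phi p psi q chi k hp hq IH].
    by rewrite (lin0 (@tdual_lin _ _ T rs g)) (lin0 lt); exact: lspan0.
  have [hp' hq'] := (fcov_act g hp, fcov_act g hq).
  have H := etens_covL c hp' hq' IH.
  move: H; rewrite (@tdual_lin _ _ T rs g) bx_tdual; congr etens_cov; apply/funext => x.
  rewrite lt; congr (_ *: _ + _).
  move: x; apply: tens_ext => [||x y]; first exact: tl hp' hq'.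
    by move=> u v w; rewrite (@mact_lin _ _ _ (etensor E F) _) (tl _ _ _ _ hp hq) lt.
  have [tp tq] := (Theta_lin (fcov_Theta hp), Theta_lin (fcov_Theta hq)).
  have [tp' tq'] := (Theta_lin (fcov_Theta hp'), Theta_lin (fcov_Theta hq')).
  by rewrite etens_actE !tmapE // talg_actE.
- apply: etens_cov_ind => [z|c phi p psi q chi k hp hq IH z].
    exact: (lin0 (dot_linl a_bilin _)).
  rewrite [LHS](dot_linl a_bilin) -[dot _ k _]/(pow_fun k _) IH; congr (_ *: _ + _).
  move: z; apply: tens_ext => [||x y].
  + exact: comp_lin (dot_linr a_bilin _) etens_map_lin.
  + exact: tl hp hq.
  rewrite etens_mapE tmapE; [|exact: Theta_lin (fcov_Theta hp)|exact: Theta_lin (fcov_Theta hq)].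
  by rewrite [LHS]pow_fun_bx (fcovE hp) (fcovE hq).
- exact: etens_cov_expands.
Qed.

End External.

(** * Corner modules *)

Section CornerModules.
Variables (R : realType) (G : groupType).
Local Notation C := (R[i]).
Local Notation "X ^^ n" := (fspow n X) (at level 30).
Local Notation dlt := (@delta C _).
Variables (A : galg R G) (hA : has_approximate_unit A) (E : fmod A).
Local Notation EA := (sum2 E (self_mod A)).
Local Notation K := (corner_alg E).
Local Notation mop := (mop hA E).
Variable F : fmod K.
Local Notation Cor := (corner hA F).
Let a_bilin := amul_bilin A.
Let k_bilin := amul_bilin K.

Lemma kmulE (S T : K) x : cop (S ** T) x = cop S (cop T x). Proof. by []. Qed.
Lemma mop_col b (x : EA) : cop (mop b) x = ((0, b ** x.2) : EA). Proof. by []. Qed.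

Lemma K_ract (T : K) (x : EA) a : cop T (x |* a) = cop T x |* a.
Proof. exact: (compact_ract (copP T)). Qed.

Lemma base_ract (b c : A) : ((0, b) : EA) |* c = ((0, b ** c) : EA).
Proof. by rewrite [LHS]/= /sum2_ract /= (lin0 ((ract_bilin E).1 c)). Qed.

(** An operator [T] in [K(E (+) A)], followed by the coordinate in [A] and by
    multiplication with [b], is the functional of [E (+) A] that [m_b T] stands
    for; dually, the column [T(0, e)] below is the vector that [T m_e] stands for. *)
Definition row (b : A) (T : K) (x : EA) : A := b ** (cop T x).2.

Lemma row_lin b x : linear (fun T : K => row b T x).
Proof.
move=> c S T; rewrite /row.
have -> : (cop (c *: S + T) x).2 = c *: (cop S x).2 + (cop T x).2 by [].
by rewrite a_bilin.2.
Qed.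

Lemma row_Theta b T : @Theta _ _ A EA (row b T).
Proof.
have /compact_opsP [l [x [phi [hphi eT]]]] := copP T.
have -> : row b T = fun y => \sum_(j < l) (b ** (x j).2) ** phi j y.
  apply/funext => y; rewrite /row eT.
  have l2 : linear (fun y : EA => b ** y.2).
    by move=> c u v; exact: a_bilin.2.
  rewrite (lin_sum _ _ _ l2); apply: eq_bigr => j _.
  by rewrite amulA.
elim: (index_enum _) => [|j s IH].
  by under eq_fun do rewrite big_nil; exact: Theta0.
by under eq_fun do rewrite big_cons; apply: ThetaD => //; exact: Theta_mul.
Qed.

Fact shift_Theta e : @Theta _ _ A EA (fun x : EA => 0 + e ** x.2).
Proof.
exists (fun=> 0), (amul e); split=> //; first exact: Theta0.
by exists e.
Qed.

(** The operator that maps [(x, c)] to [z e c]: it realises [z] as a column. *)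
Definition col_op (z : EA) (e : A) : K :=
  mk_compact (fin_sums1 (ex_intro _ z (ex_intro _ _
    (conj (shift_Theta e) (erefl (rank_one z (fun x : EA => 0 + e ** x.2))))))).

Lemma col_opE z e x : cop (col_op z e) x = z |* (e ** x.2).
Proof. by rewrite [LHS]/= /rank_one add0r. Qed.

(** The operator with values [(0, e tau(x))] realises the functional [tau] as a
    row. *)
Lemma row_op_exists (tau : EA -> A) e : @Theta _ _ A EA tau ->
  exists T : K, forall x, cop T x = ((0, e ** tau x) : EA).
Proof.
move=> ht; exists (mk_compact (fin_sums1 (ex_intro _ ((0, e) : EA) (ex_intro _ tau
  (conj ht (erefl (rank_one ((0, e) : EA) tau))))))) => x.
by rewrite [LHS]/= /rank_one base_ract.
Qed.

Lemma stable (x y : Cor) c : exists e, [/\ cval x |* mop e = cval x,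
  cval y |* mop e = cval y, e ** c = c & c ** e = c].
Proof.
have [[xi [a ea]] [eta [b eb]]] := (cvalP x, cvalP y).
have [e eP] := au_seq hA [:: a; b; c]; exists e.
have [_ ae] := eP a (mem_head _ _).
have [|_ be] := eP b; first by rewrite !inE eqxx orbT.
have [|ec ce] := eP c; first by rewrite !inE eqxx !orbT.
by rewrite ea eb !ractA -!mop_mul ae be.
Qed.

Lemma pair_seq (T : eqType) (l l' : nat) (f : 'I_l -> 'I_l' -> T) :
  exists s : seq T, forall i j, f i j \in s.
Proof.
exists [seq f i j | i <- enum 'I_l, j <- enum 'I_l'] => i j.
by apply: allpairs_f; rewrite mem_enum.
Qed.

(** Let [x = \sum_j y_j phi_j(x)] in [F].  The coefficients [phi_j(x)] are operators
    on [E (+) A], determined by their columns [zeta_j] because [x = x m_e0].  A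
    local unit [\sum_i z_i tau_i] of [E (+) A] fixing these columns factors
    [phi_j(x)] through operators of the form [col_op (z_i) e m_e] and
    [m_e R_i phi_j(x)], where [R_i] is the row of [tau_i]; the first are absorbed
    into points of the corner, the second into its functionals. *)
Lemma corner_left_units : left_units EA -> left_units F -> left_units Cor.
Proof.
move=> hE hF x; have [e0 [xe0 _ _ _]] := stable x x 0.
have [k /compact_opsP [l [y [phi [hphi ek]]]] kx] := hF (cval x).
pose zeta j : EA := cop (phi j (cval x)) ((0, e0) : EA).
have [k' /compact_opsP [l' [z [tau [htau ek']]]] kz] :=
  left_units_seq hE [seq zeta j | j <- enum 'I_l].
have zetaE j : zeta j = \sum_(i < l') z i |* tau i (zeta j).
  by rewrite -{1}(kz (zeta j)) ?ek' // (map_f zeta) // mem_enum.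
have [s sP] := pair_seq (fun j i => tau i (zeta j)).
have [e eP] := au_seq hA s.
have ett i j : e ** tau i (zeta j) = tau i (zeta j) by have [] := eP _ (sP j i).
have /choice [Rop RopE] := fun i => row_op_exists e (htau i).
have hX j i : corner_set hA ((y j |* col_op (z i) e) |* mop e) by do 2 eexists.
pose X j i : Cor := mk_corner (hX j i).
have /choice [psi hpsi] : forall ji : 'I_l * 'I_l', exists psi : Cor -> A,
    is_corner_fun e (fun v => Rop ji.2 ** phi ji.1 v) psi.
  by move=> ji; apply: corner_fun_exists; exact: Theta_mul.
exists (fun v : Cor => \sum_(j < l) \sum_(i < l') X j i |* psi (j, i) v).
  elim: (index_enum _) => [|j u IH].
    by under eq_fun do rewrite big_nil; exact: fin_sums0.
  under eq_fun do rewrite big_cons; apply: fin_sumsD IH.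
  apply: compact_ops_sum => i; exists e, (fun v => Rop i ** phi j v); split.
    exact: Theta_mul.
  exact: (hpsi (j, i)).
apply: cval_inj; rewrite (lin_sum _ _ _ (@cval_linear _ _ _ hA E F)).
rewrite -[RHS]kx ek; apply: eq_bigr => j _.
have phiE v : cop (phi j (cval x)) v = zeta j |* v.2.
  rewrite -{1}xe0 (Theta_ract (hphi j)) kmulE mop_col -base_ract K_ract.
  by [].
have -> : phi j (cval x) = \sum_(i < l') col_op (z i) e ** mop e ** (mop (psi (j, i) x)).
  apply: cop_inj; apply/funext => v.
  have cl : linear (fun T : K => cop T v) by [].
  rewrite [RHS](lin_sum _ _ _ cl) phiE {1}(zetaE j).
  rewrite (lin_sum _ _ _ ((ract_bilin EA).1 v.2)); apply: eq_bigr => i _.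
  rewrite (hpsi (j, i)) !kmulE phiE mop_col mop_col RopE col_opE /=.
  rewrite (Theta_ract (htau i)) !(amulA _ _ v.2) !ett.
  exact: (@ractA _ _ A EA).
rewrite (lin_sum _ _ _ (@cval_linear _ _ _ hA E F)) (lin_sum _ _ _ ((ract_bilin F).2 _)).
apply: eq_bigr => i _.
by rewrite -!ractA.
Qed.

Section Frame.
Variables (W : frame EA) (Fr : frame F).
Local Notation r := (frep Fr).
Local Notation s := (frep W).
Local Notation rs := (rep_prod r s).
Local Notation n := (rdim r).
Local Notation m := (rdim s).
Local Notation U := (@fmap _ _ _ _ Fr).
Local Notation cw := (@fcov _ _ _ _ W).
Local Notation cv := (@fcov _ _ _ _ Fr).

(** A frame of [F] has coefficients in [K(E (+) A)].  On the corner only the columns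
    of these coefficients matter, and columns are vectors of [E (+) A], on which a
    frame [W] is available. *)
Definition wcol (e : A) (T : K) : A ^^ m := fmap W (cop T ((0, e) : EA)).

Lemma wcol_lin e : linear (wcol e).
Proof. by move=> c S T; rewrite /wcol -(@fmap_lin _ _ _ _ W). Qed.

Lemma wcol_mop e c T : wcol e (T ** mop c) = wcol (c ** e) T.
Proof. by []. Qed.

Lemma wcol_act g e T : tact (r := s) g (wcol e T) = wcol (aact g e) (aact g T).
Proof.
rewrite /wcol -fmap_act; congr (fmap W _).
have -> : cop (aact g T) ((0, aact g e) : EA) =
    mact g (cop T (mact g^-1%g ((0, aact g e) : EA))) by [].
congr (mact g (cop T _)); rewrite [RHS]/= /sum2_act /=.
by rewrite (lin0 (@mact_lin _ _ A E _)) -aact_mul mulVg aact1.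
Qed.

Definition corner_unit (x : Cor) : A := sval (cid (stable x x 0)).
(** Apply [wcol] to each coordinate; the result is independent of the unit [e] with
    [x m_e = x] ([corner_mapE]), hence linear and equivariant. *)
Definition corner_map (x : Cor) : A ^^ (n * m)%type :=
  spread (wcol (corner_unit x)) (U (cval x)).

Lemma corner_mapE x e : cval x |* mop e = cval x ->
  corner_map x = spread (wcol e) (U (cval x)).
Proof.
suff ind e1 e2 : cval x |* mop e1 = cval x -> e1 ** e2 = e1 ->
    spread (wcol e1) (U (cval x)) = spread (wcol e2) (U (cval x)).
  move=> xe; rewrite /corner_map; have [xu _ _ _] := svalP (cid (stable x x 0)).
  (* two units are compared through a right unit [e2] of both *)
  have [e2 [_ ue _ ee]] := au2 hA (corner_unit x) e.
  by rewrite (ind _ e2 xu ue) (ind _ e2 xe ee).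
move=> xe ee; apply: fs_ext => -[i j].
rewrite !spreadE; [|exact: wcol_lin..].
have Te : U (cval x) i ** mop e1 = U (cval x) i by rewrite -{2}xe fmap_ract.
by rewrite -[in RHS]Te wcol_mop ee.
Qed.

Definition vw := sval (cid (frame_fun W)).
Lemma vwP phi : Theta phi -> cw phi (vw phi).
Proof. exact: (svalP (cid (frame_fun W))). Qed.

Lemma vw_uniq phi p : cw phi p -> vw phi = p.
Proof. by move=> h; apply: (fcov_uniq _ h); apply: vwP; exact: fcov_Theta h. Qed.

Definition vrow b T := vw (row b T).

Lemma vrowP b T : cw (row b T) (vrow b T).
Proof. exact/vwP/row_Theta. Qed.

Lemma vrow_lin b : linear (vrow b).
Proof.
move=> c S T; apply: vw_uniq; have := fcovL c (vrowP b S) (vrowP b T).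
congr fcov; apply/funext => x.
by rewrite row_lin.
Qed.

Lemma vrow_lact a b T : vrow (a ** b) T = pow_lact a (vrow b T).
Proof.
apply: vw_uniq; have := fcov_mul a (vrowP b T).
by congr fcov; apply/funext => x; rewrite /row amulA.
Qed.

Lemma vrow_mop e b T : vrow e (mop b ** T) = vrow (e ** b) T.
Proof.
apply: vw_uniq; have := vrowP (e ** b) T.
by congr fcov; apply/funext => x; rewrite /row kmulE mop_col amulA.
Qed.

Lemma vrow_act g b T : tdual (r := s) g (vrow b T) = vrow (aact g b) (aact g T).
Proof.
apply/esym/vw_uniq; have := fcov_act g (vrowP b T).
by congr fcov; apply/funext => x; rewrite /row aactM.
Qed.

(** If [p] represents [phi], the restriction of [m_b phi] to the corner is
    represented by the rows [m_b p_i], expanded in the frame of [E (+) A]. *)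
Definition corner_cov (psi : Cor -> A) (q : A ^^ (n * m)%type) :=
  exists b phi p, [/\ cv phi p, is_corner_fun b phi psi & q = spread (vrow b) p].

Lemma pow_fun_corner e b (p y : K ^^ n) : pow_fun (spread (vrow b) p) (spread (wcol e) y) =
  b ** (cop (pow_fun p y : K) ((0, e) : EA)).2.
Proof.
apply: (dot_spread (h := @amul _ _ K) (h' := @amul _ _ A) (t := fun T : K => row b T ((0, e) : EA))).
- exact: k_bilin.
- exact: a_bilin.
- exact: vrow_lin.
- exact: wcol_lin.
- exact: row_lin.
move=> S T; exact: (fcovE (vrowP b S)).
Qed.

(** Matrix multiplication: a row times a column is the entry of the product. *)
Lemma corner_covE psi q x : corner_cov psi q -> pow_fun q (corner_map x) = psi x.
Proof.
move=> [b [phi [p [hp hpsi ->]]]]; have [e [xe _ _ _]] := stable x x 0.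
rewrite (corner_mapE xe) pow_fun_corner (fcovE hp).
have psi_e : psi x ** e = psi x.
  have ht : @Theta _ _ A Cor psi by exists b, phi; split=> //; exact: fcov_Theta hp.
  by rewrite -(Theta_ract ht); congr psi; apply: cval_inj.
rewrite -[RHS]psi_e.
have := congr1 (fun T : K => (cop T ((0, e) : EA)).2) (hpsi x).
by rewrite /= => ->.
Qed.

(** Expand [phi] along points [y_j] of [F], then the rows [chi_j] of
    [m_b phi(y_j)] along points [z_i] of [E (+) A].  The points of the corner are
    [y_j (col_op (z_i) e) m_e], and [psi] takes the value [chi_j(z_i)] there. *)
Lemma corner_cov_expands psi q : corner_cov psi q -> expands corner_cov psi q.
Proof.
move=> [b [phi [p [hp hpsi ->]]]].
have [l [y [phi' [p' [hp' pE]]]]] := fcov_loc hp.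
pose chi j := row b (phi (y j)).
have [|l' [z [tau [u [hu uP]]]]] :=
    fcov_loc_seq (F := W) (s := [seq (chi j, vrow b (phi (y j))) | j <- enum 'I_l]).
  by move=> _ /mapP [j _ ->]; exact: vrowP.
have chiE j x : chi j x = \sum_(i < l') chi j (z i) ** tau i x.
  apply: (fcov_loc_fun (F := W) (vrowP b (phi (y j))) hu).
  by apply: (uP (chi j, vrow b (phi (y j)))); rewrite (map_f (fun j => (chi j, _))) // mem_enum.
have [S SP] := pair_seq (fun j i => chi j (z i)).
have [e eP] := au_seq hA S.
have chie j i : chi j (z i) ** e = chi j (z i) by have [] := eP _ (SP j i).
have htau i : @Theta _ _ A EA (tau i) by exact: fcov_Theta (hu i).
have /choice [Rop RopE] := fun i => row_op_exists e (htau i).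
have hX j i : corner_set hA ((y j |* col_op (z i) e) |* mop e) by do 2 eexists.
pose X j i : Cor := mk_corner (hX j i).
have hc j i : cv (fun v => Rop i ** phi' j v) (pow_lact (Rop i) (p' j)) by exact: fcov_mul.
have /choice [psi' hpsi'] : forall ji : 'I_l * 'I_l', exists psi : Cor -> A,
    is_corner_fun e (fun v => Rop ji.2 ** phi' ji.1 v) psi.
  by move=> ji; apply: corner_fun_exists; exact: fcov_Theta (hc _ _).
have psiX j i : psi (X j i) = chi j (z i).
  apply: (@mop_inj _ _ A hA E); apply: cop_inj; apply/funext => v.
  rewrite hpsi (Theta_ract (fcov_Theta hp)) (Theta_ract (fcov_Theta hp)).
  rewrite !kmulE !mop_col col_opE; congr pair.
  rewrite -[LHS]/(chi j (z i |* (e ** (e ** v.2)))).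
  rewrite [LHS](Theta_ract (row_Theta b (phi (y j)))).
  by rewrite -[row _ _ _]/(chi j (z i)) !amulA !chie.
have -> : spread (vrow b) p = \sum_(j < l) \sum_(i < l')
    pow_lact (psi (X j i)) (spread (vrow e) (pow_lact (Rop i) (p' j))).
  apply: fs_ext => -[k k']; rewrite spreadE; last exact: vrow_lin.
  rewrite {1}pE fs_sum (lin_sum _ _ _ (vrow_lin b)) fs_sum fs_sum; apply: eq_bigr => j _.
  rewrite fs_sum -[pow_lact _ _ k]/(phi (y j) ** p' j k).
  have -> T : vrow b (phi (y j) ** T) =
      \sum_(i < l') pow_lact (chi j (z i)) (vrow e (Rop i ** T)).
    apply: vw_uniq.
    have := fcov_sum (fun i => chi j (z i)) (fun i => vrowP e (Rop i ** T)).
    congr fcov; apply/funext => x.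
    rewrite -[RHS]/(chi j (cop T x)) chiE; apply: eq_bigr => i _.
    by rewrite /row kmulE RopE /= !amulA !chie.
  rewrite fs_sum; apply: eq_bigr => i _.
  rewrite psiX -[RHS]/(_ ** spread _ _ (k, k')) spreadE; last exact: vrow_lin.
  by [].
apply: expands_big => j; apply: expands_big => i.
apply: (@expands1 _ _ _ _ _ corner_cov psi _ (psi' (j, i))).
exists e, (fun v => Rop i ** phi' j v), (pow_lact (Rop i) (p' j)); split=> //.
exact: (hpsi' (j, i)).
Qed.

Lemma corner_frame : frame Cor.
Proof.
apply: (@Frame _ _ A Cor rs corner_map corner_cov).
- move=> c x y; have [e [xe ye _ _]] := stable x y 0.
  rewrite (corner_mapE xe) (corner_mapE ye).
  have h : cval (c *: x + y : Cor) |* mop e = cval (c *: x + y : Cor).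
    by rewrite [cval _](@cval_linear _ _ _ hA E F) ((ract_bilin F).1 _) xe ye.
  rewrite (corner_mapE h) [cval _](@cval_linear _ _ _ hA E F) (@fmap_lin _ _ _ _ Fr).
  exact: (spread_linear (wcol_lin e)).
- move=> x c; have [e [xe _ ec ce]] := stable x x c.
  have h : cval (x |* c : Cor) |* mop e = cval (x |* c : Cor).
    by rewrite [LHS](@ractA _ _ K F) -mop_mul ce.
  rewrite (corner_mapE xe) (corner_mapE h).
  have -> : U (cval (x |* c : Cor)) = pow_ract (U (cval x)) (mop c) by exact: fmap_ract.
  apply: fs_ext => -[i j]; rewrite spreadE; last exact: wcol_lin.
  rewrite -[RHS]/(_ ** _) spreadE; last exact: wcol_lin.
  rewrite -[pow_ract _ _ i]/(U (cval x) i ** mop c) wcol_mop ce -{1}ec.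
  by rewrite /wcol -base_ract K_ract fmap_ract.
- move=> g x; have [e [xe _ _ _]] := stable x x 0.
  have h : cval (mact g x : Cor) |* mop (aact g e) = cval (mact g x : Cor).
    by rewrite mop_act -[LHS](@mact_ract _ _ K F) xe.
  rewrite (corner_mapE xe) (corner_mapE h).
  have -> : U (cval (mact g x : Cor)) = tact g (U (cval x)) by exact: fmap_act.
  apply/esym/tm_spread; try exact: wcol_lin; try exact: aact_lin; try exact: rmu_lin.
  by move=> T; exact: wcol_act.
- move=> psi q [b [phi [p [hp hpsi _]]]]; exists b, phi; split=> //.
  exact: fcov_Theta hp.
- move=> psi [b [phi [hphi hpsi]]]; have [p hp] := fcov_total Fr hphi.
  by exists (spread (vrow b) p), b, phi, p.
- exists 0, (fun=> 0), 0; split; first exact: fcov0.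
    move=> x; rewrite (lin0 (@mop_linear _ _ A hA E)).
    exact/esym/(lin0 (k_bilin.1 _)).
  exact/esym/(lin0 (spread_linear (vrow_lin 0))).
- move=> c psi q psi' q' [b [phi [p [hp hpsi ->]]]] [b' [phi' [p' [hp' hpsi' ->]]]].
  have [e [eb _ eb' _]] := au2 hA b b'.
  exists e, (fun x => c *: (mop b ** phi x) + mop b' ** phi' x),
    (c *: pow_lact (mop b) p + pow_lact (mop b') p'); split.
  + by apply: fcovL; exact: fcov_mul.
  + move=> x; rewrite mop_linear hpsi hpsi' k_bilin.2.
    by rewrite !(@amulA _ _ K) -!mop_mul eb eb'.
  apply: fs_ext => -[i j]; rewrite fsLE !spreadE; [|exact: vrow_lin..].
  rewrite fsLE -[pow_lact _ p i]/(mop b ** p i) -[pow_lact _ p' i]/(mop b' ** p' i).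
  by rewrite (vrow_lin e) fsLE !vrow_mop eb eb'.
- move=> a psi q [b [phi [p [hp hpsi ->]]]]; exists (a ** b), phi, p; split=> //.
    by move=> x; rewrite !mop_mul hpsi (@amulA _ _ K).
  apply: fs_ext => -[i j]; rewrite spreadE; last exact: vrow_lin.
  by rewrite -[LHS]/(_ ** _) spreadE ?vrow_lact //; exact: vrow_lin.
- move=> g psi q [b [phi [p [hp hpsi ->]]]].
  exists (aact g b), (fun x => aact g (phi (mact g^-1%g x))), (tdual g p); split.
  + exact: fcov_act.
  + by move=> x; rewrite !mop_act hpsi aactM.
  apply: tm_spread; try exact: vrow_lin; try exact: aact_lin; try exact: rnu_lin.
  by move=> T; exact: vrow_act.
- by move=> psi q hq x; exact: corner_covE.
- exact: corner_cov_expands.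
Qed.

End Frame.

End CornerModules.

(** * Closure properties *)

Theorem theorem6p1 (R : realType) (G : groupType) :
  (* (a) *)
  ((forall (A : galg R G) (n : choiceType) (gamma : plain_action A n)
      (mu : G -> fspow n (R[i])^o -> fspow n (R[i])^o),
      discrete_alg_au A -> is_tensor_action gamma mu ->
      in_C (plain_mod gamma)) /\
   (finite_set [set: G] ->
    forall (A : galg R G) (n : choiceType) (gamma : plain_action A n),
      discrete_alg_au A -> in_C (plain_mod gamma))) /\
  (* (b) *)
  ((forall (A : galg R G) (I : choiceType) (E : I -> fmod A),
      discrete_alg_au A -> (forall i, in_C (E i)) -> in_C (dsum E)) /\
   (forall (A B : galg R G) (pi : algHom A B) (E : fmod A),
      in_C E -> discrete_alg_au B -> in_C (itensor pi E)) /\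
   (forall (A B : galg R G) (E : fmod A) (F : fmod B),
      in_C E -> in_C F -> in_C (etensor E F)) /\
   (forall (A : galg R G) (hA : has_approximate_unit A) (E : fmod A)
      (F : fmod (corner_alg E)),
      in_C E -> in_C F -> in_C (corner hA F))).
Proof.
split; split.
- by move=> A n gamma mu [_ hA] hmu; exact: plain_inC hmu.
- move=> finG A n gamma [_ hA].
  apply: (inC_of_frame hA _ (finite_group_frame finG gamma hA)).
  exact: plain_left_units.
- move=> A I E [_ hA] hE; have [S] := dsum_sum E.
  have exF i : exists _ : frame (E i), True by have [F] := inC_frame (hE i); exists F.
  pose Fr i := projT1 (cid (exF i)).
  have [F] := sum_frame S Fr; apply: inC_of_frame => //.
  by apply: (sum_left_units S) => i; exact: inC_left_units.
split; [|split].
- move=> A B pi E hE [_ hB]; have [Fr] := inC_frame hE.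
  apply: (inC_of_frame hB _ (itens_frame pi hB Fr)).
  exact: itens_left_units hB (inC_left_units hE).
- move=> A B E F hE hF; have [[Fr] [Fs]] := (inC_frame hE, inC_frame hF).
  have [[[_ hA] _ _ _ _] [[_ hB] _ _ _ _]] := (hE, hF).
  apply: (inC_of_frame (talg_au hA hB) _ (etens_frame Fr Fs)).
  exact: etens_left_units (inC_left_units hE) (inC_left_units hF).
- move=> A hA E F hE hF; have [[Fr] [Fs]] := (inC_frame hE, inC_frame hF).
  have [W] := sum2_frame Fr (self_frame hA).
  have L := sum2_left_units (inC_left_units hE) (self_left_units hA).
  apply: (inC_of_frame hA _ (corner_frame hA W Fs)).
  exact: corner_left_units L (inC_left_units hF).
Qed.
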